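(* Fix an integer $d \geq 2$. For each $n \ge 1$ let $\mathbf{X}^{(1)}, \mathbf{X}^{(2)}, \ldots, \mathbf{X}^{(n)}$ be independent random $d$-dimensional vectors each having independent Exponential$(1)$ coordinates, let $\varphi_n$ denote the minimum $\ell^1$-norm of any maximum of these vectors, and (for $n$ large enough that the iterated logarithms are defined) set $$\varphi_n^{\circ} := (\mathrm{L}_2 n)\bigl(\varphi_n - [\mathrm{L} n - \mathrm{L}_3 n - \mathrm{L}(d-1)]\bigr).$$ Then, as $n \to \infty$, $\varphi_n^{\circ}$ converges in distribution to $-G$, where $G$ has a Gumbel distribution with location $-\frac{\mathrm{L}[(d-1)!]}{d-1}$ and scale $\frac{1}{d-1}$; moreover, $$d_{\mathrm{K}}\bigl(\mathcal{L}(\varphi_n^{\circ}), \mathcal{L}(-G)\bigr) = O\bigl((\mathrm{L}_2 n)^{-1/2}\, \mathrm{L}_3 n\bigr) \quad \text{as } n \to \infty.$$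
   Context: $\mathrm{L} = \mathrm{L}_1$ denotes the natural logarithm and $\mathrm{L}_k$ its $k$-th iterate (e.g. $\mathrm{L}_2 n = \ln\ln n$, $\mathrm{L}_3 n = \ln\ln\ln n$). For $\mathbf{x},\mathbf{y}\in\mathbb{R}^d$, $\mathbf{x} \prec \mathbf{y}$ means $x_j < y_j$ for every $j \in \{1,\ldots,d\}$. A maximum of $\{\mathbf{X}^{(1)},\ldots,\mathbf{X}^{(n)}\}$ is an observation $\mathbf{X}^{(k)}$ ($1\le k\le n$) such that $\mathbf{X}^{(k)} \not\prec \mathbf{X}^{(i)}$ for all $1 \le i \le n$. The $\ell^1$-norm is $\|\mathbf{x}\| = \sum_{j=1}^d |x_j|$. If $G_0$ is standard Gumbel (distribution function $x \mapsto e^{-e^{-x}}$, $x\in\mathbb{R}$), then for $m\in\mathbb{R}$ and $s>0$ the random variable $m + sG_0$ is said to have a Gumbel distribution with location $m$ and scale $s$. $\mathcal{L}(Y)$ is the distribution of the random variable $Y$. The Kolmogorov distance between probability measures $\mu_1,\mu_2$ on $\mathbb{R}$ with distribution functions $F_1,F_2$ is $d_{\mathrm{K}}(\mu_1,\mu_2) := \sup_{t\in\mathbb{R}}|F_1(t)-F_2(t)|$. *)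

(* Defs.v *)
From HB Require Import structures.
From mathcomp Require Import all_boot all_order all_algebra.
From mathcomp Require Import all_classical all_reals all_analysis.
From mathcomp Require Import measurable_realfun.
Import Order.TTheory GRing.Theory Num.Theory.
Import numFieldNormedType.Exports.

Set Implicit Arguments.
Unset Strict Implicit.
Unset Printing Implicit Defensive.

Local Open Scope classical_set_scope.
Local Open Scope ring_scope.

Definition iterlog (R : realType) (k : nat) (x : R) : R := iter k (@ln R) x.

Section maxima.
Context {R : realType} {d : nat}.
Implicit Types x y : d.-tuple R.

Definition strictly_below x y : bool := [forall j, tnth x j < tnth y j].

Definition l1norm x : R := \sum_(j < d) `|tnth x j|.

Definition is_maximum n (x : 'I_n -> d.-tuple R) (k : 'I_n) : bool :=
  [forall i, ~~ strictly_below (x k) (x i)].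

(* For 0 < n and 0 < d this infimum is attained, see
   [min_maxima_norm_attained]; otherwise there is no maximum and it is 0. *)
Definition min_maxima_norm n (x : 'I_n -> d.-tuple R) : R :=
  inf [set l1norm (x k) | k in [set k | is_maximum x k]].

Lemma exists_maximum n (x : 'I_n -> d.-tuple R) : (0 < n)%N -> (0 < d)%N ->
  exists k, is_maximum x k.
Proof.
case: n x => // n x _ d0.
have [k _ kmax] := @arg_maxP _ R _ ord0 xpredT
  (fun k => \sum_(j < d) tnth (x k) j) isT.
exists k; apply/forallP => i; apply/negP => /forallP ki.
have := kmax i isT; rewrite /= leNgt => /negP; apply; apply: ltr_sum => //.
by apply/hasP; exists (Ordinal d0) => //; rewrite mem_index_enum.
Qed.

Lemma min_maxima_norm_attained n (x : 'I_n -> d.-tuple R) :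
    (0 < n)%N -> (0 < d)%N ->
  exists2 k, is_maximum x k & min_maxima_norm x = l1norm (x k) /\
    forall i, is_maximum x i -> l1norm (x k) <= l1norm (x i).
Proof.
move=> n0 d0; have [k0 k0max] := exists_maximum x n0 d0.
have [k kmax kmin] := @arg_minP _ R _ k0 (is_maximum x)
  (fun k => l1norm (x k)) k0max.
exists k => //; split=> [|i /kmin//].
apply/eqP; rewrite eq_le; apply/andP; split.
  apply: ge_inf; last by exists k.
  by exists (l1norm (x k)) => _ [i /kmin + <-].
by apply: lb_le_inf; [exists (l1norm (x k)), k|move=> _ [i /kmin + <-]].
Qed.

End maxima.

Section min_maxima_norm_measurable.
Context {dT} {T : measurableType dT} {R : realType} {d n : nat}.
Variable X : 'I_n -> {mfun T >-> d.-tuple R}.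

Let measurable_forall (I : finType) (b : I -> T -> bool) :
  (forall i, measurable_fun setT (b i)) ->
  measurable_fun setT (fun w => [forall i, b i w]).
Proof.
move=> mb; apply: (measurable_fun_bool true); rewrite setTI.
rewrite (_ : _ @^-1` _ = \bigcap_(i in [set: I]) (b i @^-1` [set true])).
  rewrite -[X in measurable X]setCK setC_bigcap; apply: measurableC.
  apply: fin_bigcup_measurable => [|i _]; first exact: finite_finset.
  by apply: measurableC; rewrite -[X in measurable X]setTI; exact: mb.
by apply/seteqP; split=> w /=; [move/forallP => bw i _|move=> bw;
  apply/forallP => i]; exact: bw.
Qed.

Let measurable_coord i j : measurable_fun setT (fun w => tnth (X i w) j).
Proof.
exact: (measurableT_comp (measurable_tnth j) (@measurable_funPT _ _ _ _ (X i))).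
Qed.

Lemma measurable_min_maxima_norm :
  measurable_fun setT (fun w => min_maxima_norm (fun i => X i w)).
Proof.
have [n0|n0] := posnP n.
  rewrite (_ : (fun _ => _) = cst (inf set0)); first exact: measurable_cst.
  apply/funext => w; rewrite /min_maxima_norm; congr inf.
  by rewrite -subset0 => ? [k]; have := ltn_ord k; rewrite {2}n0.
have [d0|d0] := posnP d.
  rewrite (_ : (fun _ => _) = cst (inf set0)); first exact: measurable_cst.
  apply/funext => w; rewrite /min_maxima_norm; congr inf.
  rewrite -subset0 => ? [k /forallP /(_ k) /negP + _]; apply.
  by apply/forallP => j; have := ltn_ord j; rewrite {2}d0.
move=> mT; apply: (measurability _ (RGenOInfty.measurableE R)) => //.
move=> /= _ [_ [t ->] <-]; rewrite setTI.
pose b k w := is_maximum (fun i => X i w) k ==> (t < l1norm (X k w)).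
rewrite (_ : _ @^-1` _ = (fun w => [forall k, b k w]) @^-1` [set true]).
  rewrite -[X in measurable X]setTI; apply: measurable_forall => // k.
  rewrite (_ : b k = fun w => ~~ (is_maximum (fun i => X i w) k) ||
    (t < l1norm (X k w))); last by apply/funext => w; rewrite /b implybE.
  apply: measurable_or.
    apply: measurable_neg; apply: measurable_forall => i.
    apply: measurable_neg; apply: measurable_forall => j.
    exact: measurable_fun_ltr.
  apply: measurable_fun_ltr; first exact: measurable_cst.
  apply: measurable_sum => j.
  exact: measurableT_comp.
apply/seteqP; split=> w /=; rewrite in_itv/= andbT;
  have [k kmax [-> kmin]] := min_maxima_norm_attained (fun i => X i w) n0 d0.
  by move=> tk; apply/forallP => i; apply/implyP => /kmin; exact: lt_le_trans.
by move=> /forallP /(_ k) /implyP; exact.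
Qed.

End min_maxima_norm_measurable.

Section independence.
Context {d d'} {T : measurableType d} {T' : measurableType d'} {R : realType}.

Definition mutually_independent (P : probability T R) (I : finType)
    (X : I -> {RV P >-> T'}) : Prop :=
  forall (J : {set I}) (A : I -> set T'), (forall i, measurable (A i)) ->
    P (\bigcap_(i in [set` J]) (X i @^-1` A i)) =
    (\prod_(i in J) P (X i @^-1` A i))%E.

End independence.
Arguments mutually_independent {d d' T T' R} P {I} X.

Section laws.
Context {R : realType}.

(* The equality is only meant on Borel sets: off them both sides are junk. *)
Definition has_exponential_distribution d (T : measurableType d)
    (P : probability T R) (rate : R) (X : {RV P >-> R}) : Prop :=
  forall A : set R, measurable A ->
    distribution P X A = exponential_prob rate A.

Definition standard_gumbel d (T : measurableType d) (P : probability T R)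
    (G0 : {RV P >-> R}) : Prop :=
  forall x : R, cdf G0 x = (expR (- expR (- x)))%:E.

Definition has_gumbel_distribution d (T : measurableType d)
    (P : probability T R) (m s : R) (G : {RV P >-> R}) : Prop :=
  exists2 G0 : {RV P >-> R}, standard_gumbel G0 &
    forall w, G w = m + s * G0 w.

Definition distribution_function (mu : probability R R) (t : R) : R :=
  fine (mu `]-oo, t]%classic).

Definition kolmogorov_distance (mu1 mu2 : probability R R) : R :=
  sup [set `|distribution_function mu1 t - distribution_function mu2 t|
      | t in [set: R]].

Definition cvg_in_distribution (mu_ : nat -> probability R R)
    (mu : probability R R) : Prop :=
  forall t : R, {for t, continuous (distribution_function mu)} ->
    distribution_function (mu_ n) t @[n --> \oo] --> distribution_function mu t.

End laws.
Arguments has_exponential_distribution {R d T} P rate X.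
Arguments standard_gumbel {R d T} P G0.
Arguments has_gumbel_distribution {R d T} P m s G.

Definition coordinate dT (T : measurableType dT) (R : realType) (d : nat)
  (X : {mfun T >-> d.-tuple R}) (j : 'I_d) (w : T) : R := tnth (X w) j.

Section coordinate_mfun.
Context {dT} {T : measurableType dT} {R : realType} {d : nat}.
Variables (X : {mfun T >-> d.-tuple R}) (j : 'I_d).

Let measurable_coordinate : measurable_fun setT (coordinate X j).
Proof.
exact: (measurableT_comp (measurable_tnth j) (@measurable_funPT _ _ _ _ X)).
Qed.

HB.instance Definition _ :=
  isMeasurableFun.Build _ _ _ _ (coordinate X j) measurable_coordinate.

End coordinate_mfun.

Section phi.
Context {dT} {T : measurableType dT} {R : realType} {d n : nat}.
Variable X : 'I_n -> {mfun T >-> d.-tuple R}.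

Definition phi (w : T) : R := min_maxima_norm (fun i => X i w).

HB.instance Definition _ :=
  isMeasurableFun.Build _ _ _ _ phi (measurable_min_maxima_norm X).

(* Meaningful only for n large enough: [ln] is 0 off the positive reals. *)
Definition phi_circ (w : T) : R :=
  iterlog 2 n%:R *
  (phi w - (iterlog 1 n%:R - iterlog 3 n%:R - ln d.-1%:R)).

Let measurable_phi_circ : measurable_fun setT phi_circ.
Proof.
apply: measurable_funM; first exact: measurable_cst.
by apply: measurable_funB; [exact: measurable_funPT|exact: measurable_cst].
Qed.

HB.instance Definition _ :=
  isMeasurableFun.Build _ _ _ _ phi_circ measurable_phi_circ.

End phi.

(* Main.v *)
Require Import Defs.
From HB Require Import structures.
From mathcomp Require Import all_boot all_order all_algebra.
From mathcomp Require Import all_classical all_reals all_analysis.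
From mathcomp Require Import measurable_realfun.
From mathcomp Require Import ring lra.
Import Order.TTheory GRing.Theory Num.Theory.
Import numFieldNormedType.Exports.

(** The minimum norm of a maximum exceeds a level [r] when every sample point of
norm at most [r] is dominated. The sample has about [n * r ^ (d - 1) / (d - 1)!
* expR (- r)] points per unit of height near [r], and such a point is left
undominated with probability about [expR (- n * expR (- r))]. The product of the
two, integrated over the heights below [r], is about
[lam = r ^ (d - 1) / (d - 1)! * expR (- n * expR (- r))]. At the level
[r = L n - L_3 n - L (d - 1) + t / L_2 n] it tends to
[expR ((d - 1) * t) / (d - 1)!]. The undominated points are nearly independent,
so their number is nearly Poisson and none is present with probability about
[expR (- lam)], which is the probability that the reflected Gumbel variable
exceeds [t].

For the rate, only the points of a thin slab just below [r] are looked at, and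
they are compared with the sample points above [r], which are independent of the
remaining ones once it is known which they are: a slab point is uncovered when no point above
[r] dominates it. Conditioning on the points above [r] makes the probability
that the slab is covered explicit ([void_probability]), and a second order
expansion of the exponential reduces it to the first two moments of the
uncovered mass ([covering_upper], [covering_lower]). The mean is an integral
over the height, evaluated by an antiderivative ([critical_mean_le],
[critical_mean_ge]). In the second moment two slab points interact through the
orthant above their join, which is negligible unless they are close
([second_moment_uncovered_le]). Passing from the slab to all maxima costs the
probability that a point below the slab is undominated ([covering_sub]). The
outcome is [min_norm_poisson].

With [w] the eighth root of [L_2 n] and a slab of width [w ^- 7], every error is
[O(w ^- 4)], that is [O((L_2 n) ^ (- 1 / 2))], as long as [t] is at least [- w]
and [lam] at most [w] ([min_norm_critical]). Outside this window both
distribution functions are within [O(w ^- 4)] of 0 or of 1, by monotonicity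
([min_norm_uniform]). The Kolmogorov distance is thus [O((L_2 n) ^ (- 1 / 2))],
below the claimed rate since [L_3 n] is eventually at least 1, and it tends to 0,
whence the convergence in distribution. *)

Local Open Scope classical_set_scope.
Local Open Scope ring_scope.

Set Implicit Arguments.
Unset Strict Implicit.
Unset Printing Implicit Defensive.

(** * Product laws on tuples *)

Section product_law.
Context {dE} {E : measurableType dE} {R : realType}.

Definition iid_law (nu : probability E R) n (Q : probability (n.-tuple E) R) :=
  forall A : 'I_n -> set E, (forall i, measurable (A i)) ->
    (Q [set t | forall i, A i (tnth t i)] = \prod_(i < n) nu (A i))%E.

Lemma measurable_box n (A : 'I_n -> set E) : (forall i, measurable (A i)) ->
  measurable [set t : n.-tuple E | forall i, A i (tnth t i)].
Proof.
move=> mA.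
rewrite (_ : [set _ | _] = \bigcap_(i in [set: 'I_n]) ((@tnth n E)^~ i @^-1` A i)).
  apply: fin_bigcap_measurable => [|i _]; first exact: finite_finset.
  by rewrite -[X in measurable X]setTI; exact: measurable_tnth.
by apply/seteqP; split=> t /= tA i; [move=> _|]; exact: tA.
Qed.

(** Boxes are stable under intersection and generate the product sigma-algebra. *)
Lemma tuple_measure_unique n (Q1 Q2 : probability (n.-tuple E) R) :
  (forall A : 'I_n -> set E, (forall i, measurable (A i)) ->
    Q1 [set t | forall i, A i (tnth t i)] =
    Q2 [set t | forall i, A i (tnth t i)]) ->
  forall B, measurable B -> Q1 B = Q2 B.
Proof.
move=> Q12 B mB.
pose G := [set C : set (n.-tuple E) | exists2 A : 'I_n -> set E,
  forall i, measurable (A i) & C = [set t | forall i, A i (tnth t i)]].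
apply: (measure_unique G (fun=> setT)) => //.
- apply/seteqP; split.
  + apply: smallest_sub; first exact: smallest_sigma_algebra.
    move=> C; rewrite -bigcup_seq => -[i _ [A mA <-]].
    apply: sub_sigma_algebra; exists (fun j => if j == i then A else setT).
      by move=> j; case: ifP.
    rewrite setTI; apply/seteqP; split=> t /=.
      by move=> At j; case: ifP => // /eqP ->.
    by move=> /(_ i); rewrite eqxx.
  + apply: smallest_sub; first exact: sigma_algebra_measurable.
    by move=> _ [A mA ->]; exact: measurable_box.
- move=> _ _ [A mA ->] [A' mA' ->]; exists (fun i => A i `&` A' i).
    by move=> i; exact: measurableI.
  apply/seteqP; split=> t /=; first by move=> [h1 h2] i; split.
  by move=> h; split=> i; have [] := h i.
- move=> _; exists (fun=> setT) => //.
  by apply/seteqP; split.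
- by rewrite bigcup_const//; exists 0%N.
- by move=> _ [A mA ->]; exact: Q12.
- by move=> _; rewrite (le_lt_trans (probability_le1 _ _))// ltry.
Qed.

Variables (nu : probability E R) (n : nat) (Q : probability (n.-tuple E) R).
Hypothesis iidQ : iid_law nu Q.

Definition splice (S : {set 'I_n}) (z : n.-tuple E * n.-tuple E) : n.-tuple E :=
  [tuple if i \in S then tnth z.1 i else tnth z.2 i | i < n].

Lemma measurable_splice S : measurable_fun setT (splice S).
Proof.
apply/measurable_fun_tnthP => i.
rewrite (_ : _ \o _ = fun z : n.-tuple E * n.-tuple E =>
  if i \in S then tnth z.1 i else tnth z.2 i); last first.
  by apply/funext => z /=; rewrite tnth_mktuple.
by case: (i \in S); [apply: (@measurableT_comp _ _ _ _ _ _
    (fun t : n.-tuple E => tnth t i) _ fst)|apply: (@measurableT_comp _ _ _ _ _ _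
    (fun t : n.-tuple E => tnth t i) _ snd)] => //; exact: measurable_tnth.
Qed.

HB.instance Definition _ S :=
  isMeasurableFun.Build _ _ _ _ (splice S) (measurable_splice S).

(** Resampling the coordinates outside [S] does not change a product law: this
is how every conditioning on part of a sample is carried out below. *)
Lemma integral_splice (S : {set 'I_n}) (f : n.-tuple E -> \bar R) :
  measurable_fun setT f -> (forall t, 0 <= f t)%E ->
  (\int[Q]_t f t = \int[Q]_x \int[Q]_y f (splice S (x, y)))%E.
Proof.
move=> mf f0.
have -> : (\int[Q]_t f t = \int[distribution (Q \x Q)%E (splice S)]_t f t)%E.
  apply: eq_measure_integral => B mB _.
  apply: tuple_measure_unique => // A mA.
  rewrite iidQ//= /distribution /pushforward.
  rewrite (_ : _ @^-1` _ =
    [set x | forall i, (if i \in S then A i else setT) (tnth x i)] `*`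
    [set x | forall i, (if i \in S then setT else A i) (tnth x i)]); last first.
    apply/seteqP; split=> -[x y] /=.
      by move=> h; split=> i; have := h i; rewrite tnth_mktuple/=; case: ifP.
    by move=> -[h1 h2] i; have := h1 i; have := h2 i; rewrite tnth_mktuple/=;
      case: ifP.
  have mAS i : measurable (if i \in S then A i else setT) by case: ifP.
  have mAC i : measurable (if i \in S then setT else A i) by case: ifP.
  rewrite product_measure1E;
    [|exact: (measurable_box mAS)|exact: (measurable_box mAC)].
  rewrite [X in _ = (X * _)%E](iidQ mAS) [X in _ = (_ * X)%E](iidQ mAC).
  rewrite -big_split/=; apply: eq_bigr => i _; case: ifP => _.
    by rewrite probability_setT mule1.
  by rewrite probability_setT mul1e.
rewrite ge0_integral_distribution// fubini_tonelli1//.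
  by apply: measurableT_comp => //; exact: measurable_splice.
by move=> z; exact: f0.
Qed.

Lemma iid_law_marginal i (A : set E) : measurable A ->
  Q [set t | A (tnth t i)] = nu A.
Proof.
move=> mA.
rewrite (_ : [set _ | _] =
    [set t | forall j, (if j == i then A else setT) (tnth t j)]); last first.
  apply/seteqP; split=> t /=; first by move=> At j; case: eqP => [->|].
  by move=> /(_ i); rewrite eqxx.
have mAj j : measurable (if j == i then A else setT) by case: ifP.
rewrite [LHS](iidQ mAj).
rewrite (bigD1 i)//= eqxx big1 ?mule1// => j /negPf ->.
exact: probability_setT.
Qed.

Lemma integral_marginal i (f : E -> \bar R) :
  measurable_fun setT f -> (forall t, 0 <= f t)%E ->
  (\int[Q]_t f (tnth t i) = \int[nu]_x f x)%E.
Proof.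
move=> mf f0.
pose mtn := isMeasurableFun.Build _ _ _ _ _ (@measurable_tnth _ E n i).
pose X : {mfun n.-tuple E >-> E} := HB.pack ((@tnth n E)^~ i) mtn.
rewrite -[LHS](@ge0_integral_distribution _ _ _ _ _ Q X)//.
by apply: eq_measure_integral => B mB _; exact: iid_law_marginal.
Qed.

Lemma iid_law_fine (A : 'I_n -> set E) : (forall i, measurable (A i)) ->
  fine (Q [set t | forall i, A i (tnth t i)]) = \prod_(i < n) fine (nu (A i)).
Proof.
move=> mA; rewrite (iidQ mA); apply: EFin_inj; rewrite -prodEFin.
rewrite (_ : (\prod_(i < n) (fine (nu (A i)))%:E = \prod_(i < n) nu (A i))%E).
  rewrite fineK// prode_fin_num// => i _; exact: fin_num_measure.
by apply: eq_bigr => i _; rewrite fineK// fin_num_measure.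
Qed.

End product_law.

(** * Void probabilities *)

Section void_probability.
Context {dE} {E : measurableType dE} {R : realType}.
Variables (nu : probability E R) (n : nat) (Q : probability (n.-tuple E) R).
Hypothesis iidQ : iid_law nu Q.
Variables (M H : set E) (rel : set (E * E)).
Hypotheses (mM : measurable M) (mH : measurable H) (mrel : measurable rel).
Hypothesis MH0 : M `&` H = set0.

(** In the application [rel] is strict domination, [H] lies above a level and [M]
is a slab just below it: a point of [M] is uncovered when no sample point above
the level dominates it. *)
Definition uncovered (t : n.-tuple E) : set E :=
  [set z | M z /\ forall i, H (tnth t i) -> ~ rel (z, tnth t i)].

Definition covering : set (n.-tuple E) :=
  [set t | forall i, ~ uncovered t (tnth t i)].

Definition hitting (t : n.-tuple E) : {set 'I_n} :=
  [set i | `[< H (tnth t i) >]]%SET.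

(** The chance for a sample point known to avoid [H] to fall in the uncovered
part of [M], which does not meet [H]. *)
Definition thinned_mass (t : n.-tuple E) : R :=
  fine (nu (uncovered t)) / (1 - fine (nu H)).

Let measurable_tnth_fst i : measurable_fun setT
  (fun p : n.-tuple E * E => tnth p.1 i).
Proof.
apply: (@measurableT_comp _ _ _ _ _ _ (fun t : n.-tuple E => tnth t i) _ fst).
  exact: measurable_tnth.
exact: measurable_fst.
Qed.

Lemma measurable_uncovered_graph :
  measurable [set p : n.-tuple E * E | uncovered p.1 p.2].
Proof.
pose N i := [set p : n.-tuple E * E | H (tnth p.1 i) /\ rel (p.2, tnth p.1 i)].
have mN i : measurable (N i).
  apply: measurableI.
    rewrite -[X in measurable X]setTI.
    exact: (measurable_tnth_fst i measurableT mH).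
  rewrite -[X in measurable X]setTI.
  have : measurable_fun setT (fun p : n.-tuple E * E => (p.2, tnth p.1 i)).
    apply/measurable_fun_pairP; split; last exact: measurable_tnth_fst.
    exact: measurable_snd.
  by apply.
rewrite (_ : [set _ | _] =
  (snd @^-1` M) `&` \bigcap_(i in [set: 'I_n]) ~` N i); last first.
  apply/seteqP; split=> -[t z] /=.
    by move=> [Mz h]; split => // i _ [Hi]; exact: h.
  by move=> [Mz h]; split => // i Hi ri; apply: (h i).
apply: measurableI.
  by rewrite -[X in measurable X]setTI; exact: measurable_snd.
apply: fin_bigcap_measurable => [|i _]; first exact: finite_finset.
exact: measurableC.
Qed.

Lemma measurable_uncovered t : measurable (uncovered t).
Proof.
have := @measurable_xsection _ _ _ _ _ t measurable_uncovered_graph.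
rewrite (_ : xsection _ _ = uncovered t)//.
by apply/seteqP; split=> z; rewrite /xsection/= inE.
Qed.

Lemma measurable_covering : measurable covering.
Proof.
pose g i (t : n.-tuple E) := (t, tnth t i).
have mg i : measurable_fun setT (g i).
  apply/measurable_fun_pairP; split; last exact: measurable_tnth.
  exact: measurable_id.
rewrite (_ : covering = \bigcap_(i in [set: 'I_n])
    (g i @^-1` ~` [set p | uncovered p.1 p.2])); last first.
  by apply/seteqP; split=> t /= h i; [move=> _|]; exact: h.
apply: fin_bigcap_measurable => [|i _]; first exact: finite_finset.
rewrite -[X in measurable X]setTI; apply: (mg i) => //.
by apply: measurableC; exact: measurable_uncovered_graph.
Qed.

Lemma measurable_uncovered_mass :
  measurable_fun setT (fun t => nu (uncovered t)).
Proof.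
have := @measurable_fun_xsection _ _ _ _ _ nu _ measurable_uncovered_graph.
rewrite (_ : _ \o _ = (fun t => nu (uncovered t)))//.
apply/funext => t /=; congr (nu _).
by apply/seteqP; split=> z; rewrite /xsection/= inE.
Qed.

Lemma measurable_thinned_mass : measurable_fun setT thinned_mass.
Proof.
apply: measurable_funM => //.
by apply: measurableT_comp => //; exact: measurable_uncovered_mass.
Qed.

Lemma hittingP t S : hitting t = S <->
  forall i, (if i \in S then H else ~` H) (tnth t i).
Proof.
split=> [<- i|h]; first by rewrite inE; case: ifPn => /asboolP.
apply/setP => i; rewrite inE; have := h i; case: ifPn => _ Hi; exact/asboolP.
Qed.

Lemma measurable_hitting S : measurable [set t | hitting t = S].
Proof.
rewrite (_ : [set _ | _] =
  [set t | forall i, (if i \in S then H else ~` H) (tnth t i)]); last first.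
  by apply/seteqP; split=> t /hittingP.
apply: (measurable_box (A := fun i => if i \in S then H else ~` H)) => i.
by case: ifP => _ //; exact: measurableC.
Qed.

Lemma measurable_card_hitting :
  measurable_fun setT (fun t => #|hitting t|%:R : R).
Proof.
rewrite (_ : (fun _ => _) = fun t => \sum_(i < n) \1_H (tnth t i)); last first.
  apply/funext => t; rewrite -sum1_card natr_sum big_mkcond/=.
  apply: eq_bigr => i _; rewrite inE indicE.
  by case: asboolP => hi; [rewrite mem_set|rewrite memNset].
apply: measurable_sum => i.
apply: (@measurableT_comp _ _ _ _ _ _ (\1_H : E -> R)).
  exact: measurable_indic.
exact: measurable_tnth.
Qed.

Let q := fine (nu H).
Hypothesis q1 : q < 1.

Let nuE (A : set E) : measurable A -> nu A = (fine (nu A))%:E.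
Proof. by move=> mA; rewrite fineK// fin_num_measure. Qed.

Let lt0q1 : 0 < 1 - q. Proof. by rewrite subr_gt0. Qed.

Let mass_disjoint (C : set E) : measurable C -> C `<=` M ->
  nu (~` (H `|` C)) = (1 - q - fine (nu C))%:E.
Proof.
move=> mC CM; rewrite probability_setC; last exact: measurableU.
rewrite measureU//.
  transitivity (1%:E - (q%:E + (fine (nu C))%:E))%E.
    by congr (_ - (_ + _))%E; exact: nuE.
  by rewrite -addrA -opprD.
by apply/seteqP; split=> // x [Hx /CM Mx]; rewrite -MH0.
Qed.

Let thinned_mass_itv (C : set E) : measurable C -> C `<=` M ->
  0 <= fine (nu C) / (1 - q) <= 1.
Proof.
move=> mC CM; rewrite divr_ge0 ?fine_ge0 ?(ltW lt0q1)//=.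
rewrite ler_pdivrMr// mul1r -subr_ge0 -lee_fin -mass_disjoint//.
Qed.

Lemma thinned_mass_ge0 t : 0 <= thinned_mass t.
Proof.
by have /andP[] := thinned_mass_itv (measurable_uncovered t)
  (fun z (h : uncovered t z) => h.1).
Qed.

Lemma thinned_mass_le1 t : thinned_mass t <= 1.
Proof.
by have /andP[] := thinned_mass_itv (measurable_uncovered t)
  (fun z (h : uncovered t z) => h.1).
Qed.

Let uncovered_by (S : {set 'I_n}) (x : n.-tuple E) : set E :=
  [set z | M z /\ forall i, i \in S -> ~ rel (z, tnth x i)].

Let uncovered_splice S x y : hitting (splice S (x, y)) = S ->
  uncovered (splice S (x, y)) = uncovered_by S x.
Proof.
move=> /hittingP hS; apply/seteqP; split=> z [Mz h]; split=> // i.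
  move=> iS; have := h i; have := hS i; rewrite tnth_mktuple iS/=.
  by move=> Hi; exact.
by have := hS i; rewrite tnth_mktuple/=; case: ifPn => // iS _ _; exact: h.
Qed.

Let slot (B : set E) (S : {set 'I_n}) (i : 'I_n) : set E :=
  if i \in S then setT else B.

Let measurable_slot B S i : measurable B -> measurable (slot B S i).
Proof. by rewrite /slot; case: ifP. Qed.

Let slotE (B : set E) S : measurable B ->
  Q [set y | forall i, slot B S i (tnth y i)] =
  ((fine (nu B)) ^+ (n - #|S|))%:E.
Proof.
move=> mB; rewrite iidQ => [|i]; last exact: measurable_slot.
have -> : (n - #|S| = #|~: S|)%N.
  by rewrite -{1}(card_ord n) -(cardsC S) addKn.
rewrite -prodr_const -prodEFin [RHS]big_mkcond/=; apply: eq_bigr => i _.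
by rewrite inE /slot; case: (i \in S) => /=; rewrite ?probability_setT// nuE.
Qed.

Let retention (t : n.-tuple E) : \bar R :=
  ((1 - thinned_mass t) ^+ (n - #|hitting t|))%:E.

Let retention_ge0 t : (0 <= retention t)%E.
Proof. by rewrite lee_fin exprn_ge0// subr_ge0 thinned_mass_le1. Qed.

Let sum_hitting (f : n.-tuple E -> \bar R) t :
  (f t = \sum_S (\1_[set t | hitting t = S] t)%:E * f t)%E.
Proof.
rewrite (bigD1 (hitting t))//= indicE mem_set// mul1e big1 ?adde0// => S /eqP hS.
by rewrite indicE memNset ?mul0e// => /= /esym.
Qed.

Let measurable_retention_hitting S : measurable_fun setT
  (fun t => (\1_[set t | hitting t = S] t)%:E * retention t)%E.
Proof.
rewrite (_ : (fun _ => _) = (fun t => (\1_[set t | hitting t = S] t)%:E *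
    ((1 - thinned_mass t) ^+ (n - #|S|))%:E)%E); last first.
  apply/funext => t; rewrite indicE.
  by case: (boolP (t \in _)) => [|_]; [rewrite inE /retention => /= ->|rewrite !mul0e].
apply: emeasurable_funM; apply/measurable_EFinP.
  by apply: measurable_indic; exact: measurable_hitting.
apply: measurable_funX; apply: measurable_funB => //.
exact: measurable_thinned_mass.
Qed.

Lemma measurable_retention : measurable_fun setT retention.
Proof.
rewrite (_ : retention = fun t =>
  \sum_S (\1_[set t | hitting t = S] t)%:E * retention t)%E; last first.
  by apply/funext => t; exact: sum_hitting.
by apply: emeasurable_sum => S; exact: measurable_retention_hitting.
Qed.

(** Conditionally on the points that hit [H], the remaining ones are
independent, so the chance that all of them avoid the uncovered part of [M] is
a power of one minus the conditional mass of that part. *)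
Lemma void_probability : (Q covering =
  \int[Q]_t ((1 - thinned_mass t) ^+ (n - #|hitting t|))%:E)%E.
Proof.
have mcov : measurable_fun setT (fun t => (\1_covering t)%:E : \bar R).
  by apply/measurable_EFinP; apply: measurable_indic; exact: measurable_covering.
have mhit S : measurable_fun setT
    (fun t => (\1_[set t | hitting t = S] t)%:E : \bar R).
  by apply/measurable_EFinP; apply: measurable_indic; exact: measurable_hitting.
transitivity (\int[Q]_t (\1_covering t)%:E)%E.
  by rewrite integral_indic ?setIT//; exact: measurable_covering.
rewrite (eq_integral _ _ (fun t _ => sum_hitting (fun t => (\1_covering t)%:E) t)).
rewrite [RHS](eq_integral _ _ (fun t _ => sum_hitting retention t)).
rewrite ge0_integral_sum//; last by move=> S; exact: emeasurable_funM.
rewrite ge0_integral_sum//; last first.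
  by move=> S t _; apply: mule_ge0; [rewrite lee_fin|exact: retention_ge0].
apply: eq_bigr => S _.
rewrite (integral_splice iidQ S); last 2 first.
  exact: emeasurable_funM.
  by move=> t; rewrite mule_ge0// lee_fin.
rewrite [RHS](integral_splice iidQ S)//; last first.
  by move=> t; apply: mule_ge0; [rewrite lee_fin|exact: retention_ge0].
apply: eq_integral => x _.
have [HSx|/existsNP[i]] := pselect (forall i, i \in S -> H (tnth x i)); last first.
  move=> /not_implyP[iS Hi].
  have no y : (\1_[set t | hitting t = S] (splice S (x, y)) : R) = 0.
    rewrite indicE memNset// => /= /hittingP/(_ i).
    by rewrite tnth_mktuple iS.
  by rewrite !integral0_eq// => y _; rewrite no mul0e.
have mC : measurable (uncovered_by S x).
  rewrite /uncovered_by (_ : [set _ | _] = M `&` \bigcap_(i in [set` S])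
      ~` ysection rel (tnth x i)); last first.
    apply/seteqP; split=> z /= [Mz h]; split=> // i iS; have := h i iS;
      by rewrite /ysection/= inE.
  apply: measurableI => //; apply: fin_bigcap_measurable => [|i _].
    exact: finite_finset.
  by apply: measurableC; exact: measurable_ysection.
have CM : uncovered_by S x `<=` M by move=> z [].
set C := uncovered_by S x in mC CM *.
have mHC : measurable (~` (H `|` C)) by apply/measurableC/measurableU.
have hitE y : hitting (splice S (x, y)) = S <->
    forall i, slot (~` H) S i (tnth y i).
  rewrite hittingP; split=> h i; have := h i; rewrite tnth_mktuple/= /slot.
    by case: ifP.
  by case: ifPn => // iS _; exact: HSx.
have covE y : (hitting (splice S (x, y)) = S /\ covering (splice S (x, y))) <->
    forall i, slot (~` (H `|` C)) S i (tnth y i).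
  split=> [[hS cov] i|h].
    have := (hitE y).1 hS i; rewrite /slot; case: ifPn => // iS Hi.
    move: (cov i); rewrite uncovered_splice// -/C tnth_mktuple (negPf iS)/=.
    by move=> Ci [].
  have hS : hitting (splice S (x, y)) = S.
    apply/hitE => i; have := h i; rewrite /slot; case: ifP => // _.
    by move=> /= HC Hi; apply: HC; left.
  split=> // i; rewrite uncovered_splice// -/C tnth_mktuple/=.
  have := h i; rewrite /slot; case: ifPn => [iS _ [Mi _]|_ HC Ci].
    by have : (M `&` H) (tnth x i); [split=> //; exact: HSx|rewrite MH0].
  by apply: HC; right.
transitivity (\int[Q]_y (\1_[set y | forall i, slot (~` (H `|` C)) S i (tnth y i)] y)%:E)%E.
  apply: eq_integral => y _; rewrite !indicE -EFinM.
  congr (_%:E); rewrite -natrM mulnb; congr (_%:R); congr nat_of_bool.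
  apply/idP/idP; rewrite !inE => /=.
    by move=> /andP[]; rewrite !inE => h1 h2; apply/covE.
  by move=> /covE [h1 h2]; apply/andP; rewrite !inE.
rewrite integral_indic// ?setIT; last first.
  by apply: (measurable_box (A := slot (~` (H `|` C)) S)) => i; exact: measurable_slot.
rewrite [LHS](slotE S mHC) mass_disjoint//.
transitivity (\int[Q]_y ((\1_[set y | forall i, slot (~` H) S i (tnth y i)] y)%:E *
    ((1 - fine (nu C) / (1 - q)) ^+ (n - #|S|))%:E))%E; last first.
  apply: eq_integral => y _; rewrite !indicE.
  have [hy|hy] := pselect (forall i, slot (~` H) S i (tnth y i)); last first.
    by rewrite !memNset ?mul0e// => /= /hitE.
  have hS := (hitE y).2 hy.
  rewrite !mem_set// !mul1e /retention /thinned_mass hS uncovered_splice//.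
rewrite ge0_integralZr//; last 2 first.
  apply/measurable_EFinP/measurable_indic.
  apply: (measurable_box (A := slot (~` H) S)) => i; apply: measurable_slot.
  exact: measurableC.
  by rewrite lee_fin exprn_ge0// subr_ge0; have /andP[] := thinned_mass_itv mC CM.
rewrite integral_indic// ?setIT; last first.
  apply: (measurable_box (A := slot (~` H) S)) => i; apply: measurable_slot.
  exact: measurableC.
rewrite [X in _ = (X * _)%E](slotE S (measurableC mH)).
rewrite -/q probability_setC// (nuE mH) -/q -EFinM -exprMn.
congr (_ ^+ _)%:E.
by rewrite mulrBr mulr1 mulrCA mulfV ?mulr1// gt_eqF.
Qed.

End void_probability.

Section uncovered_moments.
Context {dE} {E : measurableType dE} {R : realType}.
Variables (nu : probability E R) (n : nat) (Q : probability (n.-tuple E) R).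
Hypothesis iidQ : iid_law nu Q.
Variables (M H : set E) (rel : set (E * E)).
Hypotheses (mM : measurable M) (mH : measurable H) (mrel : measurable rel).

Let iid_avoid (B : set E) : measurable B ->
  Q [set t | forall i, ~ B (tnth t i)] = ((1 - fine (nu B)) ^+ n)%:E.
Proof.
move=> mB; have mB' (i : 'I_n) : measurable (~` B) by exact: measurableC.
rewrite [LHS](iidQ mB') big_const_ord iter_mule mule1.
rewrite probability_setC// EFin_expe EFinB.
by rewrite fineK// fin_num_measure.
Qed.

Let mrelx z : measurable [set w | rel (z, w)].
Proof.
have := @measurable_xsection _ _ _ _ _ z mrel.
rewrite (_ : xsection _ _ = [set w | rel (z, w)])//.
by apply/seteqP; split=> w; rewrite /xsection/= inE.
Qed.

(** The mean of the uncovered mass, by exchanging the sample with the point of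
[M] that it fails to cover. *)
Lemma uncovered_mass_mean :
  (\int[Q]_t nu (uncovered M H rel t) =
   \int[nu]_z (\1_M z * (1 - fine (nu (H `&` [set w | rel (z, w)]))) ^+ n)%:E)%E.
Proof.
have mG := measurable_uncovered_graph (n := n) mM mH mrel.
transitivity (\int[Q]_t \int[nu]_z
    (\1_[set p : n.-tuple E * E | uncovered M H rel p.1 p.2] (t, z))%:E)%E.
  apply: eq_integral => t _.
  rewrite -[RHS]/(\int[nu]_z (\1_(uncovered M H rel t) z)%:E)%E.
  by rewrite integral_indic ?setIT//; exact: measurable_uncovered.
rewrite (fubini_tonelli (fun p => (\1_[set p : n.-tuple E * E |
  uncovered M H rel p.1 p.2] p)%:E)); last 2 first.
  by apply/measurable_EFinP; exact: measurable_indic.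
  by move=> p; rewrite lee_fin.
apply: eq_integral => z _; rewrite indicE.
have [Mz|Mz] := pselect (M z); last first.
  rewrite memNset// mul0r; apply: integral0_eq => t _.
  by rewrite indicE memNset// => -[].
rewrite mem_set// mul1r.
rewrite -iid_avoid; last exact: measurableI.
transitivity (\int[Q]_t (\1_[set t | forall i, ~
    (H `&` [set w | rel (z, w)]) (tnth t i)] t)%:E)%E.
  apply: eq_integral => t _; rewrite !indicE; congr ((nat_of_bool _)%:R%:E).
  apply/idP/idP; rewrite !inE/=.
    by move=> [_ h] i [/h].
  by move=> h; split=> // i Hi ri; apply: (h i).
rewrite integral_indic ?setIT//.
apply: (measurable_box (A := fun=> ~` (H `&` [set w | rel (z, w)]))) => i.
by apply: measurableC; exact: measurableI.
Qed.

(** The same exchange for a pair of points: independence between them is lost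
only through the overlap of the two parts of [H] that cover them. *)
Lemma uncovered_mass_second_moment :
  (\int[Q]_t (nu (uncovered M H rel t) * nu (uncovered M H rel t)) =
   \int[nu]_y \int[nu]_z (\1_M y * \1_M z *
     (1 - fine (nu (H `&` [set w | rel (y, w) \/ rel (z, w)]))) ^+ n)%:E)%E.
Proof.
have mU := measurable_uncovered_graph (n := n) mM mH mrel.
set U := [set p | _] in mU.
have mu : measurable_fun setT (fun p : n.-tuple E * E => (\1_U p)%:E : \bar R).
  by apply/measurable_EFinP; exact: measurable_indic.
have mu1 y : measurable_fun setT (fun t : n.-tuple E => (\1_U (t, y))%:E : \bar R).
  exact: (measurableT_comp mu (pair2_measurable y)).
have mu2 t : measurable_fun setT (fun z : E => (\1_U (t, z))%:E : \bar R).
  exact: (measurableT_comp mu (pair1_measurable t)).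
have u0 p : (0 <= (\1_U p)%:E :> \bar R)%E by rewrite lee_fin.
have massE t : nu (uncovered M H rel t) = (\int[nu]_z (\1_U (t, z))%:E)%E.
  rewrite -[RHS]/(\int[nu]_z (\1_(uncovered M H rel t) z)%:E)%E.
  by rewrite integral_indic ?setIT//; exact: measurable_uncovered.
transitivity (\int[Q]_t \int[nu]_y
    ((\1_U (t, y))%:E * nu (uncovered M H rel t)))%E.
  by apply: eq_integral => t _; rewrite ge0_integralZr// -massE.
rewrite (fubini_tonelli (fun p => (\1_U p)%:E * nu (uncovered M H rel p.1))%E);
  last 2 first.
  apply: emeasurable_funM => //.
  apply: (@measurableT_comp _ _ _ _ _ _ (fun t => nu (uncovered M H rel t)) _ fst).
    exact: measurable_uncovered_mass.
  exact: measurable_fst.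
  by move=> p; exact: mule_ge0.
apply: eq_integral => y _.
transitivity (\int[Q]_t \int[nu]_z ((\1_U (t, y))%:E * (\1_U (t, z))%:E))%E.
  by apply: eq_integral => t _; rewrite ge0_integralZl// massE.
rewrite (fubini_tonelli (fun p => (\1_U (p.1, y))%:E * (\1_U p)%:E)%E);
  last 2 first.
  apply: emeasurable_funM => //.
  exact: (@measurableT_comp _ _ _ _ _ _ (fun t => (\1_U (t, y))%:E) _ fst).
  by move=> p; exact: mule_ge0.
apply: eq_integral => z _.
rewrite !indicE.
have [[My Mz]|nM] := pselect (M y /\ M z); last first.
  rewrite -natrM mulnb (_ : _ && _ = false) ?mul0r; last first.
    by apply/negP => /andP[]; rewrite !inE => My Mz; exact: nM.
  apply: integral0_eq => t _; rewrite !indicE -EFinM -natrM mulnb.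
  rewrite (_ : _ && _ = false)//; apply/negP => /andP[].
  by rewrite !inE/= => -[My _] [Mz _]; exact: nM.
rewrite !mem_set// !mul1r.
have mB : measurable (H `&` [set w | rel (y, w) \/ rel (z, w)]).
  by apply: measurableI => //; exact: (measurableU _ _ (mrelx y) (mrelx z)).
rewrite -iid_avoid//.
transitivity (\int[Q]_t (\1_[set t | forall i, ~
    (H `&` [set w | rel (y, w) \/ rel (z, w)]) (tnth t i)] t)%:E)%E.
  apply: eq_integral => t _; rewrite !indicE -EFinM -natrM mulnb.
  congr ((nat_of_bool _)%:R%:E); apply/andP/idP; rewrite !inE/=.
    by move=> [[_ h] [_ k]] i [Hi [/(h _ Hi)|/(k _ Hi)]].
  move=> h; split; split=> // i Hi ri; apply: (h i).
    by split=> //; left.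
  by split=> //; right.
rewrite integral_indic ?setIT//.
apply: (measurable_box
  (A := fun=> ~` (H `&` [set w | rel (y, w) \/ rel (z, w)]))) => i.
exact: measurableC.
Qed.

End uncovered_moments.

Lemma measurable_section_mass d1 dE (E1 : measurableType d1)
    (E : measurableType dE) (R : realType) (nu : probability E R)
    (rel : set (E1 * E)) : measurable rel ->
  measurable_fun setT (fun z => fine (nu [set w | rel (z, w)])).
Proof.
move=> mrel; apply: measurableT_comp => //.
have := @measurable_fun_xsection _ _ _ _ _ nu _ mrel.
rewrite (_ : _ \o _ = (fun z => nu [set w | rel (z, w)]))//.
apply/funext => z /=; congr (nu _).
by apply/seteqP; split=> w; rewrite /xsection/= inE.
Qed.

Section undominated_points.
Context {dE} {E : measurableType dE} {R : realType}.
Variables (nu : probability E R) (n : nat) (Q : probability (n.-tuple E) R).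
Hypothesis iidQ : iid_law nu Q.
Variables (D : set E) (rel : set (E * E)).
Hypotheses (mD : measurable D) (mrel : measurable rel).

Definition undominated (i : 'I_n) : set (n.-tuple E) :=
  [set t | D (tnth t i) /\ forall j, j != i -> ~ rel (tnth t i, tnth t j)].

Let mrelx z : measurable [set w | rel (z, w)].
Proof.
have := @measurable_xsection _ _ _ _ _ z mrel.
rewrite (_ : xsection _ _ = [set w | rel (z, w)])//.
by apply/seteqP; split=> w; rewrite /xsection/= inE.
Qed.

Lemma measurable_undominated i : measurable (undominated i).
Proof.
pose N j := [set t : n.-tuple E | rel (tnth t i, tnth t j)].
have mN j : measurable (N j).
  have mf : measurable_fun setT (fun t : n.-tuple E => (tnth t i, tnth t j)).
    by apply/measurable_fun_pairP; split; exact: measurable_tnth.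
  by rewrite -[X in measurable X]setTI; exact: (mf measurableT _ mrel).
rewrite (_ : undominated i = ((@tnth n E)^~ i @^-1` D) `&`
  \bigcap_(j in [set j | j != i]) ~` N j); last first.
  by apply/seteqP; split=> t /= [Dt h]; split.
apply: measurableI.
  by rewrite -[X in measurable X]setTI; exact: measurable_tnth.
apply: fin_bigcap_measurable => [|j _]; first exact: finite_finset.
exact: measurableC.
Qed.

(** Resampling all coordinates but the [i]th leaves [n.-1] independent points that
must all fail to dominate the [i]th one. *)
Lemma undominated_probability i : (Q (undominated i) =
  \int[nu]_z (\1_D z * (1 - fine (nu [set w | rel (z, w)])) ^+ n.-1)%:E)%E.
Proof.
transitivity (\int[Q]_t (\1_(undominated i) t)%:E)%E.
  by rewrite integral_indic ?setIT//; exact: measurable_undominated.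
rewrite (integral_splice iidQ [set i]); last 2 first.
  by apply/measurable_EFinP/measurable_indic; exact: measurable_undominated.
  by move=> t; rewrite lee_fin.
rewrite -(integral_marginal iidQ i
  (f := fun z => (\1_D z * (1 - fine (nu [set w | rel (z, w)])) ^+ n.-1)%:E));
  last 2 first.
  apply/measurable_EFinP/measurable_funM; first exact: measurable_indic.
  apply: measurable_funX; apply: measurable_funB => //.
  exact: measurable_section_mass.
  move=> z; rewrite lee_fin mulr_ge0// exprn_ge0// subr_ge0 -lee_fin.
  by rewrite fineK ?probability_le1// fin_num_measure.
apply: eq_integral => x _; set z := tnth x i.
have [Dz|Dz] := pselect (D z); last first.
  rewrite indicE memNset// mul0r; apply: integral0_eq => y _.
  by rewrite indicE memNset// => -[]; rewrite tnth_mktuple inE eqxx.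
rewrite indicE mem_set// mul1r.
pose A j := if j == i then setT else ~` [set w | rel (z, w)].
have mA j : measurable (A j).
  by rewrite /A; case: ifP => // _; exact: measurableC.
transitivity (\int[Q]_y (\1_[set y | forall j, A j (tnth y j)] y)%:E)%E.
  apply: eq_integral => y _; rewrite !indicE; congr ((nat_of_bool _)%:R%:E).
  apply/idP/idP; rewrite !inE/=.
    move=> [_ h] j; rewrite /A; case: ifPn => // ji; have := h _ ji.
    by rewrite !tnth_mktuple/= !inE eqxx (negPf ji).
  move=> h; split; first by rewrite tnth_mktuple inE eqxx.
  move=> j ji; have := h j; rewrite /A (negPf ji).
  by rewrite !tnth_mktuple/= !inE eqxx (negPf ji).
rewrite integral_indic ?setIT//; last exact: measurable_box.
rewrite [LHS](iidQ mA) (bigD1 i)//= /A eqxx probability_setT mul1e.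
transitivity (\prod_(j < n | j != i) (1 - fine (nu [set w | rel (z, w)]))%:E)%E.
  apply: eq_bigr => j /negPf ->.
  by rewrite probability_setC// EFinB fineK// fin_num_measure.
rewrite prodEFin prodr_const; congr ((_ ^+ _)%:E).
by rewrite (@eq_card _ _ (predC1 i))// cardC1 card_ord.
Qed.

End undominated_points.

(** * Elementary exponential inequalities *)

Section exponential_inequalities.
Context {R : realType}.
Implicit Types x y p m : R.

Lemma expRN_ge x : 1 - x <= expR (- x).
Proof. exact: expR_ge1Dx. Qed.

Lemma expRN_le1 x : 0 <= x -> expR (- x) <= 1.
Proof. by move=> x0; rewrite -[leRHS]expR0 ler_expR oppr_le0. Qed.

Lemma expRN_sub x y : 0 <= x -> x <= y -> expR (- x) - expR (- y) <= y - x.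
Proof.
move=> x0 xy; have -> : - y = - x + - (y - x) by ring.
rewrite expRD -[X in X - _]mulr1 -mulrBr.
have e1 := expRN_le1 x0; have e2 := expRN_ge (y - x).
have e3 : expR (- (y - x)) <= 1 by apply: expRN_le1; rewrite subr_ge0.
apply: (@le_trans _ _ (1 * (1 - expR (- (y - x))))).
  by apply: ler_wpM2r => //; rewrite subr_ge0.
by rewrite mul1r; lra.
Qed.

(** The tangent at [m] plus a square: this is what turns a second moment into
an upper bound on a Laplace transform. *)
Lemma expRN_le_quadratic x m : 0 <= x -> 0 <= m ->
  expR (- x) <= expR (- m) - expR (- m) * (x - m) + (x - m) ^+ 2.
Proof.
move=> x0 m0; have em1 := expRN_le1 m0; have em0 := expR_gt0 (- m).
have [mx|/ltW xm] := leP m x.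
  have y0 : 0 <= x - m by rewrite subr_ge0.
  have -> : - x = - m + - (x - m) by ring.
  rewrite expRD; set y := x - m in y0 *; set a := expR (- m) in em0 em1 *.
  have hy : expR (- y) <= 1 - y + y ^+ 2.
    rewrite expRN -[leLHS]mul1r ler_pdivrMr ?expR_gt0//.
    have e1 := expR_ge1Dx y.
    have py : 0 <= 1 - y + y ^+ 2 by nra.
    apply: (@le_trans _ _ ((1 - y + y ^+ 2) * (1 + y))); last exact: ler_wpM2l.
    have : 0 <= y ^+ 3 by exact: exprn_ge0.
    by rewrite !exprS expr0; nra.
  have := ler_wpM2l (ltW em0) hy.
  have : a * y ^+ 2 <= y ^+ 2 by apply: ler_piMl => //; exact: sqr_ge0.
  by nra.
set z := m - x; have z0 : 0 <= z by rewrite subr_ge0.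
have -> : x - m = - z by rewrite /z; ring.
have ezx : expR (- m) <= expR (- z) by rewrite ler_expR /z; lra.
have -> : expR (- x) = expR (- m) * expR z by rewrite -expRD /z; congr expR; ring.
have ez := expR_ge1Dx z.
have e1 : expR (- z) * expR z = 1 by rewrite -expRD addNr expR0.
have ezN := expRN_ge z.
have h1 : expR (- m) * (expR z - 1 - z) <= expR (- z) * (expR z - 1 - z).
  by apply: ler_wpM2r => //; lra.
have h2 : (1 - z) * (1 + z) <= expR (- z) * (1 + z).
  by apply: ler_wpM2r => //; lra.
by rewrite sqrrN; nra.
Qed.

Lemma expRN_ge_tangent x m : expR (- m) * (1 + m - x) <= expR (- x).
Proof.
have -> : - x = - m + - (x - m) by ring.
rewrite expRD ler_wpM2l ?expR_ge0//.
by have := expRN_ge (x - m); lra.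
Qed.

Lemma onem_exp_le p n : p <= 1 -> (1 - p) ^+ n <= expR (- (p * n%:R)).
Proof.
move=> p1; rewrite -mulNr expRM_natr.
by rewrite lerXn2r ?nnegrE ?expR_ge0 ?subr_ge0// expRN_ge.
Qed.

Lemma bernoulli_ge p n : 0 <= p -> p <= 1 -> 1 - p * n%:R <= (1 - p) ^+ n.
Proof.
move=> p0 p1; elim: n => [|n IH]; first by rewrite expr0 mulr0 subr0.
have := ler_wpM2l (_ : 0 <= 1 - p) IH; rewrite subr_ge0 => /(_ p1).
rewrite exprS; apply: le_trans; rewrite -natr1.
have : 0 <= p * p * n%:R by rewrite !mulr_ge0.
by nra.
Qed.

Lemma onem_exp_ge_mul p n : 0 <= p -> p <= 1 ->
  expR (- (p * n%:R)) * (1 - p ^+ 2 * n%:R) <= (1 - p) ^+ n.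
Proof.
move=> p0 p1; have p21 : p ^+ 2 <= 1 by rewrite expr_le1.
apply: (@le_trans _ _ (expR (- (p * n%:R)) * (1 - p ^+ 2) ^+ n)).
  by rewrite ler_wpM2l ?expR_ge0// bernoulli_ge ?exprn_ge0.
rewrite -mulNr expRM_natr -exprMn lerXn2r ?nnegrE ?subr_ge0//.
  by rewrite mulr_ge0 ?expR_ge0 ?subr_ge0.
have -> : 1 - p ^+ 2 = (1 - p) * (1 + p) by ring.
rewrite mulrCA -[leRHS]mulr1 ler_wpM2l ?subr_ge0//.
rewrite expRN mulrC ler_pdivrMr ?expR_gt0// mul1r.
exact: expR_ge1Dx.
Qed.

Lemma onem_exp_ge p n : 0 <= p -> p <= 1 ->
  expR (- (p * n%:R)) - p ^+ 2 * n%:R <= (1 - p) ^+ n.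
Proof.
move=> p0 p1; apply: le_trans (onem_exp_ge_mul n p0 p1).
rewrite mulrBr mulr1 lerB// ler_piMl ?mulr_ge0 ?exprn_ge0//.
by rewrite expRN_le1// mulr_ge0.
Qed.

Lemma expRN_lip x y : 0 <= x -> 0 <= y ->
  `|expR (- x) - expR (- y)| <= `|x - y|.
Proof.
move=> x0 y0; wlog xy : x y x0 y0 / x <= y.
  by move=> h; have [/h|/ltW/h] := leP x y; [exact|rewrite distrC (distrC x)]; exact.
rewrite ger0_norm ?subr_ge0 ?ler_expR ?lerN2//.
by rewrite distrC (ger0_norm (_ : 0 <= y - x)) ?subr_ge0// expRN_sub.
Qed.

Lemma expR_le1D2 x : 0 <= x -> x <= 2^-1 -> expR x <= 1 + 2 * x.
Proof.
move=> x0 x2; have := expRN_ge x; have : expR (- x) * expR x = 1.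
  by rewrite -expRD addNr expR0.
by have := expR_gt0 x; nra.
Qed.

Lemma expRN_le_half x : 0 <= x -> x <= 1 -> expR (- x) <= 1 - x / 2.
Proof.
move=> x0 x1; have := expR_ge1Dx x; have : expR (- x) * expR x = 1.
  by rewrite -expRD addNr expR0.
by have := expR_gt0 (- x); nra.
Qed.

End exponential_inequalities.

Lemma probability_integral_cst dE (E : measurableType dE) (R : realType)
    (P : probability E R) (r : R) : (\int[P]_x r%:E = r%:E)%E.
Proof.
rewrite [LHS](integral_cst P (@measurableT _ E) r%:E) -[RHS]mule1.
by congr (_ * _)%E; exact: probability_setT.
Qed.

Section covering_bounds.
Context {dE} {E : measurableType dE} {R : realType}.
Variables (nu : probability E R) (n : nat) (Q : probability (n.-tuple E) R).
Hypothesis iidQ : iid_law nu Q.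
Variables (M H : set E) (rel : set (E * E)).
Hypotheses (mM : measurable M) (mH : measurable H) (mrel : measurable rel).
Hypothesis MH0 : M `&` H = set0.

Let q := fine (nu H).
Let p := fine (nu M).
Hypothesis q2 : q <= 2^-1.

Variables m v : R.
Hypothesis mE : (n%:R%:E * \int[Q]_t nu (uncovered M H rel t) = m%:E)%E.
Hypothesis vE : ((n%:R ^+ 2)%:E *
  \int[Q]_t (nu (uncovered M H rel t) * nu (uncovered M H rel t)) = v%:E)%E.

Let A (t : n.-tuple E) := fine (nu (uncovered M H rel t)).

Let AE t : nu (uncovered M H rel t) = (A t)%:E.
Proof. by rewrite fineK// fin_num_measure//; exact: measurable_uncovered. Qed.

Let A0 t : 0 <= A t. Proof. exact: fine_ge0. Qed.

Let Ap t : A t <= p.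
Proof.
rewrite -lee_fin -AE /p fineK ?fin_num_measure//.
by apply: le_measure; rewrite ?inE//; [exact: measurable_uncovered|move=> z []].
Qed.

Let p0 : 0 <= p. Proof. exact: fine_ge0. Qed.
Let q0 : 0 <= q. Proof. exact: fine_ge0. Qed.
Let q1 : q < 1. Proof. by apply: le_lt_trans q2 _; rewrite invf_lt1// ltr1n. Qed.

Let mA : measurable_fun setT A.
Proof. by apply: measurableT_comp => //; exact: measurable_uncovered_mass. Qed.

Let intA : (\int[Q]_t (n%:R * A t)%:E = m%:E)%E.
Proof.
under eq_integral do rewrite EFinM.
rewrite ge0_integralZl//; first by rewrite -mE; under eq_integral do rewrite -AE.
- exact/measurable_EFinP.
- by move=> t _; rewrite lee_fin.
Qed.

Let intA2 : (\int[Q]_t ((n%:R * A t) ^+ 2)%:E = v%:E)%E.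
Proof.
under eq_integral do rewrite exprMn EFinM.
rewrite ge0_integralZl//.
- rewrite -vE; congr (_ * _)%E; apply: eq_integral => t _.
  by rewrite AE -EFinM expr2.
- by apply/measurable_EFinP; exact: measurable_funX.
- by move=> t _; rewrite lee_fin sqr_ge0.
Qed.

Let int_card : (\int[Q]_t (#|hitting H t|%:R)%:E = (n%:R * q)%:E)%E.
Proof.
transitivity (\int[Q]_t \sum_(i < n) (\1_H (tnth t i))%:E)%E.
  apply: eq_integral => t _; rewrite sumEFin; congr (_%:E).
  rewrite -sum1_card natr_sum big_mkcond/=.
  apply: eq_bigr => i _; rewrite inE indicE.
  by case: asboolP => hi; [rewrite mem_set|rewrite memNset].
rewrite ge0_integral_sum//; last first.
  move=> i; apply/measurable_EFinP.
  apply: (@measurableT_comp _ _ _ _ _ _ (\1_H : E -> R)); last exact: measurable_tnth.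
  exact: measurable_indic.
transitivity (\sum_(i < n) q%:E)%E.
  apply: eq_bigr => i _.
  rewrite (integral_marginal iidQ i (f := fun x => (\1_H x)%:E))//.
    by rewrite integral_indic ?setIT// fineK// fin_num_measure.
  by apply/measurable_EFinP; exact: measurable_indic.
by rewrite sumEFin sumr_const card_ord mulr_natl.
Qed.

Let mretention : measurable_fun setT (fun t : n.-tuple E =>
  ((1 - thinned_mass nu M H rel t) ^+ (n - #|hitting H t|))%:E : \bar R).
Proof. exact: measurable_retention. Qed.

Let retention_ge0 (t : n.-tuple E) :
  0 <= (1 - thinned_mass nu M H rel t) ^+ (n - #|hitting H t|).
Proof. by rewrite exprn_ge0// subr_ge0 thinned_mass_le1. Qed.

Let m0 : 0 <= m.
Proof.
by rewrite -lee_fin -intA; apply: integral_ge0 => t _; rewrite lee_fin mulr_ge0.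
Qed.

(** Given the uncovered mass [A], the sample is a covering with probability close
to [expR (- n A)]. Its mean exceeds the exponential of the mean by at most the
variance of [n A]; the last term pays for the sample points spent in [H]. *)
Lemma covering_upper : fine (Q (covering (n := n) M H rel)) <=
  expR (- m) + (v - m ^+ 2) + 2 * (n%:R * p * q).
Proof.
pose c := expR (- m) + 2 * m.
have c0 : 0 <= c by rewrite addr_ge0 ?expR_ge0// mulr_ge0.
have pw (t : n.-tuple E) : (1 - thinned_mass nu M H rel t) ^+ (n - #|hitting H t|) +
    c * (n%:R * A t) <= expR (- m) * (1 + m) + m ^+ 2 +
    ((n%:R * A t) ^+ 2 + 2 * p * #|hitting H t|%:R).
  set al := thinned_mass nu M H rel t.
  set K := #|hitting H t|.
  have Kn : (K <= n)%N by rewrite -[leqRHS]card_ord max_card.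
  have al1 : al <= 1 by exact: thinned_mass_le1.
  have al0 : 0 <= al by exact: thinned_mass_ge0.
  have q10 : 0 < 1 - q by rewrite subr_gt0.
  have Aal : A t <= al.
    by rewrite ler_pdivlMr// ler_piMr// lerBlDr lerDl.
  have alp : al <= 2 * p.
    rewrite ler_pdivrMr//; apply: (le_trans (Ap t)).
    by have := q2; have := p0; rewrite -/q; nra.
  have s1 := onem_exp_le (n - K) al1.
  have n0 : 0 <= n%:R :> R by [].
  have K0 : 0 <= K%:R :> R by [].
  have nK : (n - K)%:R = n%:R - K%:R :> R by rewrite natrB.
  have s2 : expR (- (al * (n - K)%:R)) - expR (- (al * n%:R)) <=
      al * n%:R - al * (n - K)%:R.
    apply: expRN_sub; first by rewrite mulr_ge0.
    by rewrite ler_wpM2l// ler_nat leq_subr.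
  have s3 : expR (- (al * n%:R)) <= expR (- (n%:R * A t)).
    by rewrite ler_expR lerN2 mulrC ler_wpM2r.
  have s4 := expRN_le_quadratic (mulr_ge0 n0 (A0 t)) m0.
  have s5 : al * K%:R <= 2 * p * K%:R by rewrite ler_wpM2r.
  apply: (@le_trans _ _ (expR (- (n%:R * A t)) + 2 * p * K%:R + c * (n%:R * A t))).
    rewrite lerD2r; apply: (le_trans s1); rewrite nK in s2 *; nra.
  by move: s4; rewrite /c; set X := n%:R * A t; nra.
have mX : measurable_fun setT (fun t => n%:R * A t).
  by apply: measurable_funM.
have : (\int[Q]_t ((1 - thinned_mass nu M H rel t) ^+ (n - #|hitting H t|) +
    c * (n%:R * A t))%:E <= \int[Q]_t (expR (- m) * (1 + m) + m ^+ 2 +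
    ((n%:R * A t) ^+ 2 + 2 * p * #|hitting H t|%:R))%:E)%E.
  apply: ge0_le_integral => //.
  - by move=> t _; rewrite lee_fin addr_ge0// mulr_ge0// mulr_ge0.
  - apply/measurable_EFinP/measurable_funD; first by move/measurable_EFinP: mretention.
    exact: measurable_funM.
  - apply/measurable_EFinP/measurable_funD => //; apply: measurable_funD.
      exact: measurable_funX.
    by apply: measurable_funM => //; exact: measurable_card_hitting.
  - by move=> t _; rewrite lee_fin.
under eq_integral do rewrite EFinD.
rewrite ge0_integralD//; last 3 first.
  by move=> t _; rewrite lee_fin.
  by move=> t _; rewrite lee_fin mulr_ge0// mulr_ge0.
  by apply/measurable_EFinP; exact: measurable_funM.
rewrite -(void_probability iidQ mM mH mrel MH0 q1).
under [X in (_ + X)%E]eq_integral do rewrite EFinM.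
rewrite ge0_integralZl//; last 2 first.
  exact/measurable_EFinP.
  by move=> t _; rewrite lee_fin mulr_ge0.
rewrite intA.
under eq_integral do rewrite EFinD.
rewrite ge0_integralD//; last 3 first.
  by move=> t _; rewrite lee_fin addr_ge0 ?sqr_ge0// mulr_ge0 ?expR_ge0// addr_ge0.
  by move=> t _; rewrite lee_fin addr_ge0 ?sqr_ge0// !mulr_ge0.
  apply/measurable_EFinP/measurable_funD; first exact: measurable_funX.
  by apply: measurable_funM => //; exact: measurable_card_hitting.
rewrite probability_integral_cst.
under eq_integral do rewrite EFinD.
rewrite ge0_integralD//; last 4 first.
  by move=> t _; rewrite lee_fin sqr_ge0.
  by apply/measurable_EFinP; exact: measurable_funX.
  by move=> t _; rewrite lee_fin !mulr_ge0.
  apply/measurable_EFinP/measurable_funM => //; exact: measurable_card_hitting.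
rewrite intA2.
under eq_integral do rewrite EFinM.
rewrite ge0_integralZl//; last 2 first.
  by apply/measurable_EFinP; exact: measurable_card_hitting.
  by rewrite lee_fin mulr_ge0.
rewrite int_card -[Q _]fineK; last by rewrite fin_num_measure//; exact: measurable_covering.
rewrite -!EFinM -!EFinD lee_fin /c; nra.
Qed.

(** Convexity of the exponential gives this direction without the variance. *)
Lemma covering_lower : expR (- m) - 2 * (n%:R * p * q) - 4 * (n%:R * p ^+ 2) <=
  fine (Q (covering (n := n) M H rel)).
Proof.
have q10 : 0 < 1 - q by rewrite subr_gt0.
pose m' := m / (1 - q).
have m'0 : 0 <= m' by rewrite divr_ge0// ltW.
have pw (t : n.-tuple E) : expR (- m') * (1 + m') <=
    (1 - thinned_mass nu M H rel t) ^+ (n - #|hitting H t|) +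
    (expR (- m') / (1 - q) * (n%:R * A t) + 4 * (n%:R * p ^+ 2)).
  set al := thinned_mass nu M H rel t.
  set K := #|hitting H t|.
  have al1 : al <= 1 by exact: thinned_mass_le1.
  have al0 : 0 <= al by exact: thinned_mass_ge0.
  have alp : al <= 2 * p.
    rewrite ler_pdivrMr//; apply: (le_trans (Ap t)).
    by have := q2; have := p0; rewrite -/q; nra.
  have s1 : (1 - al) ^+ n <= (1 - al) ^+ (n - K).
    by apply: ler_wiXn2l; rewrite ?leq_subr// ?subr_ge0// lerBlDr lerDl.
  have s2 := onem_exp_ge n al0 al1.
  have s3 := expRN_ge_tangent (al * n%:R) m'.
  have s4 : al ^+ 2 <= 4 * p ^+ 2.
    by have := p0; nra.
  have s5 : al ^+ 2 * n%:R <= 4 * p ^+ 2 * n%:R by rewrite ler_wpM2r.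
  have -> : expR (- m') / (1 - q) * (n%:R * A t) = expR (- m') * (al * n%:R).
    rewrite /al /thinned_mass -/(A t) -/q; ring.
  by nra.
have mX : measurable_fun setT (fun t => n%:R * A t).
  by apply: measurable_funM.
have : (\int[Q]_t (expR (- m') * (1 + m'))%:E <=
    \int[Q]_t ((1 - thinned_mass nu M H rel t) ^+ (n - #|hitting H t|) +
    (expR (- m') / (1 - q) * (n%:R * A t) + 4 * (n%:R * p ^+ 2)))%:E)%E.
  apply: ge0_le_integral => //.
  - by move=> t _; rewrite lee_fin mulr_ge0 ?expR_ge0// addr_ge0.
  - apply/measurable_EFinP/measurable_funD; first by move/measurable_EFinP: mretention.
    by apply: measurable_funD => //; exact: measurable_funM.
  - by move=> t _; rewrite lee_fin.
rewrite probability_integral_cst.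
under eq_integral do rewrite EFinD.
rewrite ge0_integralD//; last 3 first.
  by move=> t _; rewrite lee_fin.
  move=> t _; rewrite lee_fin addr_ge0// !mulr_ge0 ?expR_ge0 ?invr_ge0 ?sqr_ge0//.
  exact: ltW.
  by apply/measurable_EFinP/measurable_funD => //; exact: measurable_funM.
rewrite -(void_probability iidQ mM mH mrel MH0 q1).
under eq_integral do rewrite EFinD.
rewrite ge0_integralD//; last 3 first.
  move=> t _; rewrite lee_fin !mulr_ge0 ?expR_ge0 ?invr_ge0//; exact: ltW.
  by apply/measurable_EFinP; exact: measurable_funM.
  by move=> t _; rewrite lee_fin !mulr_ge0 ?sqr_ge0.
rewrite probability_integral_cst.
under eq_integral do rewrite EFinM.
rewrite ge0_integralZl//; last 3 first.
  exact/measurable_EFinP.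
  by move=> t _; rewrite lee_fin mulr_ge0.
  by rewrite lee_fin mulr_ge0 ?expR_ge0 ?invr_ge0// ltW.
rewrite intA -[Q _]fineK; last by rewrite fin_num_measure//; exact: measurable_covering.
rewrite -!EFinM -!EFinD lee_fin.
have -> : expR (- m') / (1 - q) * m = expR (- m') * m' by rewrite /m'; ring.
have mp : m <= n%:R * p.
  rewrite -lee_fin -intA; apply: (@le_trans _ _ (\int[Q]_t (n%:R * p)%:E)%E).
    apply: ge0_le_integral => //.
    - by move=> t _; rewrite lee_fin mulr_ge0.
    - exact/measurable_EFinP.
    - by move=> t _; rewrite lee_fin ler_wpM2l.
  by rewrite probability_integral_cst.
have mm' : m <= m' by rewrite ler_pdivlMr// ler_piMr// lerBlDr lerDl.
have s1 := expRN_sub m0 mm'.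
have s2 : m' - m <= 2 * (m * q).
  rewrite lerBlDr ler_pdivrMr//.
  have : 0 <= m * q * (1 - 2 * q).
    by rewrite !mulr_ge0// subr_ge0 -ler_pdivlMl// mulr1.
  by have := m0; nra.
have s3 : m * q <= n%:R * p * q by rewrite ler_wpM2r.
by nra.
Qed.

End covering_bounds.

(** * The exponential law *)

Section exponential_law.
Context {R : realType}.
Variable nu : probability R R.
Hypothesis nuE : forall A : set R, measurable A -> nu A = exponential_prob 1 A.
Notation leb := (@lebesgue_measure R).
Notation pdf := (@exponential_pdf R 1).

Let pdf0 x : 0 <= pdf x. Proof. exact: exponential_pdf_ge0. Qed.

Let mpdf (D : set R) : measurable_fun D (EFin \o pdf).
Proof.
apply/measurable_EFinP/measurable_funTS; exact: measurable_exponential_pdf.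
Qed.

Let pdfE x : 0 <= x -> pdf x = expR (- x).
Proof. by move=> x0; rewrite exponential_pdfE// mul1r mulN1r. Qed.

Let pdf_le x : pdf x <= expR (- x).
Proof.
have [x0|x0] := leP 0 x; first by rewrite pdfE.
by rewrite lt0_exponential_pdf// expR_ge0.
Qed.

Import HBNNSimple.

Lemma integral_exponential_law (f : R -> \bar R) :
  measurable_fun setT f -> (forall x, 0 <= f x)%E ->
  (\int[nu]_x f x = \int[leb]_x (f x * (pdf x)%:E))%E.
Proof.
move=> mf f0; pose f_ := nnsfun_approx measurableT mf.
have sf (g : {nnsfun R >-> R}) :
    (\int[nu]_x (g x)%:E = \int[leb]_x ((g x)%:E * (pdf x)%:E))%E.
  have mg r : measurable (g @^-1` [set r]) by exact: measurable_funPTI.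
  have mi r : measurable_fun setT (\1_(g @^-1` [set r]) : R -> R).
    exact: measurable_indic.
  under [LHS]eq_integral do rewrite fimfunE -fsumEFin//.
  rewrite [LHS]ge0_integral_fsum//; last 2 first.
    - by move=> r; apply/measurable_EFinP/measurable_funM => //; exact: mi.
    - by move=> r x _; rewrite EFinM nnfun_muleindic_ge0.
  under [RHS]eq_integral.
    move=> x xD; rewrite fimfunE -fsumEFin// ge0_mule_fsuml; last first.
      by move=> r; rewrite EFinM nnfun_muleindic_ge0.
    over.
  rewrite [RHS]ge0_integral_fsum//; last 2 first.
    - move=> r; apply: emeasurable_funM; last exact: mpdf.
      apply/measurable_EFinP/measurable_funM => //; exact: mi.
    - move=> r x _; apply: mule_ge0; last by rewrite lee_fin.
      by rewrite EFinM nnfun_muleindic_ge0.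
  apply: eq_fsbigr => r rg.
  have r0 : 0 <= r.
    by move: rg; rewrite inE/= => -[x _ <-].
  under [RHS]eq_integral do rewrite EFinM -muleA.
  rewrite ge0_integralZl//; last 2 first.
    - apply: emeasurable_funM; last exact: mpdf.
      by apply/measurable_EFinP; exact: mi.
    - by move=> x _; rewrite mule_ge0// lee_fin.
  under [LHS]eq_integral do rewrite EFinM.
  rewrite [LHS]ge0_integralZl//; last first.
    by apply/measurable_EFinP; exact: mi.
  rewrite integral_indic// setIT; congr (_ * _)%E.
  rewrite [LHS]nuE// /exponential_prob [LHS]integral_mkcond.
  apply: eq_integral => x _; rewrite patchE indicE.
  by case: ifPn => _; rewrite ?mul1e ?mul0e.
transitivity (lim (\int[nu]_x (f_ n x)%:E @[n --> \oo])%E).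
  rewrite -monotone_convergence//=.
  - apply: eq_integral => ? /[!inE] xD; apply/esym/cvg_lim => //=.
    exact: cvg_nnsfun_approx.
  - by move=> n; exact/measurable_EFinP/measurable_funTS.
  - by move=> n ? _; rewrite lee_fin.
  - by move=> ? _ ? ? mn; rewrite lee_fin; exact/lefP/nd_nnsfun_approx.
transitivity (lim (\int[leb]_x ((f_ n x)%:E * (pdf x)%:E)%E @[n --> \oo])%E).
  by apply: congr_lim; apply/funext => n /=; exact: sf.
rewrite -monotone_convergence//=.
- apply: eq_integral => x _; apply/cvg_lim => //=.
  by apply: cvgeZr => //; exact: cvg_nnsfun_approx.
- have mfn n : measurable_fun setT (f_ n : R -> R) by [].
  move=> n; apply: emeasurable_funM; last exact: mpdf.
  by apply/measurable_EFinP; exact: mfn.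
- by move=> n x _; apply: mule_ge0; rewrite lee_fin.
- move=> x _ a b ab; rewrite lee_wpmul2r ?lee_fin//.
  by have /lefP := nd_nnsfun_approx measurableT mf ab; exact.
Qed.

(** Integrals against the exponential law are evaluated through an antiderivative
of the integrand times its density. *)
Lemma exponential_law_FTC (h K : R -> R) (a b : R) : 0 <= a -> a <= b ->
  continuous h -> (forall x, a < x <= b -> 0 <= h x) ->
  (forall x : R, is_derive x (1 : R) K (h x * expR (- x))) ->
  (\int[nu]_x (\1_`]a, b]%classic x * h x)%:E = (K b - K a)%:E)%E.
Proof.
move=> a0; rewrite le_eqVlt => /predU1P[<-|ab] ch h0 K'.
  rewrite subrr; apply: integral0_eq => x _.
  by rewrite indicE memNset ?mul0r//= in_itv/= => /andP[/lt_le_trans h1 /h1]; rewrite ltxx.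
have cE : continuous (fun x : R => expR (- x)).
  move=> x; apply: continuous_comp; last exact: continuous_expR.
  exact: (@continuousN _ R^o).
have chE : continuous (fun x : R => h x * expR (- x)).
  by move=> x; apply: cvgM; [exact: ch|exact: cE].
rewrite integral_exponential_law; last 2 first.
  apply/measurable_EFinP/measurable_funM; first exact: measurable_indic.
  exact: continuous_measurable_fun.
  move=> x; rewrite lee_fin indicE.
  case: (boolP (x \in _)); rewrite ?mul0r// inE/= in_itv/= => /h0 hx.
  by rewrite mul1r.
transitivity (\int[leb]_(x in `]a, b]) (h x * expR (- x))%:E)%E.
  rewrite [RHS]integral_mkcond; apply: eq_integral => x _.
  rewrite patchE indicE; case: ifPn; last by rewrite mul0r mul0e.
  rewrite inE/= in_itv/= => /andP[ax _].
  by rewrite mul1r -EFinM pdfE// (le_trans a0)// ltW.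
rewrite integral_itv_obnd_cbnd; last first.
  by apply/measurable_EFinP/measurable_funTS; exact: continuous_measurable_fun.
rewrite (@continuous_FTC2 _ _ K)//.
- exact: continuous_subspaceT.
- have cK : continuous K.
    move=> x; apply: differentiable_continuous; apply/derivable1_diffP.
    by have [] := K' x.
  split.
  + by move=> x _; have [] := K' x.
  + exact/cvg_at_right_filter/cK.
  + exact/cvg_at_left_filter/cK.
- by move=> x _; rewrite derive1E; have [_ ->] := K' x.
Qed.

Lemma exponential_law_tail (a : R) : nu `]a, +oo[%classic = (expR (- Num.max a 0))%:E.
Proof.
have tail b : 0 <= b -> nu `]b, +oo[%classic = (expR (- b))%:E.
  move=> b0; rewrite [LHS]nuE// /exponential_prob.
  transitivity (\int[leb]_(x in `]b, +oo[) (expR (- x))%:E)%E.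
    apply: eq_integral => x; rewrite inE/= in_itv/= andbT => bx.
    by rewrite pdfE// (le_trans b0)// ltW.
  have cE : continuous (fun x : R => expR (- x)).
    move=> x; apply: continuous_comp; last exact: continuous_expR.
    exact: (@continuousN _ R^o).
  have cE' : continuous (fun x : R => - expR (- x)).
    by move=> x; apply: cvgN; exact: cE.
  rewrite integral_itv_obnd_cbnd; last first.
    by apply/measurable_EFinP/measurable_funTS; exact: continuous_measurable_fun.
  rewrite (@ge0_continuous_FTC2y _ _ (fun x => - expR (- x)) _ 0)//.
  - by rewrite sub0e -EFinN opprK.
  - exact: continuous_subspaceT.
  - by rewrite -oppr0; apply: cvgN; exact: cvgr_expR.
  - by apply: cvg_at_right_filter; exact: cE'.
  - move=> x _; rewrite derive1E derive_val.
    by rewrite mulrN1 opprK.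
have [a0|a0] := leP 0 a.
  by rewrite tail// max_l.
rewrite oppr0 expR0; apply/eqP.
rewrite eq_le probability_le1//=.
apply: (@le_trans _ _ (nu `]0, +oo[%classic)); first by rewrite tail// oppr0 expR0.
apply: le_measure; rewrite ?inE// => x /=.
by rewrite !in_itv/= !andbT; exact: lt_trans.
Qed.

Lemma exponential_law_itv_le (c l : R) : 0 <= l ->
  (nu `[c, (c + l)%R]%classic <= (l * expR (- c))%:E)%E.
Proof.
move=> l0; rewrite [leLHS]nuE// /exponential_prob.
apply: (@le_trans _ _ (\int[leb]_(x in `[c, (c + l)%R]) (expR (- c))%:E)%E).
  apply: ge0_le_integral => //.
  - by move=> x _; rewrite lee_fin.
  - exact: mpdf.
  - move=> x /=; rewrite in_itv/= => /andP[cx _].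
    by rewrite lee_fin (le_trans (pdf_le x))// ler_expR lerN2.
rewrite integral_cst//= lebesgue_measure_itv/= lte_fin.
case: ifPn => _; last by rewrite mule0 lee_fin mulr_ge0 ?expR_ge0.
have -> : ((c + l)%:E - c%:E = l%:E)%E by rewrite -EFinB addrAC subrr add0r.
by rewrite -EFinM mulrC.
Qed.

End exponential_law.

(** * Geometry of a vector with exponential coordinates *)

Lemma exponential_law_pos (R : realType) (nu : probability R R)
    (nuE : forall A : set R, measurable A -> nu A = exponential_prob 1 A)
    (f : R -> \bar R) : measurable_fun setT f -> (forall x, 0 <= f x)%E ->
  (\int[nu]_x f x = \int[nu]_x ((\1_`]0, +oo[%classic x)%:E * f x))%E.
Proof.
move=> mf f0.
have m1 : measurable_fun setT (fun x : R => (\1_`]0, +oo[%classic x)%:E : \bar R).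
  by apply/measurable_EFinP; exact: measurable_indic.
apply: ge0_ae_eq_integral => //.
- exact: emeasurable_funM.
- by move=> x _; rewrite mule_ge0// lee_fin.
exists (~` `]0, +oo[%classic); split.
- exact: measurableC.
- transitivity (1 - nu `]0%R, +oo[%classic)%E; first exact: probability_setC.
  by rewrite exponential_law_tail// maxxx oppr0 expR0 subee.
- move=> x /= h x0; apply: h => _.
  by rewrite indicE mem_set ?mul1e.
Qed.

Lemma is_derive_simplex (R : realType) (a v : R) k :
  is_derive v (1 : R) (fun u : R => - ((a - u) ^+ k.+1 / (k.+1)`!%:R))
    ((a - v) ^+ k / k`!%:R).
Proof.
pose g : R -> R := cst a - id.
rewrite (_ : (fun u : R => _) = - ((k.+1)`!%:R^-1 \*: (g ^+ k.+1))); last first.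
  by apply/funext => x; rewrite -[RHS]/(- (_ * (g ^+ k.+1) x)) exprfctE mulrC.
apply: is_derive_eq.
rewrite /= /g -[(cst a - id) v]/(a - v) sub0r /GRing.scale/= mulrN1 mulrN opprK.
rewrite mulrA mulrC factS natrM invfM -!mulrA; congr (_ * _).
by rewrite mulrCA mulVf ?mulr1// pnatr_eq0.
Qed.

Lemma is_derive_translate (R : realType) (G : R -> R) (s v dg : R) :
  is_derive (s + v) (1 : R) G dg -> is_derive v (1 : R) (fun u => G (s + u)) dg.
Proof.
move=> dG; pose g : R -> R := cst s + id.
have gv : g v = s + v by [].
rewrite -gv in dG.
have dg1 : is_derive v (1 : R) g 1 by apply: is_derive_eq; rewrite add0r.
have := is_derive1_comp dG dg1; rewrite mulr1; exact.
Qed.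

Section exponential_vector.
Context {R : realType} {d : nat}.
Variable nu : probability R R.
Hypothesis nuE : forall A : set R, measurable A -> nu A = exponential_prob 1 A.
Variable mu : probability (d.-tuple R) R.
Hypothesis iidmu : iid_law nu mu.
Implicit Types (x y : d.-tuple R) (B : {set 'I_d}).

Definition partial_height B x : R := \sum_(j in B) tnth x j.

Definition height x : R := \sum_(j < d) tnth x j.

Lemma measurable_partial_height B : measurable_fun setT (partial_height B).
Proof.
rewrite /partial_height; under eq_fun do rewrite big_mkcond/=.
by apply: measurable_sum => j; case: (j \in B) => //; exact: measurable_tnth.
Qed.

Lemma measurable_height : measurable_fun setT height.
Proof. by apply: measurable_sum => j; exact: measurable_tnth. Qed.

Let partial_height_splice B (j : 'I_d) x y : j \notin B ->
  partial_height (j |: B) (splice [set j]%SET (x, y)) =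
  tnth x j + partial_height B y.
Proof.
move=> jB; rewrite /partial_height big_setU1//= tnth_mktuple inE eqxx/=.
congr (_ + _); apply: eq_bigr => i iB; rewrite tnth_mktuple inE.
by case: eqP => // ij; rewrite -ij iB in jB.
Qed.

Let measurable_le_fun (b : R) (f : R -> R) : measurable_fun setT f ->
  measurable_fun setT (fun v : R => if v <= b then f v else 0).
Proof.
move=> mf; apply: measurable_fun_ifT => //.
exact: measurable_fun_ler.
Qed.

Let measurable_capped (B : {set 'I_d}) (a : R) : measurable_fun setT
  (fun x => (if partial_height B x <= a then expR (partial_height B x) else 0)%:E).
Proof.
apply/measurable_EFinP.
apply: (@measurableT_comp _ _ _ _ _ _ (fun v : R => if v <= a then expR v else 0)).
  by apply: measurable_le_fun; exact: measurable_expR.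
exact: measurable_partial_height.
Qed.

(** The factor [expR] cancels the exponential density, so the integral is the
volume of a simplex. *)
Lemma simplex_volume B (a : R) :
  (\int[mu]_x (if partial_height B x <= a then expR (partial_height B x)
               else 0)%:E =
   (if 0 <= a then a ^+ #|B| / (#|B|)`!%:R else 0)%:E)%E.
Proof.
move: {2}#|B| (erefl #|B|) => k; elim: k B a => [|k IH] B a Bk.
  have -> : B = finset.set0 by apply: cards0_eq.
  rewrite cards0 fact0 expr0 divr1.
  under eq_integral do rewrite /partial_height big_set0 expR0.
  exact: probability_integral_cst.
have [j jB] : exists j, j \in B by apply/card_gt0P; rewrite Bk.
have jB' : j \notin (B :\ j)%SET by rewrite !inE eqxx.
have B'k : #|(B :\ j)%SET| = k by move: Bk; rewrite (cardsD1 j) jB => -[].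
rewrite -(finset.setD1K jB) cardsU1 jB' add1n B'k.
set B' := (B :\ j)%SET in jB' B'k *.
rewrite (integral_splice iidmu [set j]%SET); last 2 first.
  exact: measurable_capped.
  by move=> x; rewrite lee_fin; case: ifP => // _; exact: expR_ge0.
pose f (v : R) := expR v * (if v <= a then (a - v) ^+ k / (k`!)%:R else 0).
have mf : measurable_fun setT (fun v => (f v)%:E : \bar R).
  apply/measurable_EFinP; apply: measurable_funM; first exact: measurable_expR.
  apply: measurable_le_fun; apply: measurable_funM => //.
  by apply: measurable_funX; exact: measurable_funB.
have f0 v : (0 <= (f v)%:E :> \bar R)%E.
  rewrite lee_fin mulr_ge0 ?expR_ge0//; case: ifP => // va.
  by rewrite divr_ge0// exprn_ge0// subr_ge0.
transitivity (\int[mu]_x (f (tnth x j))%:E)%E.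
  apply: eq_integral => x _; set v := tnth x j.
  transitivity (\int[mu]_y ((expR v)%:E * (if partial_height B' y <= a - v then
      expR (partial_height B' y) else 0)%:E))%E.
    apply: eq_integral => y _; rewrite partial_height_splice// -/v.
    rewrite lerBrDl -EFinM; case: ifP => _; last by rewrite mulr0.
    by rewrite expRD.
  rewrite (ge0_integralZl _ measurableT (measurable_capped B' (a - v)));
    last 2 first.
    by move=> y _; rewrite lee_fin; case: ifP => // _; exact: expR_ge0.
    by rewrite lee_fin expR_ge0.
  by rewrite IH// subr_ge0 B'k -EFinM.
rewrite (integral_marginal iidmu j (f := fun v => (f v)%:E))//.
rewrite (exponential_law_pos nuE)//.
have [a0|a0] := leP 0 a; last first.
  apply: integral0_eq => v _; rewrite indicE.
  case: (boolP (v \in _)); last by rewrite mul0e.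
  rewrite inE/= in_itv/= andbT => v0.
  by rewrite /f leNgt (lt_trans a0 v0)/= mulr0 mule0.
pose K v := - ((a - v) ^+ k.+1 / (k.+1`!)%:R).
pose h v := expR v * ((a - v) ^+ k / (k`!)%:R).
transitivity (\int[nu]_v (\1_`]0, a]%classic v * h v)%:E)%E.
  apply: eq_integral => v _; rewrite !indicE !mem_setE !in_itv/= andbT -EFinM.
  congr (_%:E); rewrite /f /h; case: (0 < v); rewrite /= ?mul0r//.
  by case: ifP => va; rewrite ?mul1r ?mul0r ?mulr0.
have K' (v : R) : is_derive v (1 : R) K (h v * expR (- v)).
  apply: is_derive_eq (is_derive_simplex a v k) _.
  by rewrite /h mulrAC -expRD subrr expR0 mul1r.
rewrite (exponential_law_FTC nuE _ _ _ _ K')//.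
- by rewrite /K /= subrr expr0n mul0r oppr0 sub0r opprK addr0.
- move=> v; apply: cvgM; first exact: continuous_expR.
  apply: cvgM; last exact: cvg_cst.
  apply: (@continuous_comp _ _ _ (fun v : R => a - v) (fun u : R => u ^+ k)).
    by apply: cvgB; [exact: cvg_cst|exact: cvg_id].
  exact: exprn_continuous.
- move=> v /andP[_ va]; rewrite mulr_ge0 ?expR_ge0// divr_ge0//.
  by rewrite exprn_ge0// subr_ge0.
Qed.

Section slab.
Variables (g G : R -> R) (a b : R).
Hypotheses (ab : a <= b) (b0 : 0 <= b).
Hypotheses (cg : continuous g) (g0 : forall t, 0 <= g t).
Hypothesis G' : forall t : R, is_derive t (1 : R) G (g t * expR (- t)).
Hypothesis ndG : {homo G : s t / s <= t}.

Let mg : measurable_fun setT g. Proof. exact: continuous_measurable_fun. Qed.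

Let mslab : measurable_fun setT (fun t : R => \1_`]a, b]%classic t * g t).
Proof. by apply: measurable_funM => //; exact: measurable_indic. Qed.

Let slab0 t : 0 <= \1_`]a, b]%classic t * g t.
Proof. by rewrite mulr_ge0. Qed.

Let slab_fiber (s : R) :
  (\int[nu]_v (\1_`]a, b]%classic (s + v)%R * g (s + v))%:E =
   (if s <= b then expR s * (G b - G (Num.max a s)) else 0)%:E)%E.
Proof.
have ms : measurable_fun setT
    (fun v : R => (\1_`]a, b]%classic (s + v) * g (s + v))%:E).
  apply/measurable_EFinP.
  apply: (@measurableT_comp _ _ _ _ _ _ (fun t : R => \1_`]a, b]%classic t * g t)) => //.
  exact: measurable_funD.
rewrite (exponential_law_pos nuE)//; last by move=> v; rewrite lee_fin.
have [sb|bs] := leP s b; last first.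
  apply: integral0_eq => v _; rewrite !indicE !mem_setE !in_itv/= andbT -EFinM.
  case: (ltP 0 v) => v0; rewrite ?mul0r// (_ : s + v <= b = false) ?andbF ?mul0r ?mulr0//.
  by apply/negbTE; rewrite -ltNge (lt_trans bs)// ltrDl.
pose al := Num.max (a - s) 0; pose be := b - s.
transitivity (\int[nu]_v (\1_`]al, be]%classic v * g (s + v))%:E)%E.
  apply: eq_integral => v _; rewrite !indicE !mem_setE !in_itv/= andbT -EFinM.
  congr (_%:E); rewrite mulrA -natrM mulnb; congr ((nat_of_bool _)%:R * _).
  by rewrite /al /be gt_max ltrBlDl lerBrDl andbA [X in X && _ = _]andbC.
have K' (v : R) : is_derive v (1 : R) (fun u => expR s * G (s + u))
    (g (s + v) * expR (- v)).
  have := @is_deriveZ _ _ _ _ (expR s) _ _ _ (is_derive_translate (G' (s + v))).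
  move=> dK; apply: is_derive_eq dK _; rewrite /GRing.scale/= mulrCA -expRD.
  by rewrite opprD addrA subrr sub0r.
rewrite (exponential_law_FTC nuE _ _ _ _ K').
- have -> : s + be = b by rewrite /be; ring.
  have -> : s + al = Num.max a s by rewrite /al addr_maxr addr0 subrKC.
  by rewrite mulrBr.
- by rewrite le_max lexx orbT.
- by rewrite ge_max /al /be lerD2r ab subr_ge0 sb.
- move=> v; apply: (@continuous_comp _ _ _ (fun v : R => s + v) g).
    by apply: cvgD; [exact: cvg_cst|exact: cvg_id].
  exact: cg.
- by [].
Qed.

Variable j0 : 'I_d.
Let B := (~: [set j0])%SET.

Let cardB : #|B| = d.-1. Proof. by rewrite cardsC1 card_ord. Qed.

Lemma height_splice x y :
  height (splice B (x, y)) = partial_height B x + tnth y j0.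
Proof.
rewrite /height (bigD1 j0)//= tnth_mktuple !inE eqxx/= addrC; congr (_ + _).
rewrite /partial_height; apply: eq_big => [i|i ij0]; first by rewrite !inE.
by rewrite tnth_mktuple !inE ij0.
Qed.

Let slab_integralE :
  (\int[mu]_x (\1_`]a, b]%classic (height x) * g (height x))%:E =
   \int[mu]_x (if partial_height B x <= b then expR (partial_height B x) *
     (G b - G (Num.max a (partial_height B x))) else 0)%:E)%E.
Proof.
rewrite (integral_splice iidmu B); last 2 first.
  apply/measurable_EFinP.
  apply: (@measurableT_comp _ _ _ _ _ _ (fun t : R => \1_`]a, b]%classic t * g t)) => //.
  exact: measurable_height.
  by move=> x; rewrite lee_fin.
apply: eq_integral => x _; rewrite -slab_fiber.
under eq_integral do rewrite height_splice.
rewrite (integral_marginal iidmu j0 (f := fun v =>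
  (\1_`]a, b]%classic (partial_height B x + v)%R * g (partial_height B x + v))%:E))//.
  apply/measurable_EFinP.
  apply: (@measurableT_comp _ _ _ _ _ _ (fun t : R => \1_`]a, b]%classic t * g t)) => //.
  exact: measurable_funD.
by move=> v; rewrite lee_fin.
Qed.

Let mslabB : measurable_fun setT (fun x =>
  (if partial_height B x <= b then expR (partial_height B x) *
     (G b - G (Num.max a (partial_height B x))) else 0)%:E).
Proof.
apply/measurable_EFinP.
apply: (@measurableT_comp _ _ _ _ _ _ (fun s : R => if s <= b then expR s *
  (G b - G (Num.max a s)) else 0)); last exact: measurable_partial_height.
apply: measurable_le_fun; apply: measurable_funM; first exact: measurable_expR.
apply: measurable_funB => //.
apply: (@measurableT_comp _ _ _ _ _ _ G).
  by apply: nondecreasing_measurable => // ? ? _ _; exact: ndG.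
exact: measurable_maxr.
Qed.

Let int_capped (c : R) : 0 <= c -> (\int[mu]_x ((G b - G a)%:E *
    (if partial_height B x <= c then expR (partial_height B x) else 0)%:E) =
  ((c ^+ d.-1 / (d.-1)`!%:R) * (G b - G a))%:E)%E.
Proof.
move=> c0; rewrite (ge0_integralZl _ measurableT (measurable_capped B c)).
- by rewrite simplex_volume c0 cardB -EFinM mulrC.
- by move=> y _; rewrite lee_fin; case: ifP => // _; exact: expR_ge0.
- by rewrite lee_fin subr_ge0 ndG.
Qed.

(** Integrating out one coordinate turns the law of the height on a slab into
[expR (- t)] times the volume of a simplex of size between [a] and [b]. *)
Lemma slab_integral_le :
  (\int[mu]_x (\1_`]a, b]%classic (height x) * g (height x))%:E <=
   ((b ^+ d.-1 / (d.-1)`!%:R) * (G b - G a))%:E)%E.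
Proof.
rewrite slab_integralE -(int_capped b0); apply: ge0_le_integral => //.
- move=> x _; rewrite lee_fin; case: ifP => // sb.
  by rewrite mulr_ge0 ?expR_ge0// subr_ge0 ndG// ge_max ab.
- by apply: emeasurable_funM => //; exact: measurable_capped.
- move=> x _; rewrite -EFinM lee_fin; case: ifP => _; last by rewrite mulr0.
  by rewrite mulrC ler_wpM2r ?expR_ge0// lerB// ndG// le_max lexx.
Qed.

Lemma slab_integral_ge : 0 <= a -> (((a ^+ d.-1 / (d.-1)`!%:R) * (G b - G a))%:E <=
   \int[mu]_x (\1_`]a, b]%classic (height x) * g (height x))%:E)%E.
Proof.
move=> a0; rewrite slab_integralE -(int_capped a0); apply: ge0_le_integral => //.
- move=> x _; rewrite -EFinM lee_fin mulr_ge0 ?subr_ge0 ?ndG//.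
  by case: ifP => // _; exact: expR_ge0.
- by apply: emeasurable_funM => //; exact: measurable_capped.
- move=> x _; rewrite -EFinM lee_fin.
  case: (leP (partial_height B x) a) => [sa|_].
    by rewrite (le_trans sa ab) mulrC.
  rewrite mulr0; case: ifP => // sb.
  by rewrite mulr_ge0 ?expR_ge0// subr_ge0 ndG.
Qed.

End slab.

End exponential_vector.

Lemma measure_bigsetU_le dT (T : measurableType dT) (R : realType)
    (m : {measure set T -> \bar R}) n (F : 'I_n -> set T) :
  (forall i, measurable (F i)) ->
  (m (\big[setU/set0]_(i < n) F i) <= \sum_(i < n) m (F i))%E.
Proof.
move=> mF; suff [] : measurable (\big[setU/set0]_(i < n) F i) /\
    (m (\big[setU/set0]_(i < n) F i) <= \sum_(i < n) m (F i))%E by [].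
elim/big_rec2 : _ => [|i x A _ [mA Ax]]; first by rewrite measure0.
split; first exact: measurableU.
by rewrite (le_trans (measureU2 _ _ _))// leeD2l.
Qed.

Section orthants.
Context {R : realType} {d : nat}.
Variable nu : probability R R.
Hypothesis nuE : forall A : set R, measurable A -> nu A = exponential_prob 1 A.
Variable mu : probability (d.-tuple R) R.
Hypothesis iidmu : iid_law nu mu.
Implicit Types (x y w : d.-tuple R).

Lemma measurable_slab (i : interval R) :
  measurable [set x : d.-tuple R | height x \in i].
Proof.
rewrite -[X in measurable X]setTI.
exact: (@measurable_height R d measurableT [set` i] (measurable_itv i)).
Qed.

Definition above (r : R) : set (d.-tuple R) := [set w | r < height w].

Lemma measurable_above r : measurable (above r).
Proof.
rewrite (_ : above r = [set x | height x \in `]r, +oo[]).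
  exact: measurable_slab.
by apply/seteqP; split=> x; rewrite /above/= in_itv/= andbT.
Qed.

Definition orthant x : set (d.-tuple R) := [set w | strictly_below x w].

Lemma orthantE x : orthant x = [set w | forall j, `]tnth x j, +oo[%classic (tnth w j)].
Proof.
apply/seteqP; split=> w /=.
  by move=> /forallP h j; rewrite in_itv/= andbT.
by move=> h; apply/forallP => j; have := h j; rewrite in_itv/= andbT.
Qed.

Lemma measurable_orthant x : measurable (orthant x).
Proof.
by rewrite orthantE; apply: (measurable_box (A := fun j => `]tnth x j, +oo[%classic)).
Qed.

Lemma measurable_domination :
  measurable [set p : d.-tuple R * d.-tuple R | strictly_below p.1 p.2].
Proof.
rewrite (_ : [set _ | _] = \bigcap_(j in [set: 'I_d])
    ((fun p : d.-tuple R * d.-tuple R => tnth p.1 j < tnth p.2 j) @^-1` [set true])).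
  apply: fin_bigcap_measurable => [|j _]; first exact: finite_finset.
  rewrite -[X in measurable X]setTI.
  have : measurable_fun setT
      (fun p : d.-tuple R * d.-tuple R => tnth p.1 j < tnth p.2 j).
    apply: measurable_fun_ltr.
      apply: (@measurableT_comp _ _ _ _ _ _ (fun t : d.-tuple R => tnth t j) _ fst).
        exact: measurable_tnth.
      exact: measurable_fst.
    apply: (@measurableT_comp _ _ _ _ _ _ (fun t : d.-tuple R => tnth t j) _ snd).
      exact: measurable_tnth.
    exact: measurable_snd.
  by apply.
apply/seteqP; split=> p /=; first by move=> /forallP h j _; exact: h.
by move=> h; apply/forallP => j; exact: h.
Qed.

Lemma orthant_mass x : mu (orthant x) = (expR (- \sum_(j < d) Num.max (tnth x j) 0))%:E.
Proof.
rewrite orthantE [LHS](iidmu (A := fun j => `]tnth x j, +oo[%classic))//.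
under eq_bigr do rewrite exponential_law_tail//.
by rewrite prodEFin -sumrN expR_sum.
Qed.

Lemma orthant_mass_le x : fine (mu (orthant x)) <= expR (- height x).
Proof.
rewrite orthant_mass/= ler_expR lerN2; apply: ler_sum => j _.
by rewrite le_max lexx.
Qed.

Definition nonneg : set (d.-tuple R) := [set x | forall j, 0 <= tnth x j].

Lemma orthant_mass_nonneg x : nonneg x ->
  fine (mu (orthant x)) = expR (- height x).
Proof.
move=> x0; rewrite orthant_mass/=; congr (expR (- _)); apply: eq_bigr => j _.
by rewrite max_l.
Qed.

Lemma measurable_nonneg : measurable nonneg.
Proof.
rewrite (_ : nonneg = [set x | forall j, `[0, +oo[%classic (tnth x j)]).
  exact: (measurable_box (A := fun=> `[(0 : R), +oo[%classic)).
by apply/seteqP; split=> x /= h j; have := h j; rewrite in_itv/= andbT.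
Qed.

Lemma nonneg_mass : mu nonneg = 1%E.
Proof.
rewrite (_ : nonneg = [set x | forall j, `[0, +oo[%classic (tnth x j)]); last first.
  by apply/seteqP; split=> x /= h j; have := h j; rewrite in_itv/= andbT.
rewrite [LHS](iidmu (A := fun=> `[(0 : R), +oo[%classic))//.
rewrite big1// => j _; apply/eqP; rewrite eq_le probability_le1//=.
apply: (@le_trans _ _ (nu `](0 : R), +oo[%classic)).
  by rewrite exponential_law_tail// maxxx oppr0 expR0.
by apply: le_measure; rewrite ?inE// => x /=; rewrite !in_itv/= !andbT => /ltW.
Qed.

(** Some coordinate is at least the average [r / d]. *)
Lemma above_mass_le r : (0 < d)%N ->
  fine (mu (above r)) <= d%:R * expR (- (r / d%:R)).
Proof.
move=> d0; pose t := r / d%:R.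
pose F (j : 'I_d) := [set x : d.-tuple R | `]t, +oo[%classic (tnth x j)].
have mF j : measurable (F j).
  rewrite -[X in measurable X]setTI.
  exact: (@measurable_tnth _ R d j measurableT _ (measurable_itv _)).
rewrite -lee_fin fineK ?fin_num_measure//; last exact: measurable_above.
apply: (@le_trans _ _ (mu (\big[setU/set0]_(j < d) F j))).
  apply: le_measure; rewrite ?inE; first exact: measurable_above.
    by apply: bigsetU_measurable => j _; exact: mF.
  move=> x; rewrite /above/= => rx.
  have [j xj] : exists j, t < tnth x j.
    apply/not_existsP => h.
    suff : height x <= r by rewrite leNgt rx.
    apply: (@le_trans _ _ (\sum_(j < d) t)).
      by apply: ler_sum => j _; rewrite leNgt; apply/negP; exact: h.
    by rewrite sumr_const card_ord -(mulr_natr t) /t divfK// pnatr_eq0 -lt0n.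
  rewrite -bigcup_seq; exists j; first by rewrite /= mem_index_enum.
  by rewrite /F /= in_itv/= xj.
apply: (@le_trans _ _ (\sum_(j < d) mu (F j))%E).
  exact: measure_bigsetU_le.
have E j : mu (F j) = (expR (- Num.max t 0))%:E.
  by rewrite -(exponential_law_tail nuE) -(iid_law_marginal iidmu j).
under eq_bigr do rewrite E.
rewrite sumEFin sumr_const card_ord mulr_natl lee_fin lerMn2r ler_expR lerN2.
by rewrite le_max lexx orbT.
Qed.

Lemma exponential_law_cell (c u : R) : 0 <= c -> 0 <= u ->
  fine (nu `]c, (c + u)%R]%classic) <= expR (- c) * u.
Proof.
move=> c0 u0; rewrite -lee_fin fineK ?fin_num_measure//.
apply: (@le_trans _ _ (nu `[c, (c + u)%R]%classic)); last first.
  by rewrite mulrC; exact: exponential_law_itv_le.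
by apply: le_measure; rewrite ?inE//; exact: subset_itv_oc_cc.
Qed.

(** Above [x], the part of the orthant below level [r] fits in a cube of side
[r - height x]. *)
Lemma above_orthant_mass_ge x r : nonneg x -> height x <= r ->
  expR (- height x) * (1 - (r - height x) ^+ d) <=
  fine (mu (above r `&` orthant x)).
Proof.
move=> x0 xr; set u := r - height x; have u0 : 0 <= u by rewrite subr_ge0.
pose cell (j : 'I_d) : set R := `]tnth x j, (tnth x j + u)%R]%classic.
pose C : set (d.-tuple R) := [set w | forall j, cell j (tnth w j)].
have mcell j : measurable (cell j) by exact: measurable_itv.
have mC : measurable C by exact: (measurable_box mcell).
have mO := measurable_orthant x; have mA := measurable_above r.
have mAO : measurable (above r `&` orthant x) by exact: measurableI.
have CE : fine (mu C) <= expR (- height x) * u ^+ d.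
  rewrite (iid_law_fine iidmu mcell).
  rewrite -sumrN expR_sum -[d in u ^+ d]card_ord -prodr_const -big_split/=.
  apply: ler_prod => j _; rewrite fine_ge0//=.
  exact: exponential_law_cell (x0 j) u0.
have sub : orthant x `<=` (above r `&` orthant x) `|` C.
  move=> w xw; have [rw|wr] := ltP r (height w); first by left.
  right => j; rewrite /cell/= in_itv/=; have /forallP xwj := xw; rewrite xwj/=.
  rewrite /u; have : \sum_(i < d | i != j) tnth x i <= \sum_(i < d | i != j) tnth w i.
    by apply: ler_sum => i _; exact/ltW/xwj.
  by move: wr; rewrite /height (bigD1 j)//= [in X in _ -> _ -> X](bigD1 j)//=; lra.
have : fine (mu (orthant x)) <= fine (mu (above r `&` orthant x)) + fine (mu C).
  rewrite -lee_fin EFinD !fineK ?fin_num_measure//.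
  apply: le_trans (measureU2 _ _ _) => //.
  by apply: le_measure; rewrite ?inE//; exact: measurableU.
rewrite orthant_mass_nonneg//; lra.
Qed.

Definition join x y : d.-tuple R := [tuple Num.max (tnth x j) (tnth y j) | j < d].

Lemma above_orthant_mass_le x r :
  fine (mu (above r `&` orthant x)) <= expR (- height x).
Proof.
have mO := measurable_orthant x; have mA := measurable_above r.
apply: le_trans (orthant_mass_le x); apply: fine_le;
  rewrite ?fin_num_measure//; first exact: measurableI.
by apply: le_measure; rewrite ?inE//; exact: measurableI.
Qed.

(** Inclusion and exclusion: the overlap of two orthants is the orthant of the
join of their corners. *)
Lemma above_orthantU_mass_ge x y r :
  fine (mu (above r `&` orthant x)) + fine (mu (above r `&` orthant y)) -
    expR (- height (join x y)) <=
  fine (mu (above r `&` [set w | strictly_below x w \/ strictly_below y w])).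
Proof.
have mx := measurableI _ _ (measurable_above r) (measurable_orthant x).
have my := measurableI _ _ (measurable_above r) (measurable_orthant y).
rewrite (_ : above r `&` [set w | _] =
  (above r `&` orthant x) `|` (above r `&` orthant y)); last first.
  by rewrite -setIUr.
set A := above r `&` orthant x in mx *; set B := above r `&` orthant y in my *.
have AB : fine (mu (A `&` B)) <= expR (- height (join x y)).
  apply: le_trans (orthant_mass_le _); apply: fine_le;
    rewrite ?fin_num_measure//; [exact: measurableI|exact: measurable_orthant|].
  apply: le_measure; rewrite ?inE; [exact: measurableI|exact: measurable_orthant|].
  move=> w [[_ /forallP xw] [_ /forallP yw]]; apply/forallP => j.
  by rewrite tnth_mktuple gt_max xw yw.
have : fine (mu A) + fine (mu B) = fine (mu (A `|` B)) + fine (mu (A `&` B)).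
  have mAB := measurableI _ _ mx my; have mAUB := measurableU _ _ mx my.
  have Bfin : (mu B < +oo)%E by rewrite (le_lt_trans (probability_le1 _ my))// ltry.
  have E : mu (A `|` B) = (mu A + mu B - mu (A `&` B))%E by exact: measureUfinr.
  have fA : mu A = (fine (mu A))%:E by rewrite fineK// fin_num_measure.
  have fB : mu B = (fine (mu B))%:E by rewrite fineK// fin_num_measure.
  have fAB : mu (A `&` B) = (fine (mu (A `&` B)))%:E by rewrite fineK// fin_num_measure.
  by rewrite E fA fB fAB/= subrK.
by lra.
Qed.

Lemma measurable_cube y (rho : R) : measurable
  [set x : d.-tuple R | forall j, `|tnth x j - tnth y j| <= rho].
Proof.
pose side j : set R := `[tnth y j - rho, tnth y j + rho]%classic.
rewrite (_ : [set _ | _] = [set x | forall j, side j (tnth x j)]).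
  by apply: (measurable_box (A := side)) => j; exact: measurable_itv.
by apply/seteqP; split=> x /= h j; have := h j; rewrite /side/= in_itv/= ler_distl.
Qed.

(** The constraint on the height confines the last coordinate to an interval of
length [e] at the price of a factor [expR] of the other coordinates, which
again cancels their density. *)
Lemma slab_cube_mass_le (j0 : 'I_d) y (a e rho : R) : 0 <= e -> 0 <= rho ->
  fine (mu [set x | height x \in `]a, (a + e)] /\
    forall j, `|tnth x j - tnth y j| <= rho]) <=
  e * expR (- a) * (2 * rho * expR (2 * rho)) ^+ d.-1.
Proof.
move=> e0 rho0; pose B := (~: [set j0])%SET.
pose S := [set x : d.-tuple R | height x \in `]a, (a + e)]].
pose cube (j : 'I_d) : set R :=
  if j == j0 then setT else `[tnth y j - rho, tnth y j - rho + 2 * rho]%classic.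
pose I := [set x : d.-tuple R | forall j, cube j (tnth x j)].
have mcube j : measurable (cube j) by rewrite /cube; case: ifP.
have mI : measurable I by exact: (measurable_box mcube).
have mS : measurable S by exact: measurable_slab.
have mSI : measurable (S `&` I) by exact: measurableI.
pose c := e * expR (- a) * \prod_(j in B) expR (tnth y j + rho).
have c0 : 0 <= c by rewrite !mulr_ge0 ?expR_ge0// prodr_ge0// => j _; exact: expR_ge0.
have mIe : measurable_fun setT (fun x => (\1_I x)%:E : \bar R).
  by apply/measurable_EFinP; exact: measurable_indic.
have step : (mu (S `&` I) <= (c * fine (mu I))%:E)%E.
  have -> : (mu (S `&` I) = \int[mu]_x (\1_(S `&` I) x)%:E)%E.
    by rewrite integral_indic// setIT.
  rewrite (integral_splice iidmu B); last 2 first.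
    by apply/measurable_EFinP; exact: measurable_indic.
    by move=> x; rewrite lee_fin.
  apply: (@le_trans _ _ (\int[mu]_x (c%:E * (\1_I x)%:E))%E); last first.
    rewrite ge0_integralZl//.
    rewrite integral_indic// setIT -[X in (_ * X <= _)%E]fineK.
      by rewrite -EFinM.
    exact: fin_num_measure.
  apply: ge0_le_integral => //.
  - by move=> x _; apply: integral_ge0 => w _; rewrite lee_fin.
  - apply: (@measurable_fun_fubini_tonelli_F _ _ _ _ _ mu
      (fun p => (\1_(S `&` I) (splice B p))%:E)).
      apply/measurable_EFinP.
      apply: (@measurableT_comp _ _ _ _ _ _ (\1_(S `&` I) : d.-tuple R -> R)).
        exact: measurable_indic.
      exact: measurable_splice.
    by move=> p; rewrite lee_fin.
  - by apply: emeasurable_funM.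
  move=> x _; have [Ix|nIx] := pselect (I x); last first.
    rewrite [leRHS](_ : _ = 0%E); last by rewrite indicE memNset// mule0.
    rewrite integral0_eq// => w _; rewrite indicE memNset// => -[_ Iw]; apply: nIx.
    move=> j; have := Iw j; rewrite tnth_mktuple !inE /cube.
    by case: (eqVneq j j0) => [->|].
  rewrite [in leRHS]indicE mem_set// mule1.
  set s := partial_height B x.
  pose D : set R := `[a - s, (a - s + e)%R]%classic.
  apply: (@le_trans _ _ (\int[mu]_w (\1_D (tnth w j0))%:E)%E).
    apply: ge0_le_integral => //.
    - apply/measurable_EFinP.
      apply: (@measurableT_comp _ _ _ _ _ _ (\1_(S `&` I) : d.-tuple R -> R)).
        exact: measurable_indic.
      by apply: (measurableT_comp (measurable_splice B)); exact: pair1_measurable.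
    - apply/measurable_EFinP.
      apply: (@measurableT_comp _ _ _ _ _ _ (\1_D : R -> R)).
        by apply: measurable_indic; exact: measurable_itv.
      exact: measurable_tnth.
    move=> w _; rewrite lee_fin !indicE.
    have [Sw|nS] := pselect ((S `&` I) (splice B (x, w))); last first.
      by rewrite (memNset nS) ler0n.
    have Dw : D (tnth w j0).
      move: Sw => -[+ _]; rewrite /S/= /D/= !in_itv/= height_splice -/B -/s.
      by move=> /andP[h1 h2]; apply/andP; split; lra.
    by rewrite (mem_set Dw) ler_nat leq_b1.
  rewrite (integral_marginal iidmu j0 (f := fun v => (\1_D v)%:E)); last 2 first.
    by apply/measurable_EFinP/measurable_indic; exact: measurable_itv.
    by move=> v; rewrite lee_fin.
  rewrite integral_indic//; last exact: measurable_itv.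
  rewrite setIT; apply: le_trans (exponential_law_itv_le nuE _ e0) _.
  rewrite lee_fin /c -mulrA ler_wpM2l// opprB -expR_sum expRD mulrC.
  rewrite ler_wpM2l ?expR_ge0// ler_expR /s; apply: ler_sum => j.
  rewrite !inE => jj0; have := Ix j.
  by rewrite /cube (negPf jj0)/= in_itv/= => /andP[_]; lra.
apply: (@le_trans _ _ (c * fine (mu I))).
  rewrite -lee_fin; apply: le_trans step.
  have mW := measurableI _ _ mS (measurable_cube y rho).
  rewrite fineK ?fin_num_measure//; apply: le_measure; rewrite ?inE//.
  move=> x [Sx Cx]; split=> // j; rewrite /cube; case: ifP => // _.
  by rewrite /= in_itv/=; have := Cx j; rewrite ler_norml; lra.
rewrite (iid_law_fine iidmu mcube) (bigD1 j0)//= {1}/cube eqxx probability_setT mul1r.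
rewrite /c -mulrA ler_wpM2l ?mulr_ge0 ?expR_ge0//.
rewrite [X in X * _](eq_bigl (fun j => j != j0)) => [|j]; last by rewrite !inE.
rewrite -big_split/=.
have <- : #|[pred j | j != j0]| = d.-1.
  by rewrite (@eq_card _ _ (predC1 j0))// cardC1 card_ord.
rewrite -prodr_const; apply: ler_prod => j jj0.
rewrite mulr_ge0 ?expR_ge0 ?fine_ge0//= /cube (negPf jj0).
have := exponential_law_itv_le nuE (tnth y j - rho) (mulr_ge0 (ler0n R 2) rho0).
rewrite -[X in (X <= _)%E -> _]fineK ?fin_num_measure// lee_fin => h.
apply: (@le_trans _ _ (expR (tnth y j + rho) * (2 * rho * expR (- (tnth y j - rho))))).
  by rewrite ler_wpM2l ?expR_ge0.
rewrite mulrCA -expRD ler_wpM2l ?mulr_ge0// ler_expR; lra.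
Qed.

End orthants.

(** * Moments of the uncovered mass near the critical level *)

Section critical_slab.
Context {R : realType} {d : nat}.
Hypothesis d2 : (2 <= d)%N.
Variable nu : probability R R.
Hypothesis nuE : forall A : set R, measurable A -> nu A = exponential_prob 1 A.
Variable mu : probability (d.-tuple R) R.
Hypothesis iidmu : iid_law nu mu.
Variable n : nat.
Hypothesis n0 : (0 < n)%N.
Variables (a r : R).
Hypotheses (a0 : 0 <= a) (ar : a <= r) (ra1 : r - a <= 1).
Implicit Types (x y w : d.-tuple R).

Let N : R := n%:R.
Let La : R := N * expR (- a).
Let Lr : R := N * expR (- r).
Let e : R := r - a.

Definition slab : set (d.-tuple R) :=
  nonneg `&` [set x | height x \in `]a, r]].

(** The chance that no sample point falls in the orthant above [x], whose mass is
[expR (- height x)], in the Poisson approximation. *)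
Definition weight x : R := expR (- (N * expR (- height x))).

Definition simplex_vol (t : R) : R := t ^+ d.-1 / (d.-1)`!%:R.

Let hmass x : R := fine (mu (above r `&` orthant x)).

Let j0 : 'I_d := Ordinal (ltnW d2).

Let N0 : 0 < N. Proof. by rewrite ltr0n. Qed.
Let e0 : 0 <= e. Proof. by rewrite subr_ge0. Qed.
Let La0 : 0 < La. Proof. by rewrite mulr_gt0 ?expR_gt0. Qed.
Let Lr0 : 0 < Lr. Proof. by rewrite mulr_gt0 ?expR_gt0. Qed.

Lemma measurable_slab_nonneg : measurable slab.
Proof. by apply: measurableI; [exact: measurable_nonneg|exact: measurable_slab]. Qed.

Lemma measurable_weight : measurable_fun setT weight.
Proof.
apply: (@measurableT_comp _ _ _ _ _ _ (fun t : R => expR (- (N * expR (- t)))) _ height).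
  apply: measurableT_comp => //; apply: measurable_funN; apply: measurable_funM => //.
  by apply: measurableT_comp => //; exact: measurable_funN.
exact: measurable_height.
Qed.

Lemma weight_ge0 x : 0 <= weight x. Proof. exact: expR_ge0. Qed.

Let is_derive_expRN (t : R) : is_derive t (1 : R) (fun u : R => expR (- u)) (- expR (- t)).
Proof.
by apply: is_derive_eq; rewrite /GRing.scale/= ?mulr1 ?mulrN1 ?mulNr ?mul1r.
Qed.

Let is_derive_double_exp (t : R) :
  is_derive t (1 : R) (fun u : R => expR (- (N * expR (- u))))
    (N * expR (- (N * expR (- t))) * expR (- t)).
Proof.
have d1 : is_derive t (1 : R) (fun u : R => - (N * expR (- u))) (N * expR (- t)).
  have := @is_deriveZ _ _ _ _ (- N) _ _ _ (is_derive_expRN t).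
  rewrite /GRing.scale/= mulrNN.
  rewrite (_ : - N \*: _ = (fun u : R => - (N * expR (- u))))//.
  by apply/funext => u; exact: mulNr.
have := is_derive1_comp (is_derive_expR _) d1.
by rewrite mulrCA mulrA.
Qed.

Let continuous_expRN : continuous (fun u : R => expR (- u)).
Proof.
move=> t; apply: continuous_comp; last exact: continuous_expR.
exact: (@continuousN _ R^o).
Qed.

Let continuous_double_exp : continuous (fun u : R => N * expR (- (N * expR (- u)))).
Proof.
move=> t; apply: cvgM; first exact: cvg_cst.
apply: (@continuous_comp _ _ _ (fun u => N * expR (- u)) (fun v => expR (- v))).
  by apply: cvgM; [exact: cvg_cst|exact: continuous_expRN].
exact: continuous_expRN.
Qed.

Let double_exp_homo : {homo (fun u : R => expR (- (N * expR (- u)))) : s t / s <= t}.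
Proof. by move=> s t st; rewrite ler_expR lerN2 ler_wpM2l ?(ltW N0)// ler_expR lerN2. Qed.

Let double_exp_ge0 (t : R) : 0 <= N * expR (- (N * expR (- t))).
Proof. by rewrite mulr_ge0 ?expR_ge0// ltW. Qed.

Lemma simplex_vol_ge0 t : 0 <= t -> 0 <= simplex_vol t.
Proof. by move=> t0; rewrite divr_ge0// exprn_ge0. Qed.

Let slabW_lty : (\int[mu]_x (\1_slab x * weight x)%:E < +oo)%E.
Proof.
apply: (@le_lt_trans _ _ (\int[mu]_x 1%:E)%E); last first.
  by rewrite probability_integral_cst ltry.
apply: ge0_le_integral => //.
- by move=> x _; rewrite lee_fin mulr_ge0 ?expR_ge0.
- apply/measurable_EFinP/measurable_funM; last exact: measurable_weight.
  by apply: measurable_indic; exact: measurable_slab_nonneg.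
- move=> x _; rewrite lee_fin mulr_ile1 ?expR_ge0//.
  by rewrite expRN_le1// mulr_ge0 ?expR_ge0// ltW.
Qed.

(** The mean number of points of the slab that no other point dominates, up to
the replacement of a binomial by a Poisson law. *)
Definition critical_mean : R :=
  N * fine (\int[mu]_x (\1_slab x * weight x)%:E).

Let mslabW : measurable_fun setT (fun x => (\1_slab x * weight x)%:E : \bar R).
Proof.
apply/measurable_EFinP/measurable_funM; last exact: measurable_weight.
by apply: measurable_indic; exact: measurable_slab_nonneg.
Qed.

Let slabW_ge0 x : (0 <= (\1_slab x * weight x)%:E :> \bar R)%E.
Proof. by rewrite lee_fin mulr_ge0 ?expR_ge0. Qed.

Let critical_meanE :
  (N%:E * \int[mu]_x (\1_slab x * weight x)%:E = critical_mean%:E)%E.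
Proof.
rewrite EFinM fineK//; apply/fin_numPlt; rewrite slabW_lty andbT.
by rewrite (lt_le_trans (ltNyr 0))// integral_ge0.
Qed.

Let critical_mean_scaled :
  (critical_mean%:E = \int[mu]_x (\1_slab x * (N * weight x))%:E)%E.
Proof.
rewrite -critical_meanE -ge0_integralZl//.
- by apply: eq_integral => x _; rewrite -EFinM mulrCA.
- by rewrite lee_fin ltW.
Qed.

Lemma critical_mean_ge0 : 0 <= critical_mean.
Proof. by rewrite mulr_ge0 ?(ltW N0)// fine_ge0// integral_ge0. Qed.

Let slab_sub x : (\1_slab x : R) <= \1_`]a, r]%classic (height x).
Proof.
rewrite !indicE ler_nat; case: (boolP (x \in slab)) => //.
by rewrite inE => -[_ /= h]; rewrite mem_set.
Qed.

Let measurable_slab_height (g : R -> R) : measurable_fun setT g ->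
  measurable_fun setT (fun x => (\1_`]a, r]%classic (height x) * g (height x))%:E).
Proof.
move=> mg; apply/measurable_EFinP.
apply: (@measurableT_comp _ _ _ _ _ _ (fun t => \1_`]a, r]%classic t * g t) _ height).
  by apply: measurable_funM => //; exact: measurable_indic.
exact: measurable_height.
Qed.

(** The function [weight] is an antiderivative in the height, so that the mean is
the volume of a simplex times an increment of [weight]; the increment is almost
all of its value at the top of the slab. *)
Lemma critical_mean_le : critical_mean <= simplex_vol r * expR (- Lr).
Proof.
rewrite -lee_fin critical_mean_scaled.
apply: (@le_trans _ _ (simplex_vol r * (expR (- Lr) - expR (- La)))%:E).
  apply: le_trans (slab_integral_le nuE iidmu ar (le_trans a0 ar)
    continuous_double_exp double_exp_ge0 is_derive_double_exp double_exp_homo j0).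
  apply: ge0_le_integral => //.
  - by move=> x _; rewrite lee_fin mulr_ge0// double_exp_ge0.
  - apply/measurable_EFinP/measurable_funM; last first.
      by apply: measurable_funM => //; exact: measurable_weight.
    by apply: measurable_indic; exact: measurable_slab_nonneg.
  - apply: (measurable_slab_height (g := fun t => N * expR (- (N * expR (- t))))).
    exact: continuous_measurable_fun.
  - by move=> x _; rewrite lee_fin ler_wpM2r// double_exp_ge0.
rewrite lee_fin ler_wpM2l ?simplex_vol_ge0 ?(le_trans a0 ar)//.
by rewrite gerBl expR_ge0.
Qed.

Lemma critical_mean_ge :
  simplex_vol a * (expR (- Lr) - expR (- La)) <= critical_mean.
Proof.
rewrite -lee_fin critical_mean_scaled.
apply: le_trans (slab_integral_ge nuE iidmu ar
  continuous_double_exp double_exp_ge0 is_derive_double_exp double_exp_homo j0 a0) _.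
rewrite le_eqVlt; apply/orP; left; apply/eqP.
apply: ge0_ae_eq_integral => //.
- apply: (measurable_slab_height (g := fun t => N * expR (- (N * expR (- t))))).
    exact: continuous_measurable_fun.
- apply/measurable_EFinP/measurable_funM; last first.
    by apply: measurable_funM => //; exact: measurable_weight.
  by apply: measurable_indic; exact: measurable_slab_nonneg.
- by move=> x _; rewrite lee_fin mulr_ge0// double_exp_ge0.
- by move=> x _; rewrite lee_fin mulr_ge0// double_exp_ge0.
exists (~` nonneg); split.
- by apply: measurableC; exact: measurable_nonneg.
- transitivity (1 - mu nonneg)%E; last by rewrite (nonneg_mass nuE iidmu) subee.
  by apply: probability_setC; exact: measurable_nonneg.
- move=> x /= h x0; apply: h => _; congr ((_ * _)%:E).
  rewrite !indicE; congr ((nat_of_bool _)%:R).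
  by apply/idP/idP => [/set_mem h|/set_mem [_ h]]; exact/mem_set.
Qed.

Lemma slab_mass_le : N * fine (mu slab) <= simplex_vol r * La.
Proof.
have Vr := simplex_vol_ge0 (le_trans a0 ar).
suff h : fine (mu slab) <= simplex_vol r * expR (- a).
  by rewrite /La mulrCA ler_wpM2l// ltW.
rewrite -lee_fin fineK ?fin_num_measure//; last exact: measurable_slab_nonneg.
apply: (@le_trans _ _ (simplex_vol r * (- expR (- r) - - expR (- a)))%:E).
  apply: le_trans (slab_integral_le (g := fun=> 1) (G := fun u => - expR (- u))
    nuE iidmu ar (le_trans a0 ar) _ _ _ _ j0).
  - rewrite (_ : (mu slab = \int[mu]_x (\1_slab x)%:E)%E); last first.
      by rewrite integral_indic ?setIT//; exact: measurable_slab_nonneg.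
    apply: ge0_le_integral => //.
    + by apply/measurable_EFinP/measurable_indic; exact: measurable_slab_nonneg.
    + exact: (measurable_slab_height (g := fun=> 1)).
    + by move=> x _; rewrite lee_fin mulr1.
  - by move=> t; exact: cvg_cst.
  - by move=> _.
  - move=> t; have := @is_deriveN _ _ _ _ _ _ _ (is_derive_expRN t).
    by rewrite opprK mul1r.
  - by move=> s t st; rewrite lerN2 ler_expR lerN2.
rewrite lee_fin ler_wpM2l// opprK addrC gerBl expR_ge0//.
Qed.

(** A maximum lying below the slab would make the minimum norm small without
leaving a trace in the slab, but a point that low has so much mass above it that
it is dominated with overwhelming probability. *)
Definition deep : set (d.-tuple R) := nonneg `&` [set x | height x <= a].

Lemma measurable_deep : measurable deep.
Proof.
apply: measurableI; first exact: measurable_nonneg.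
rewrite (_ : [set _ | _] = [set x | height x \in `]-oo, a]]).
  exact: measurable_slab.
by apply/seteqP; split=> x /=; rewrite in_itv.
Qed.

Lemma deep_integral_le :
  (N%:E * \int[mu]_x (\1_deep x * weight x)%:E
   <= (simplex_vol a * expR (- La))%:E)%E.
Proof.
have am : -1 <= a by apply: le_trans a0; rewrite lerN10.
have mdW : measurable_fun setT (fun x => (\1_deep x * weight x)%:E : \bar R).
  apply/measurable_EFinP/measurable_funM; last exact: measurable_weight.
  by apply: measurable_indic; exact: measurable_deep.
rewrite -(ge0_integralZl _ measurableT mdW); last 2 first.
- by move=> x _; rewrite lee_fin mulr_ge0 ?expR_ge0.
- by rewrite lee_fin ltW.
apply: (@le_trans _ _ (simplex_vol a * (expR (- La) - expR (- (N * expR (- -1)))))%:E);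
  last first.
  by rewrite lee_fin ler_wpM2l ?simplex_vol_ge0// gerBl expR_ge0.
apply: le_trans (slab_integral_le nuE iidmu am a0
    continuous_double_exp double_exp_ge0 is_derive_double_exp double_exp_homo j0).
apply: ge0_le_integral => //.
- by move=> x _; rewrite -EFinM lee_fin !mulr_ge0 ?expR_ge0// ltW.
- exact: emeasurable_funM.
- apply/measurable_EFinP.
  apply: (@measurableT_comp _ _ _ _ _ _ (fun t => \1_`]-1, a]%classic t *
    (N * expR (- (N * expR (- t))))) _ height); last exact: measurable_height.
  apply: measurable_funM; first exact: measurable_indic.
  exact: continuous_measurable_fun.
- move=> x _; rewrite -EFinM lee_fin mulrCA ler_wpM2r ?double_exp_ge0//.
  rewrite !indicE ler_nat; case: (boolP (x \in _)) => //.
  rewrite inE => -[x0 /= xa]; rewrite mem_set//= in_itv/= xa andbT.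
  by apply: (@lt_le_trans _ _ 0); rewrite ?ltrN10// sumr_ge0.
Qed.

Let kap : R := La * e ^+ 2.

Let height_itv x : slab x -> a < height x <= r.
Proof. by move=> [_ /=]; rewrite in_itv. Qed.

Let height_ge0 x : slab x -> 0 <= height x.
Proof. by move=> /height_itv /andP[ax _]; rewrite (le_trans a0)// ltW. Qed.

Let hmass_itv x : 0 <= hmass x <= 1.
Proof.
rewrite fine_ge0//= -lee_fin fineK ?probability_le1//.
  by apply: measurableI; [exact: measurable_above|exact: measurable_orthant].
apply: fin_num_measure.
by apply: measurableI; [exact: measurable_above|exact: measurable_orthant].
Qed.

Let N_hmass_ge x : slab x -> N * expR (- height x) - kap <= N * hmass x.
Proof.
move=> sx; have /andP[ax xr] := height_itv sx; have [x0 _] := sx.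
have := above_orthant_mass_ge nuE iidmu x0 xr; rewrite -/(hmass x).
set u := r - height x => h.
have u0 : 0 <= u by rewrite subr_ge0.
have ue : u <= e by rewrite lerD2l lerN2 ltW.
have ud : u ^+ d <= e ^+ 2.
  apply: (@le_trans _ _ (u ^+ 2)); last by rewrite lerXn2r// nnegrE.
  by apply: ler_wiXn2l => //; apply: le_trans ue ra1.
have E1 : expR (- height x) <= expR (- a) by rewrite ler_expR lerN2 ltW.
have E2 : expR (- height x) * u ^+ d <= expR (- a) * e ^+ 2.
  by apply: ler_pM; rewrite ?expR_ge0// exprn_ge0.
have := ler_wpM2l (ltW N0) (lerD h E2).
by rewrite /kap /La; nra.
Qed.

Let N_expR_le x : slab x -> N * expR (- height x) <= La.
Proof.
move=> /height_itv /andP[ax _].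
by rewrite ler_wpM2l ?(ltW N0)// ler_expR lerN2 ltW.
Qed.

Let N_expR_ge x : slab x -> Lr <= N * expR (- height x).
Proof.
move=> /height_itv /andP[_ xr].
by rewrite ler_wpM2l ?(ltW N0)// ler_expR lerN2.
Qed.

Let measurable_below_above :
  measurable [set p : d.-tuple R * d.-tuple R | above r p.2 /\ strictly_below p.1 p.2].
Proof.
apply: (measurableI (snd @^-1` above r)); last exact: measurable_domination.
rewrite -[X in measurable X]setTI; apply: measurable_snd => //.
exact: measurable_above.
Qed.

Let measurable_hmass : measurable_fun setT hmass.
Proof. exact: measurable_section_mass measurable_below_above. Qed.

Let measurable_slab_avoid :
  measurable_fun setT (fun x => (\1_slab x * (1 - hmass x) ^+ n)%:E : \bar R).
Proof.
apply/measurable_EFinP/measurable_funM.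
  by apply: measurable_indic; exact: measurable_slab_nonneg.
by apply: measurable_funX; apply: measurable_funB => //; exact: measurable_hmass.
Qed.

(** Discarding the part of the orthant below level [r] changes the exponent by at
most [kap], since that part fits in a small cube. *)
Lemma mean_uncovered_le :
  (N%:E * \int[mu]_x (\1_slab x * (1 - hmass x) ^+ n)%:E <=
   (expR kap * critical_mean)%:E)%E.
Proof.
rewrite EFinM -critical_meanE muleCA; apply: lee_wpmul2l; first by rewrite lee_fin ltW.
rewrite -(ge0_integralZl _ measurableT mslabW)//.
apply: ge0_le_integral => //.
- move=> x _; rewrite lee_fin mulr_ge0// exprn_ge0// subr_ge0.
  by have /andP[] := hmass_itv x.
- exact: emeasurable_funM.
move=> x _; rewrite -EFinM lee_fin mulrCA indicE.
have [sx|sx] := pselect (slab x); last by rewrite memNset// !mul0r.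
rewrite mem_set// !mul1r; have /andP[_ h1] := hmass_itv x.
apply: le_trans (onem_exp_le n h1) _.
by rewrite -expRD ler_expR mulrC; have := N_hmass_ge sx; rewrite /N; lra.
Qed.

Lemma mean_uncovered_ge :
  (((1 - La ^+ 2 / N) * critical_mean)%:E <=
   N%:E * \int[mu]_x (\1_slab x * (1 - hmass x) ^+ n)%:E)%E.
Proof.
have [c0|c0] := leP (1 - La ^+ 2 / N) 0.
  apply: (@le_trans _ _ 0%E).
    by rewrite lee_fin mulr_le0_ge0// critical_mean_ge0.
  rewrite mule_ge0 ?lee_fin ?(ltW N0)//; apply: integral_ge0 => x _.
  rewrite lee_fin mulr_ge0// exprn_ge0// subr_ge0.
  by have /andP[] := hmass_itv x.
rewrite EFinM -critical_meanE muleCA; apply: lee_wpmul2l; first by rewrite lee_fin ltW.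
rewrite -(ge0_integralZl _ measurableT mslabW)//; last by rewrite lee_fin ltW.
apply: ge0_le_integral => //.
- by move=> x _; rewrite -EFinM lee_fin !mulr_ge0 ?expR_ge0// ltW.
- exact: emeasurable_funM.
move=> x _; rewrite -EFinM lee_fin mulrCA indicE.
have [sx|sx] := pselect (slab x); last by rewrite memNset// !mul0r.
rewrite mem_set// !mul1r; have /andP[h0 h1] := hmass_itv x.
have hE := above_orthant_mass_le nuE iidmu x r.
have E0 := expR_ge0 (- height x); have E1 := expRN_le1 (height_ge0 sx).
apply: (@le_trans _ _ ((1 - expR (- height x)) ^+ n)); last first.
  by rewrite lerXn2r ?nnegrE ?subr_ge0// lerB.
apply: le_trans (onem_exp_ge_mul n E0 E1).
rewrite mulrC /weight [expR _ * n%:R]mulrC ler_wpM2l ?expR_ge0// lerB//.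
rewrite ler_pdivlMr// -mulrA -expr2 mulrC -exprMn.
by rewrite lerXn2r ?nnegrE ?(ltW La0) ?mulr_ge0 ?(ltW N0)//; exact: N_expR_le.
Qed.

Let height_join x y :
  2 * height (join x y) = height x + height y + \sum_(j < d) `|tnth x j - tnth y j|.
Proof.
rewrite /height mulr_sumr -!big_split/=; apply: eq_bigr => j _.
by rewrite tnth_mktuple maxr_absE mulrC divfK// pnatr_eq0.
Qed.

Let height_join_gel x y : height x <= height (join x y).
Proof. by apply: ler_sum => j _; rewrite tnth_mktuple le_max lexx. Qed.

(** Twice the height of a join is the sum of the two heights plus the l1 distance
of the points. *)
Let height_join_far x y (rho : R) : slab x -> slab y ->
  ~ (forall j, `|tnth x j - tnth y j| <= rho) ->
  height x + (rho - e) / 2 <= height (join x y).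
Proof.
move=> /height_itv /andP[ax xr] /height_itv /andP[ay yr] /existsNP[j] /negP.
rewrite -ltNge => far; have := height_join x y.
have : rho <= \sum_(j < d) `|tnth x j - tnth y j|.
  by rewrite (bigD1 j)//=; apply: le_trans (ltW far) _; rewrite lerDl sumr_ge0.
by rewrite /e; lra.
Qed.

Variables (eta K : R).
Hypotheses (eta0 : 0 <= eta) (eeta : e <= eta) (eta2 : eta - e <= 2).
Hypothesis K0 : 0 <= K.
Let theta : R := expR (- (Lr * ((eta - e) / 4))).
Let zeta : R := La * expR (- ((K - e) / 2)).
Hypothesis zeta2 : zeta <= 2^-1.

Let near (rho : R) y : set (d.-tuple R) :=
  [set x | height x \in `]a, r] /\ forall j, `|tnth x j - tnth y j| <= rho].

Let measurable_near rho y : measurable (near rho y).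
Proof. by apply: measurableI; [exact: measurable_slab|exact: measurable_cube]. Qed.

(** Bounds the mean number of points of the slab within distance [rho] of a given
one, coordinate by coordinate. *)
Definition cube_bound (rho : R) : R := La * e * (2 * rho * expR (2 * rho)) ^+ d.-1.

Let near_mass (rho : R) y : 0 <= rho -> N * fine (mu (near rho y)) <= cube_bound rho.
Proof.
move=> rho0; rewrite /cube_bound /La -mulrA -mulrA ler_wpM2l ?(ltW N0)//.
have := slab_cube_mass_le nuE iidmu j0 y a e0 rho0.
by rewrite /e subrKC => /le_trans; apply; rewrite mulrA [X in X * _]mulrC.
Qed.

Let pair_mass y x : R :=
  fine (mu (above r `&` [set w | strictly_below y w \/ strictly_below x w])).

Let pair_mass_le1 y x : pair_mass y x <= 1.
Proof.
have mP : measurable (above r `&` [set w | strictly_below y w \/ strictly_below x w]).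
  apply: measurableI; first exact: measurable_above.
  exact: (measurableU _ _ (measurable_orthant y) (measurable_orthant x)).
by rewrite -lee_fin fineK ?probability_le1// fin_num_measure.
Qed.

Let pair_avoid_ge0 y x : 0 <= \1_slab y * \1_slab x * (1 - pair_mass y x) ^+ n.
Proof. by rewrite !mulr_ge0// exprn_ge0// subr_ge0 pair_mass_le1. Qed.

(** The overlap of two orthants matters only for points at distance at most
[eta]; up to distance [K] it is beaten by a factor [theta], and beyond it is at
most [zeta]. *)
Let pair_weight_le y x : slab y -> slab x ->
  (1 - pair_mass y x) ^+ n <= expR (2 * kap) *
    ((1 + 2 * zeta) * (weight x * weight y) +
     (\1_(near eta y) x + theta * \1_(near K y) x) * weight y).
Proof.
move=> sy sx.
apply: le_trans (onem_exp_le n (pair_mass_le1 y x)) _.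
have U := above_orthantU_mass_ge nuE iidmu y x r; rewrite -/(pair_mass y x) in U.
have hx := N_hmass_ge sx; have hy := N_hmass_ge sy.
set c := N * expR (- height (join x y)).
have c0 : 0 <= c by rewrite mulr_ge0 ?expR_ge0// ltW.
have joinC : join y x = join x y.
  by apply: eq_from_tnth => j; rewrite !tnth_mktuple maxC.
set ax := N * expR (- height x) in hx; set ay := N * expR (- height y) in hy.
apply: (@le_trans _ _ (expR (2 * kap) * expR (- ax - ay + c))).
  rewrite -expRD ler_expR.
  have := ler_wpM2l (ltW N0) U; rewrite -/(hmass x) -/(hmass y) joinC => U'.
  by rewrite [pair_mass _ _ * _]mulrC -/N; move: U'; rewrite mulrBr mulrDr -/c; lra.
rewrite ler_wpM2l ?expR_ge0//.
have wx0 := weight_ge0 x; have wy0 := weight_ge0 y.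
have th0 : 0 <= theta by exact: expR_ge0.
have ze0 : 0 <= zeta by rewrite mulr_ge0 ?expR_ge0// ltW.
have nE rho : (\1_(near rho y) x : R) =
    (if pselect (forall j, `|tnth x j - tnth y j| <= rho) then 1 else 0).
  rewrite indicE; case: pselect => h /=; first by rewrite mem_set//; case: sx.
  by rewrite memNset// => -[_].
have wyE : weight y = expR (- ay) by [].
have wxE : weight x = expR (- ax) by [].
rewrite !nE; case: pselect => nearx /=.
  have cx : c <= ax.
    by rewrite ler_wpM2l ?(ltW N0)// ler_expR lerN2 height_join_gel.
  apply: (@le_trans _ _ (weight y)).
    by rewrite wyE ler_expR; lra.
  have : 0 <= weight x * weight y by exact: mulr_ge0.
  by case: pselect => ? /=; nra.
rewrite add0r; case: pselect => nearK /=.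
  pose z := (eta - e) / 2.
  have z0 : 0 <= z by rewrite divr_ge0// subr_ge0.
  have z1 : z <= 1 by rewrite ler_pdivrMr// mul1r.
  have cx : c <= ax * expR (- z).
    rewrite /ax -mulrA ler_wpM2l ?(ltW N0)// -expRD ler_expR.
    by have := height_join_far sx sy nearx; rewrite /z; lra.
  have ez := expRN_le_half z0 z1.
  have axL := N_expR_ge sx; rewrite -/ax in axL.
  apply: (@le_trans _ _ (theta * weight y)).
    rewrite wyE /theta -expRD ler_expR.
    have : ax * expR (- z) <= ax * (1 - z / 2).
      by rewrite ler_wpM2l// (le_trans (ltW Lr0)).
    have : Lr * (z / 2) <= ax * (z / 2) by rewrite ler_wpM2r// divr_ge0.
    have -> : Lr * ((eta - e) / 4) = Lr * (z / 2) by rewrite /z; field.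
    by lra.
  have : 0 <= weight x * weight y by exact: mulr_ge0.
  by nra.
rewrite mulr0 mul0r addr0.
have cz : c <= zeta.
  rewrite /zeta; apply: (@le_trans _ _ (ax * expR (- ((K - e) / 2)))).
    rewrite /ax -mulrA ler_wpM2l ?(ltW N0)// -expRD ler_expR.
    by have := height_join_far sx sy nearK; lra.
  by rewrite ler_wpM2r ?expR_ge0//; exact: N_expR_le.
have ec := expR_le1D2 c0 (le_trans cz zeta2).
rewrite wxE wyE -expRD [leLHS]expRD mulrC ler_wpM2r ?expR_ge0//; lra.
Qed.

Let measurable_pair_mass :
  measurable_fun setT (fun p : d.-tuple R * d.-tuple R => pair_mass p.1 p.2).
Proof.
apply: (@measurable_section_mass _ _ _ _ _ mu [set q : (d.-tuple R * d.-tuple R) * d.-tuple R |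
  above r q.2 /\ (strictly_below q.1.1 q.2 \/ strictly_below q.1.2 q.2)]).
apply: (measurableI (snd @^-1` above r)).
  rewrite -[X in measurable X]setTI; apply: measurable_snd => //.
  exact: measurable_above.
have m1 : measurable_fun setT
    (fun q : (d.-tuple R * d.-tuple R) * d.-tuple R => (q.1.1, q.2)).
  apply/measurable_fun_pairP; split; last exact: measurable_snd.
  exact: (measurableT_comp measurable_fst measurable_fst).
have m2 : measurable_fun setT
    (fun q : (d.-tuple R * d.-tuple R) * d.-tuple R => (q.1.2, q.2)).
  apply/measurable_fun_pairP; split; last exact: measurable_snd.
  exact: (measurableT_comp measurable_snd measurable_fst).
apply: measurableU.
  rewrite -[X in measurable X]setTI.
  exact: (m1 measurableT _ (measurable_domination (d := d))).
rewrite -[X in measurable X]setTI.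
exact: (m2 measurableT _ (measurable_domination (d := d))).
Qed.

Let measurable_pair_avoid : measurable_fun setT
  (fun p : d.-tuple R * d.-tuple R =>
    (\1_slab p.1 * \1_slab p.2 * (1 - pair_mass p.1 p.2) ^+ n)%:E : \bar R).
Proof.
have ms : measurable_fun setT (\1_slab : d.-tuple R -> R).
  by apply: measurable_indic; exact: measurable_slab_nonneg.
apply/measurable_EFinP/measurable_funM.
  apply: measurable_funM.
    by apply: (@measurableT_comp _ _ _ _ _ _ (\1_slab : _ -> R) _ fst).
  by apply: (@measurableT_comp _ _ _ _ _ _ (\1_slab : _ -> R) _ snd).
by apply: measurable_funX; apply: measurable_funB => //; exact: measurable_pair_mass.
Qed.

(** Summing the bound on pairs over the slab: far pairs give the square of the
mean, and close pairs are controlled by the mass of a cube. *)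
Lemma second_moment_uncovered_le :
  ((N ^+ 2)%:E * \int[mu]_y \int[mu]_x
     (\1_slab y * \1_slab x * (1 - pair_mass y x) ^+ n)%:E <=
   (expR (2 * kap) * critical_mean *
    ((1 + 2 * zeta) * critical_mean + cube_bound eta + theta * cube_bound K))%:E)%E.
Proof.
pose I := fine (\int[mu]_x (\1_slab x * weight x)%:E).
pose c := expR (2 * kap) *
  ((1 + 2 * zeta) * I + cube_bound eta / N + theta * (cube_bound K / N)).
have ze0 : 0 <= zeta by rewrite mulr_ge0 ?expR_ge0// ltW.
have th0 : 0 <= theta by exact: expR_ge0.
have I0 : 0 <= I by rewrite fine_ge0// integral_ge0.
have IE : (\int[mu]_x (\1_slab x * weight x)%:E = I%:E)%E.
  rewrite fineK//; apply/fin_numPlt; rewrite slabW_lty andbT.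
  by rewrite (lt_le_trans (ltNyr 0))// integral_ge0.
have Ne rho y : 0 <= rho -> fine (mu (near rho y)) <= cube_bound rho / N.
  by move=> rho0; rewrite ler_pdivlMr// mulrC near_mass.
have cb0 rho : 0 <= rho -> 0 <= cube_bound rho.
  by move=> rho0; rewrite !mulr_ge0 ?exprn_ge0 ?mulr_ge0 ?expR_ge0 ?(ltW La0).
have c0 : 0 <= c.
  apply: mulr_ge0; first exact: expR_ge0.
  apply: addr_ge0; last by rewrite mulr_ge0// divr_ge0 ?cb0 ?(ltW N0).
  apply: addr_ge0; last by rewrite divr_ge0 ?cb0 ?(ltW N0).
  by rewrite mulr_ge0// addr_ge0// mulr_ge0.
have inner y : (\int[mu]_x (\1_slab y * \1_slab x * (1 - pair_mass y x) ^+ n)%:E <=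
    (c * (\1_slab y * weight y))%:E)%E.
  have [sy|sy] := pselect (slab y); last first.
    rewrite integral0_eq => [|x _]; last by rewrite indicE memNset// !mul0r.
    by rewrite lee_fin; apply: mulr_ge0 => //; apply: mulr_ge0 => //; exact: expR_ge0.
  pose f x : R := (1 + 2 * zeta) * weight y * (\1_slab x * weight x).
  pose g x : R := weight y * \1_(near eta y) x.
  pose h x : R := weight y * theta * \1_(near K y) x.
  have wy0 := weight_ge0 y.
  have f0 x : 0 <= f x by rewrite !mulr_ge0 ?addr_ge0 ?mulr_ge0 ?expR_ge0.
  have g0 x : 0 <= g x by rewrite mulr_ge0.
  have h0 x : 0 <= h x by rewrite !mulr_ge0.
  have mslabWr : measurable_fun setT (fun x => \1_slab x * weight x : R).
    by apply/measurable_EFinP.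
  have mf : measurable_fun setT f by exact: measurable_funM.
  have mg : measurable_fun setT g.
    by apply: measurable_funM => //; exact: measurable_indic.
  have mh : measurable_fun setT h.
    by apply: measurable_funM => //; exact: measurable_indic.
  apply: (@le_trans _ _ (\int[mu]_x ((expR (2 * kap))%:E *
      ((f x)%:E + ((g x)%:E + (h x)%:E))))%E).
    apply: ge0_le_integral => //.
    - by move=> x _; rewrite lee_fin.
    - exact: (measurable_fun_pair2 y measurable_pair_avoid).
    - apply: emeasurable_funM => //; apply: emeasurable_funD; first exact/measurable_EFinP.
      by apply: emeasurable_funD; exact/measurable_EFinP.
    move=> x _; have [sx|sx] := pselect (slab x); last first.
      rewrite [in leLHS](_ : \1_slab x = 0) ?mulr0 ?mul0r; last first.
        by rewrite indicE memNset.
      by rewrite -!EFinD -EFinM lee_fin mulr_ge0 ?expR_ge0// !addr_ge0.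
    rewrite -!EFinD -EFinM lee_fin /f !indicE mem_set// mem_set// !mul1r.
    have := pair_weight_le sy sx; rewrite /g /h !indicE; lra.
  have mgh : measurable_fun setT (fun x => (g x)%:E + (h x)%:E)%E.
    by apply: emeasurable_funD; exact/measurable_EFinP.
  have mfgh : measurable_fun setT (fun x => (f x)%:E + ((g x)%:E + (h x)%:E))%E.
    by apply: emeasurable_funD => //; exact/measurable_EFinP.
  rewrite (ge0_integralZl _ measurableT mfgh); last 2 first.
  - by move=> x _; rewrite -!EFinD lee_fin !addr_ge0.
  - by rewrite lee_fin expR_ge0.
  rewrite ge0_integralD; last 5 first.
  - exact: measurableT.
  - by move=> x _; rewrite lee_fin.
  - exact/measurable_EFinP.
  - by move=> x _; rewrite -!EFinD lee_fin !addr_ge0.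
  - exact: mgh.
  rewrite ge0_integralD; last 5 first.
  - exact: measurableT.
  - by move=> x _; rewrite lee_fin.
  - exact/measurable_EFinP.
  - by move=> x _; rewrite lee_fin.
  - exact/measurable_EFinP.
  have intf : (\int[mu]_x (f x)%:E = ((1 + 2 * zeta) * weight y * I)%:E)%E.
    rewrite EFinM -IE -(ge0_integralZl _ measurableT mslabW)//.
    by rewrite lee_fin mulr_ge0// addr_ge0// mulr_ge0.
  have intn rho k : 0 <= k -> (\int[mu]_x (k * \1_(near rho y) x)%:E =
      (k * fine (mu (near rho y)))%:E)%E.
    move=> k0; under eq_integral do rewrite EFinM.
    rewrite ge0_integralZl//.
      by rewrite integral_indic// setIT [RHS]EFinM fineK// fin_num_measure.
    by apply/measurable_EFinP; exact: measurable_indic.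
  rewrite intf intn// intn; last exact: mulr_ge0.
  rewrite -!EFinD -EFinM lee_fin /c indicE mem_set// mul1r.
  rewrite -[leRHS]mulrA ler_wpM2l ?expR_ge0//.
  have n1 := Ne eta y eta0; have n2 := Ne K y K0.
  have n1' := ler_wpM2l wy0 n1.
  have n2' := ler_wpM2l (mulr_ge0 wy0 th0) n2.
  by lra.
apply: (@le_trans _ _ ((N ^+ 2)%:E * \int[mu]_y (c%:E * (\1_slab y * weight y)%:E))%E).
  apply: lee_wpmul2l; first by rewrite lee_fin sqr_ge0.
  apply: ge0_le_integral => //.
  - by move=> y _; apply: integral_ge0 => x _; rewrite lee_fin.
  - apply: (@measurable_fun_fubini_tonelli_F _ _ _ _ _ mu _ measurable_pair_avoid).
    by move=> p; rewrite lee_fin.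
  - exact: emeasurable_funM.
rewrite (ge0_integralZl _ measurableT mslabW)//.
rewrite IE -!EFinM lee_fin /c /critical_mean -/I le_eqVlt; apply/orP; left; apply/eqP.
by field; rewrite gt_eqF.
Qed.

End critical_slab.

(** * From coverings to the minimum norm of a maximum *)

Section minimum_norm.
Context {R : realType} {d n : nat}.
Hypotheses (d0 : (0 < d)%N) (n0 : (0 < n)%N).
Implicit Types (t : n.-tuple (d.-tuple R)) (x y z : d.-tuple R).

Definition min_norm t : R := min_maxima_norm (tnth t).

Lemma measurable_min_norm : measurable_fun setT min_norm.
Proof.
pose m i := isMeasurableFun.Build _ _ _ _ _ (@measurable_tnth _ (d.-tuple R) n i).
pose X i : {mfun n.-tuple (d.-tuple R) >-> d.-tuple R} :=
  HB.pack (fun t => tnth t i) (m i).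
exact: (measurable_min_maxima_norm X).
Qed.

Lemma measurable_min_norm_gt s : measurable [set t | s < min_norm t].
Proof.
have := @measurable_min_norm measurableT `]s, +oo[%classic (measurable_itv _).
rewrite setTI (_ : _ @^-1` _ = [set t | s < min_norm t])//.
by apply/seteqP; split=> t /=; rewrite in_itv/= andbT.
Qed.

Lemma strictly_below_trans y x z : strictly_below x y -> strictly_below y z ->
  strictly_below x z.
Proof.
by move=> /forallP xy /forallP yz; apply/forallP => j; exact: lt_trans (yz j).
Qed.

Lemma strictly_below_height x y : strictly_below x y -> height x < height y.
Proof.
move=> /forallP xy; apply: ltr_sum => [|j _]; last exact: xy.
by apply/hasP; exists (Ordinal d0) => //; rewrite mem_index_enum.
Qed.

Lemma l1norm_nonneg x : nonneg x -> l1norm x = height x.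
Proof. by move=> x0; apply: eq_bigr => j _; rewrite ger0_norm. Qed.

(** Among the points above a given one, a point of largest height is a maximum. *)
Lemma dominating_maximum t i : ~~ is_maximum (tnth t) i ->
  exists2 k, is_maximum (tnth t) k & strictly_below (tnth t i) (tnth t k).
Proof.
rewrite negb_forall => /existsP[l]; rewrite negbK => il.
have [k ik kmax] := @arg_maxP _ R _ l (fun k => strictly_below (tnth t i) (tnth t k))
  (fun k => height (tnth t k)) il.
exists k => //; apply/forallP => j; apply/negP => kj.
have /= := kmax j (strictly_below_trans ik kj).
by rewrite leNgt strictly_below_height.
Qed.

Let rel : set (d.-tuple R * d.-tuple R) := [set p | strictly_below p.1 p.2].

Variables (a r : R).

(** A point of the slab is not a maximum when all maxima have norm above [r]; the
maximum that dominates it then covers it. *)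
Lemma min_norm_gt_sub :
  [set t | r < min_norm t] `<=` covering (slab a r) (above r) rel.
Proof.
move=> t /= rt i [[x0 hx] nc].
have [kmin kminmax [Ekmin lek]] := min_maxima_norm_attained (tnth t) n0 d0.
have hi : height (tnth t i) <= r by move: hx; rewrite /= in_itv/= => /andP[].
have [imax|] := boolP (is_maximum (tnth t) i).
  have := lek _ imax; rewrite -Ekmin l1norm_nonneg// => h.
  by have := lt_le_trans rt (le_trans h hi); rewrite ltxx.
move=> /dominating_maximum [k kmax ik]; apply: (nc k) => //.
have k0 : nonneg (tnth t k).
  by move=> j; move/forallP: ik => /(_ j) /ltW; exact: le_trans.
rewrite /above/= -l1norm_nonneg//; apply: lt_le_trans rt _.
by rewrite /min_norm Ekmin; exact: lek.
Qed.

(** When the slab is covered, a maximum of norm at most [r] has to lie below the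
slab. *)
Lemma covering_sub : covering (slab a r) (above r) rel `<=`
  [set t | r < min_norm t] `|` ((\big[setU/set0]_(i < n) undominated (E := d.-tuple R) (deep a) rel i) `|`
    ~` [set t | forall i, nonneg (tnth t i)]).
Proof.
move=> t cov; have [pos|neg] := pselect (forall i, nonneg (tnth t i)); last first.
  by right; right.
have [k kmax [Ek _]] := min_maxima_norm_attained (tnth t) n0 d0.
have [rt|tr] := ltP r (min_norm t); [by left|right; left].
have kr : height (tnth t k) <= r by rewrite -l1norm_nonneg// -Ek.
have [ak|ka] := ltP a (height (tnth t k)).
  exfalso; apply: (cov k); split.
    by split; [exact: pos|rewrite /= in_itv/= ak].
  by move=> j _ /= kj; move/forallP: kmax => /(_ j) /negP.
rewrite -bigcup_seq; exists k; first by rewrite /= mem_index_enum.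
split; first by split; [exact: pos|].
by move=> j _ /= kj; move/forallP: kmax => /(_ j) /negP.
Qed.

End minimum_norm.

(** Here [m] and [v] are the first two moments of the scaled uncovered mass, [m1]
and [lam] successive approximations of [m], [C] the probability of a covering and
[P] that of a large minimum norm. *)
Lemma poisson_error_arith (R : realType)
    (eps lam kap lan zeta m1 m v B npq np2 D P C : R) :
  0 <= eps -> eps <= 2^-1 -> 0 <= lam -> 0 <= kap -> 0 <= zeta ->
  2 * kap <= eps -> lan <= eps -> 2 * zeta <= eps ->
  0 <= m1 -> (1 - eps) * lam <= m1 -> m1 <= lam -> 0 <= m -> 0 <= B ->
  0 <= npq -> 0 <= np2 -> 0 <= D ->
  m <= expR kap * m1 -> (1 - lan) * m1 <= m ->
  v <= expR (2 * kap) * m1 * ((1 + 2 * zeta) * m1 + B) ->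
  C <= expR (- m) + (v - m ^+ 2) + 2 * npq ->
  expR (- m) - 2 * npq - 4 * np2 <= C -> P <= C -> C - D <= P ->
  `|P - expR (- lam)| <=
    2 * eps * lam + 9 * eps * lam ^+ 2 + 2 * lam * B + 2 * npq + 4 * np2 + D.
Proof.
move=> eps0 eps2 lam0 kap0 zeta0 kap_le lan_le zeta_le m10 m1_ge m1_le m0 B0
  npq0 np20 D0 m_le m_ge v_le up lo A1 A2.
have e1 : expR kap <= 1 + eps.
  by apply: le_trans (expR_le1D2 kap0 _) _; lra.
have e2 : expR (2 * kap) <= 1 + 2 * eps.
  by apply: le_trans (expR_le1D2 _ _) _; lra.
have el0 : 0 <= eps * lam by rewrite mulr_ge0.
have m_le' : m <= lam + eps * lam.
  apply: (le_trans m_le); apply: (@le_trans _ _ ((1 + eps) * lam)); last by lra.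
  by apply: ler_pM => //; exact: expR_ge0.
have m_ge' : lam - 2 * eps * lam <= m.
  apply: le_trans m_ge; apply: (@le_trans _ _ ((1 - eps) * ((1 - eps) * lam))).
    have h : 0 <= eps * (eps * lam) by rewrite !mulr_ge0.
    by lra.
  apply: (@le_trans _ _ ((1 - eps) * m1)).
    by rewrite ler_wpM2l//; lra.
  by rewrite ler_wpM2r// lerB.
have ml : `|m - lam| <= 2 * eps * lam.
  by rewrite ler_norml; apply/andP; split; lra.
have elm := le_trans (expRN_lip m0 lam0) ml.
have v_le' : v <= (1 + 2 * eps) * lam * ((1 + eps) * lam + B).
  apply: (le_trans v_le); apply: ler_pM => //.
  - by rewrite mulr_ge0 ?expR_ge0.
  - by rewrite addr_ge0// mulr_ge0// addr_ge0// mulr_ge0.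
  - by apply: ler_pM => //; exact: expR_ge0.
  - rewrite lerD2r; apply: ler_pM => //; last by rewrite lerD2l.
    by rewrite addr_ge0// mulr_ge0.
have el2 : 0 <= eps * lam ^+ 2 by rewrite mulr_ge0// sqr_ge0.
have m2 : (1 - 4 * eps) * lam ^+ 2 <= m ^+ 2.
  have h0 : 0 <= lam - 2 * eps * lam.
    by rewrite -{1}[lam]mul1r -mulrBl mulr_ge0//; lra.
  have : (lam - 2 * eps * lam) ^+ 2 <= m ^+ 2 by rewrite lerXn2r// nnegrE.
  by apply: le_trans; have := sqr_ge0 (eps * lam); lra.
have lB : 0 <= lam * B by rewrite mulr_ge0.
have vm : v - m ^+ 2 <= 9 * eps * lam ^+ 2 + 2 * lam * B.
  have h2 : eps * (eps * lam ^+ 2) <= 2^-1 * (eps * lam ^+ 2).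
    by rewrite ler_wpM2r.
  have h3 : eps * (lam * B) <= 2^-1 * (lam * B) by rewrite ler_wpM2r.
  by lra.
move: elm; rewrite ler_norml => /andP[l1 l2].
by rewrite ler_norml; apply/andP; split; lra.
Qed.

Section critical_level.
Context {R : realType} {d : nat}.
Hypothesis d2 : (2 <= d)%N.
Variable nu : probability R R.
Hypothesis nuE : forall A : set R, measurable A -> nu A = exponential_prob 1 A.
Variable mu : probability (d.-tuple R) R.
Hypothesis iidmu : iid_law nu mu.
Variable n : nat.
Hypothesis n0 : (0 < n)%N.
Variable Q : probability (n.-tuple (d.-tuple R)) R.
Hypothesis iidQ : iid_law mu Q.
Variables (a r : R).
Hypotheses (a0 : 0 <= a) (ar : a <= r) (ra1 : r - a <= 1).

Let d0 : (0 < d)%N. Proof. exact: ltnW. Qed.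
Let N : R := n%:R.
Let La : R := N * expR (- a).
Let Lr : R := N * expR (- r).
Let rel : set (d.-tuple R * d.-tuple R) := [set p | strictly_below p.1 p.2].
Let M := slab (d := d) a r.
Let H := above (d := d) r.
Let m1 := critical_mean mu n a r.

Let mM : measurable M. Proof. exact: measurable_slab_nonneg. Qed.
Let mH : measurable H. Proof. exact: measurable_above. Qed.
Let mrel : measurable rel. Proof. exact: measurable_domination. Qed.

Let MH0 : M `&` H = set0.
Proof.
apply/seteqP; split=> // x [[_ /=]]; rewrite in_itv/= => /andP[_ xr].
by rewrite /H /above/= ltNge xr.
Qed.

Let mevent : measurable [set t : n.-tuple (d.-tuple R) | r < min_norm t].
Proof. exact: measurable_min_norm_gt. Qed.

Lemma undominated_deep_le i : (Q (undominated (E := d.-tuple R) (deep a) rel i) <=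
  \int[mu]_z ((expR 1)%:E * (\1_(deep a) z * weight n z)%:E))%E.
Proof.
have mdeep := measurable_deep (d := d) a.
rewrite (undominated_probability iidQ mdeep mrel); apply: ge0_le_integral => //.
- move=> z _; rewrite lee_fin mulr_ge0// exprn_ge0// subr_ge0.
  rewrite -lee_fin fineK ?probability_le1//; first exact: measurable_orthant.
  by rewrite fin_num_measure//; exact: measurable_orthant.
- apply/measurable_EFinP/measurable_funM; first exact: measurable_indic.
  apply: measurable_funX; apply: measurable_funB => //.
  exact: (measurable_section_mass mu mrel).
- apply: emeasurable_funM => //; apply/measurable_EFinP/measurable_funM.
    exact: measurable_indic.
  exact: measurable_weight.
move=> z _; rewrite -EFinM lee_fin mulrCA indicE.
have [dz|dz] := pselect (deep a z); last by rewrite memNset// !mul0r.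
rewrite mem_set// !mul1r; have [z0 _] := dz.
have hz : 0 <= height z by exact: sumr_ge0.
have -> : fine (mu [set w | rel (z, w)]) = expR (- height z).
  by rewrite -(orthant_mass_nonneg nuE iidmu z0).
apply: le_trans (onem_exp_le _ (expRN_le1 hz)) _.
rewrite /weight -expRD ler_expR.
have -> : n%:R = n.-1%:R + 1 :> R by rewrite natr1 prednK.
by have := expRN_le1 hz; lra.
Qed.

Lemma min_norm_gt_le :
  fine (Q [set t | r < min_norm t]) <= fine (Q (covering M H rel)).
Proof.
have mcov := measurable_covering (n := n) mM mH mrel.
apply: fine_le; rewrite ?fin_num_measure//.
by apply: le_measure; rewrite ?inE//; exact: min_norm_gt_sub.
Qed.

Lemma min_norm_gt_ge : fine (Q (covering M H rel)) -
    expR 1 * (simplex_vol (d := d) a * expR (- La)) <=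
  fine (Q [set t | r < min_norm t]).
Proof.
have mcov := measurable_covering (n := n) mM mH mrel.
have mdeep := measurable_deep (d := d) a.
have miso i := measurable_undominated (n := n) mdeep mrel i.
have mpos : measurable [set t : n.-tuple (d.-tuple R) | forall i, nonneg (tnth t i)].
  by apply: (measurable_box (A := fun=> nonneg)) => i; exact: measurable_nonneg.
set Iso := \big[setU/set0]_(i < n) undominated (E := d.-tuple R) (deep a) rel i.
have mIso : measurable Iso by apply: bigsetU_measurable => i _; exact: miso.
have Iso_le : (Q Iso <= (expR 1 * (simplex_vol (d := d) a * expR (- La)))%:E)%E.
  apply: le_trans (measure_bigsetU_le Q miso) _.
  apply: (@le_trans _ _ (\sum_(i < n) (\int[mu]_z ((expR 1)%:E *
      (\1_(deep a) z * weight n z)%:E)))%E).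
    by apply: lee_sum => i _; exact: undominated_deep_le.
  have mW : measurable_fun setT
      (fun z : d.-tuple R => (\1_(deep a) z * weight n z)%:E : \bar R).
    apply/measurable_EFinP/measurable_funM; first exact: measurable_indic.
    exact: measurable_weight.
  have W0 (z : d.-tuple R) : (0 <= (\1_(deep a) z * weight n z)%:E :> \bar R)%E.
    by rewrite lee_fin mulr_ge0 ?expR_ge0.
  have I0 : (0 <= \int[mu]_z (\1_(deep a) z * weight n z)%:E)%E.
    by apply: integral_ge0 => z _; exact: W0.
  have := deep_integral_le d2 nuE iidmu n0 a0.
  rewrite (ge0_integralZl _ measurableT mW)//.
  move: I0; case: (\int[mu]_z _)%E => [w|//|//]; last first.
    by rewrite gt0_muley// lte_fin ltr0n.
  rewrite -!EFinM sumEFin sumr_const card_ord !lee_fin => _ h.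
  by rewrite -(mulr_natl (expR 1 * w)) mulrCA ler_wpM2l ?expR_ge0.
have Neg0 : Q (~` [set t | forall i, nonneg (tnth t i)]) = 0%E.
  transitivity (1 - Q [set t | forall i, nonneg (tnth t i)])%E.
    exact: probability_setC.
  have mnn (i : 'I_n) : measurable (@nonneg R d) by exact: measurable_nonneg.
  have -> : Q [set t | forall i, nonneg (tnth t i)] = 1%E.
    rewrite [LHS](iidQ mnn); apply: big1 => i _.
    exact: (nonneg_mass nuE iidmu).
  by rewrite subee.
rewrite lerBlDr -lee_fin EFinD !fineK ?fin_num_measure//.
apply: (@le_trans _ _ (Q [set t | (r < min_norm t)%R] + (Q Iso +
    Q (~` [set t | forall i, nonneg (tnth t i)])))%E); last first.
  by rewrite Neg0 adde0 leeD2l.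
apply: (@le_trans _ _ (Q ([set t | (r < min_norm t)%R] `|` (Iso `|`
    ~` [set t | forall i, nonneg (tnth t i)])))).
  apply: le_measure; rewrite ?inE//; last exact: covering_sub.
  by apply: measurableU => //; apply: measurableU => //; exact: measurableC.
apply: le_trans (measureU2 _ _ _) _ => //.
  by apply: measurableU => //; exact: measurableC.
by rewrite leeD2l// measureU2//; exact: measurableC.
Qed.

Variables (eta K : R).
Hypotheses (eta0 : 0 <= eta) (eeta : r - a <= eta) (eta2 : eta - (r - a) <= 2).
Hypothesis K0 : 0 <= K.
Let kap : R := La * (r - a) ^+ 2.
Let theta : R := expR (- (Lr * ((eta - (r - a)) / 4))).
Let zeta : R := La * expR (- ((K - (r - a)) / 2)).
Let B : R := cube_bound (d := d) n a r eta + theta * cube_bound (d := d) n a r K.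
Let p : R := fine (mu M).
Let q : R := fine (mu H).
Variables (lam eps : R).
Hypotheses (eps0 : 0 <= eps) (eps2 : eps <= 2^-1) (lam0 : 0 <= lam).
Hypotheses (kap_le : 2 * kap <= eps) (La_le : La ^+ 2 / N <= eps).
Hypothesis zeta_le : 2 * zeta <= eps.
Hypothesis q_le : q <= 2^-1.
Hypotheses (m1_ge : (1 - eps) * lam <= m1) (m1_le : m1 <= lam).

Let N0 : 0 < N. Proof. by rewrite ltr0n. Qed.
Let La0 : 0 <= La. Proof. by rewrite mulr_ge0 ?expR_ge0// ltW. Qed.
Let kap0 : 0 <= kap. Proof. by rewrite mulr_ge0// sqr_ge0. Qed.
Let zeta0 : 0 <= zeta. Proof. by rewrite mulr_ge0 ?expR_ge0. Qed.
Let m10 : 0 <= m1. Proof. exact: critical_mean_ge0. Qed.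

Let cube_bound_ge0 rho : 0 <= rho -> 0 <= cube_bound (d := d) n a r rho.
Proof.
move=> rho0; rewrite !mulr_ge0 ?subr_ge0//.
by rewrite exprn_ge0// !mulr_ge0// expR_ge0.
Qed.

Let B0 : 0 <= B.
Proof.
apply: addr_ge0; first exact: cube_bound_ge0.
by apply: mulr_ge0; [exact: expR_ge0|exact: cube_bound_ge0].
Qed.

(** The minimum norm exceeds [r] when the slab is covered, up to a deep maximum.
The exponential appears because the scaled uncovered mass has a small variance:
[eps] is the relative error on its mean and [B] the contribution of close pairs to
its second moment. The products of [p] and [q] are the price of replacing a
binomial law by a Poisson law. *)
Lemma min_norm_poisson : `|fine (Q [set t | r < min_norm t]) - expR (- lam)| <=
  2 * eps * lam + 9 * eps * lam ^+ 2 + 2 * lam * B + 2 * (N * p * q) +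
  4 * (N * p ^+ 2) + expR 1 * (simplex_vol (d := d) a * expR (- La)).
Proof.
have mean_lty (f : n.-tuple (d.-tuple R) -> \bar R) : measurable_fun setT f ->
    (forall t, 0 <= f t <= 1)%E -> (\int[Q]_t f t \is a fin_num)%E.
  move=> mf f01; apply/fin_numPlt.
  rewrite (lt_le_trans (ltNyr 0))/=; last first.
    by apply: integral_ge0 => t _; have /andP[] := f01 t.
  apply: (@le_lt_trans _ _ (\int[Q]_t 1%:E)%E).
    apply: ge0_le_integral => //.
    - by move=> t _; have /andP[] := f01 t.
    - by move=> t _; have /andP[] := f01 t.
  by rewrite probability_integral_cst ltry.
have mU := measurable_uncovered_mass (n := n) mu mM mH mrel.
have U01 (t : n.-tuple (d.-tuple R)) : (0 <= mu (uncovered M H rel t) <= 1)%E.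
  by rewrite measure_ge0 probability_le1//; exact: measurable_uncovered.
have fin1 := mean_lty _ mU U01.
have fin2 : (\int[Q]_t (mu (uncovered M H rel t) * mu (uncovered M H rel t))
    \is a fin_num)%E.
  apply: mean_lty; first exact: emeasurable_funM.
  by move=> t; have /andP[u0 u1] := U01 t; rewrite mule_ge0// -[leRHS]mule1 lee_pmul.
pose m := N * fine (\int[Q]_t mu (uncovered M H rel t))%E.
pose v := N ^+ 2 *
  fine (\int[Q]_t (mu (uncovered M H rel t) * mu (uncovered M H rel t)))%E.
have mE : (N%:E * \int[Q]_t mu (uncovered M H rel t) = m%:E)%E.
  by rewrite EFinM fineK.
have vE : ((N ^+ 2)%:E * \int[Q]_t (mu (uncovered M H rel t) *
    mu (uncovered M H rel t)) = v%:E)%E.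
  by rewrite [v%:E]EFinM fineK.
have up := covering_upper iidQ mM mH mrel MH0 q_le mE vE.
have lo := covering_lower iidQ mM mH mrel MH0 q_le mE.
have m_le : m <= expR kap * m1.
  rewrite -lee_fin -mE (uncovered_mass_mean iidQ mM mH mrel).
  exact: (mean_uncovered_le d2 nuE iidmu n0 ar ra1).
have m_ge : (1 - La ^+ 2 / N) * m1 <= m.
  rewrite -lee_fin -mE (uncovered_mass_mean iidQ mM mH mrel).
  exact: (mean_uncovered_ge nuE iidmu n0 r a0).
have v_le : v <= expR (2 * kap) * m1 * ((1 + 2 * zeta) * m1 + B).
  rewrite -lee_fin -vE (uncovered_mass_second_moment iidQ mM mH mrel).
  rewrite /B addrA.
  apply: (second_moment_uncovered_le d2 nuE iidmu n0 ar ra1 eta0 eeta eta2 K0).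
  by move: zeta_le eps2; rewrite -/La -/zeta; lra.
have m0 : 0 <= m.
  by rewrite mulr_ge0 ?(ltW N0)// fine_ge0// integral_ge0.
have D0 : 0 <= expR 1 * (simplex_vol (d := d) a * expR (- La)).
  apply: mulr_ge0; first exact: expR_ge0.
  by apply: mulr_ge0; [exact: simplex_vol_ge0|exact: expR_ge0].
have npq : 0 <= N * p * q by rewrite mulr_ge0 ?fine_ge0// mulr_ge0 ?fine_ge0// ltW.
have np2 : 0 <= N * p ^+ 2 by rewrite mulr_ge0 ?sqr_ge0// ltW.
exact: (poisson_error_arith eps0 eps2 lam0 kap0 zeta0 kap_le La_le zeta_le m10
  m1_ge m1_le m0 B0 npq np2 D0 m_le m_ge v_le up lo min_norm_gt_le min_norm_gt_ge).
Qed.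

End critical_level.

(** * Size of the errors *)

Section growth.
Context {R : realType}.
Implicit Types x : R.

Lemma pow_le_expR j x : 0 <= x -> x ^+ j <= j%:R ^+ j * expR x.
Proof.
move=> x0; case: j => [|j]; first by rewrite expr0 mul1r -expR0 ler_expR.
have j0 : (j.+1%:R : R) != 0 by rewrite pnatr_eq0.
have {2}-> : x = x / j.+1%:R * j.+1%:R by rewrite divfK.
rewrite expRM_natr -exprMn lerXn2r ?nnegrE//.
rewrite -ler_pdivrMl ?ltr0n// mulrC.
by apply: le_trans (expR_ge1Dx _); rewrite lerDr.
Qed.

Lemma expRN_mul_pow j x : 0 <= x -> expR (- x) * x ^+ j <= j%:R ^+ j.
Proof.
move=> x0; rewrite expRN mulrC ler_pdivrMr ?expR_gt0//.
exact: pow_le_expR.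
Qed.

Lemma ln_le_self x : 0 <= x -> ln x <= x.
Proof.
rewrite le_eqVlt => /predU1P[<-|x0]; first by rewrite ln0.
have := expR_ge1Dx (ln x); rewrite lnK ?posrE//; lra.
Qed.

Lemma expR_le_quadratic x : x <= 2^-1 -> expR x <= 1 + x + 2 * x ^+ 2.
Proof.
move=> x2; have e1 := expRN_ge x; have e0 := expR_gt0 (- x).
have -> : expR x = (expR (- x))^-1 by rewrite expRN invrK.
rewrite -[leLHS]mul1r ler_pdivrMr//.
have p0 : 0 <= 1 + x + 2 * x ^+ 2.
  have -> : 1 + x + 2 * x ^+ 2 = (1 + x / 2) ^+ 2 + 7 / 4 * x ^+ 2 by field.
  by rewrite addr_ge0 ?sqr_ge0// mulr_ge0 ?sqr_ge0// divr_ge0.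
apply: le_trans (ler_wpM2l p0 e1).
have -> : (1 + x + 2 * x ^+ 2) * (1 - x) = 1 + x ^+ 2 * (1 - 2 * x) by ring.
by rewrite lerDl mulr_ge0 ?sqr_ge0//; lra.
Qed.

Lemma onem_mul3_ge x y e : 0 <= x -> 0 <= y -> 10 * x + y <= e -> e <= 2^-1 ->
  1 - e <= (1 - 8 * x) * (1 - y) * (1 - 2 * x).
Proof.
move=> x0 y0 xye e2; have xy : 0 <= x * y by exact: mulr_ge0.
have : 0 <= x ^+ 2 * (1 - y) by rewrite mulr_ge0 ?sqr_ge0//; lra.
by rewrite expr2; nra.
Qed.

End growth.

(** An upper bound of [expR (- (w / 4)) * w ^+ 14], namely [14 ^+ 14 * 4 ^+ 14]. *)
Definition decay_cst (R : realType) : R := 56 ^+ 14.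

(** An upper bound of the mass above the critical height times [u ^+ k.+1], where
[u] is the logarithm of the sample size. *)
Definition tail_cst (R : realType) (k : nat) : R :=
  k.+1%:R * (2 * k.+1%:R * k.+1%:R) ^+ k.+1.

(** The relative error on the mean at the critical height is [eps_cst] times
[w ^- 6]; [error_cst] adds up all terms of the resulting Poisson approximation. *)
Definition eps_cst (R : realType) (k : nat) : R :=
  1024 * k%:R ^+ 2 + 20 * k%:R + 8 * k%:R * decay_cst R + 4 * tail_cst R k.

Definition error_cst (R : realType) (k : nat) : R :=
  11 * eps_cst R k + 32 * k%:R + 8 * k%:R * decay_cst R +
  32 * k%:R * tail_cst R k + 1024 * k%:R ^+ 2 * (2 * k.+1)%:R ^+ (2 * k.+1) +
  expR 1 * decay_cst R.

(** In terms of [w], the eighth root of the twice iterated logarithm of the sample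
size, all errors are powers of [i = w^-1]. The slab has width [i ^+ 7], thin
enough for the part of an orthant between a slab point and the critical level to
be negligible, and yet crossing it multiplies the mean by at least
[expR (w / 2)]. Close pairs are those at distance
[i ^+ 6]. *)
Section critical_scale.
Context {R : realType}.
Variables (k : nat) (w s : R).
Hypothesis k0 : (0 < k)%N.
Hypothesis w_ge : 2 * eps_cst R k <= w.
Hypotheses (s_ge : - w <= s) (s_le : s <= w).

Let i : R := w^-1.
Let l : R := w ^+ 8.
Let u : R := expR l.
Let N : R := expR u.
Let lam : R := expR (k%:R * s) / k`!%:R.

(** The level that the minimum norm has to exceed for its centred and scaled
version to exceed [s]. *)
Definition critical_height : R := u - ln l - ln k%:R + s / l.
Let r : R := critical_height.
Let a : R := r - i ^+ 7.
Let Lr : R := N * expR (- r).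
Let La : R := N * expR (- a).

Let k1 : 1 <= k%:R :> R. Proof. by rewrite ler1n. Qed.
Let E : R := decay_cst R.
Let D : R := tail_cst R k.
Let c : R := eps_cst R k.
Let E0 : 0 <= E. Proof. exact: exprn_ge0. Qed.
Let D0 : 0 <= D. Proof. by rewrite mulr_ge0// exprn_ge0// !mulr_ge0. Qed.
Let kE : E <= k%:R * E. Proof. by rewrite ler_peMl. Qed.
Let k2 : k%:R <= k%:R ^+ 2 :> R. Proof. by rewrite expr2 ler_peMl. Qed.
Let cE : c = 1024 * k%:R ^+ 2 + 20 * k%:R + 8 * (k%:R * E) + 4 * D.
Proof. by rewrite /c /eps_cst mulrA. Qed.
Let w64 : 64 * k%:R + 16 <= w.
Proof. by move: w_ge cE kE k2 E0 D0 k1; rewrite -/c; lra. Qed.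
Let w80 : 80 <= w. Proof. by move: w64 k1; lra. Qed.
Let w0 : 0 < w. Proof. by move: w80; lra. Qed.
Let wn0 : w != 0. Proof. by rewrite gt_eqF. Qed.
Let i0 : 0 < i. Proof. by rewrite invr_gt0. Qed.
Let i80 : i <= 80^-1. Proof. by rewrite lef_pV2 ?posrE//; move: w80; lra. Qed.
Let i1 : i <= 1. Proof. by apply: le_trans i80 _; lra. Qed.
Let iX m n : (m <= n)%N -> i ^+ n <= i ^+ m.
Proof. by move=> mn; apply: ler_wiXn2l => //; exact: ltW. Qed.
Let iX0 n : 0 <= i ^+ n. Proof. by rewrite exprn_ge0// ltW. Qed.
Let l0 : 0 < l. Proof. by rewrite exprn_gt0. Qed.
Let i7_small : i ^+ 7 <= 80^-1. Proof. by apply: le_trans (iX (isT : (1 <= 7)%N)) _. Qed.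

Let w_le_l : w <= l.
Proof. by rewrite -[leLHS]expr1 ler_weXn2l//; move: w80; lra. Qed.

Let u_ge : w ^+ 16 / 4 <= u.
Proof.
have := pow_le_expR 2 (ltW l0); rewrite -exprM -natrX /= -/u.
by rewrite ler_pdivrMr// mulrC.
Qed.

Let u0 : 0 < u. Proof. exact: expR_gt0. Qed.
Let N0 : 0 < N. Proof. exact: expR_gt0. Qed.

Let sl : R := s / l.
Let sl_le : `|sl| <= i ^+ 7.
Proof.
rewrite /sl normrM [X in _ * X]ger0_norm ?invr_ge0 ?(ltW l0)//.
rewrite ler_pdivrMr//; have -> : i ^+ 7 * l = w by rewrite /i /l; field.
by rewrite ler_norml s_ge s_le.
Qed.

Let Lr_eq : Lr = k%:R * l * expR (- sl).
Proof.
rewrite /Lr /r /critical_height -/sl.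
have -> : - (u - ln l - ln k%:R + sl) = - u + (ln l + (ln k%:R - sl)) by ring.
rewrite expRD expRD expRD lnK ?posrE// lnK ?posrE ?ltr0n//.
by rewrite mulrA -expRD subrr expR0 mul1r mulrCA mulrA.
Qed.

Let kl0 : 0 < k%:R * l. Proof. by rewrite mulr_gt0 ?ltr0n. Qed.

Let Lr_le : Lr <= 2 * (k%:R * l).
Proof.
rewrite Lr_eq mulrC ler_wpM2r ?(ltW kl0)//.
have [n1 n2] : - i ^+ 7 <= sl /\ sl <= i ^+ 7 by apply/andP; rewrite -ler_norml.
apply: (@le_trans _ _ (expR (i ^+ 7))); first by rewrite ler_expR lerNl.
by apply: le_trans (expR_le1D2 (iX0 7) _) _; move: i7_small; lra.
Qed.

Let Lr_ge : k%:R * l / 2 <= Lr.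
Proof.
rewrite Lr_eq ler_wpM2l ?(ltW kl0)//.
have [n1 n2] : - i ^+ 7 <= sl /\ sl <= i ^+ 7 by apply/andP; rewrite -ler_norml.
by apply: le_trans (expRN_ge _); move: i7_small; lra.
Qed.

Let La_eq : La = Lr * expR (i ^+ 7).
Proof. by rewrite /La /Lr /a opprB -mulrA -expRD [_ + - r]addrC. Qed.

Let Lr0 : 0 < Lr. Proof. by rewrite mulr_gt0 ?expR_gt0. Qed.

Let La_le : La <= 4 * (k%:R * l).
Proof.
rewrite La_eq; apply: (@le_trans _ _ (2 * (k%:R * l) * 2)); last by lra.
apply: ler_pM => //; first exact: ltW.
by apply: le_trans (expR_le1D2 (iX0 7) _) _; move: i7_small; lra.
Qed.

(** The gap makes the lower edge of the slab negligible: the mean there is smaller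
by an exponential factor in [w]. *)
Let La_gap : w / 2 <= La - Lr.
Proof.
rewrite La_eq -[X in _ - X]mulr1 -mulrBr.
have e1 : i ^+ 7 <= expR (i ^+ 7) - 1 by have := expR_ge1Dx (i ^+ 7); lra.
apply: (@le_trans _ _ (k%:R * l / 2 * i ^+ 7)); last first.
  by apply: ler_pM => //; rewrite divr_ge0 ?(ltW kl0).
have -> : k%:R * l / 2 * i ^+ 7 = k%:R * (w / 2) by rewrite /i /l; field.
by rewrite ler_peMl// divr_ge0// ltW.
Qed.

Let u_pow_inv : expR (- (k%:R * l)) * u ^+ k = 1.
Proof. by rewrite /u -expRM_natl -expRD addNr expR0. Qed.

(** The height is chosen so that the exponential of [Lr] balances the volume of
the simplex of size [u]. *)
Let expRLr_le : expR (- Lr) * u ^+ k <= expR (k%:R * s).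
Proof.
rewrite -[leRHS]mulr1 -[X in _ <= _ * X]u_pow_inv mulrA -expRD ler_wpM2r ?exprn_ge0 ?(ltW u0)//.
rewrite ler_expR Lr_eq.
have -> : k%:R * s = k%:R * l * sl by rewrite /sl; field; rewrite gt_eqF.
by have := ler_wpM2l (ltW kl0) (expRN_ge sl); lra.
Qed.

Let expRLr_ge : (1 - 2 * k%:R * i ^+ 6) * expR (k%:R * s) <= expR (- Lr) * u ^+ k.
Proof.
have h : Lr <= k%:R * l - k%:R * s + 2 * k%:R * i ^+ 6.
  rewrite Lr_eq.
  have n1 : - sl <= i ^+ 7 by apply: le_trans (ler_norm _) _; rewrite normrN.
  have := expR_le_quadratic (_ : - sl <= 2^-1) => /(_ _) h.
  have {}h : expR (- sl) <= 1 + - sl + 2 * (- sl) ^+ 2.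
    by apply: expR_le_quadratic; move: i7_small; lra.
  have s2 : l * sl ^+ 2 <= i ^+ 6.
    have -> : i ^+ 6 = l * (i ^+ 7) ^+ 2 by rewrite /i /l; field.
    by rewrite ler_wpM2l ?(ltW l0)// -(real_normK (num_real sl)) lerXn2r ?nnegrE.
  have -> : k%:R * s = k%:R * l * sl by rewrite /sl; field; rewrite gt_eqF.
  have := ler_wpM2l (ltW kl0) h; have := ler_wpM2l (ltW (lt_le_trans ltr01 k1)) s2.
  by rewrite sqrrN; lra.
have h2 : - (k%:R * l) + (k%:R * s - 2 * k%:R * i ^+ 6) <= - Lr by lra.
apply: (@le_trans _ _ (expR (k%:R * s - 2 * k%:R * i ^+ 6))).
  rewrite expRD mulrC ler_wpM2l ?expR_ge0//; exact: expRN_ge.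
rewrite -[leLHS]mulr1 -[X in _ * X <= _]u_pow_inv mulrA -expRD ler_wpM2r ?exprn_ge0 ?(ltW u0)//.
by rewrite ler_expR addrC.
Qed.

Let i7s : i ^+ 7 * l = w. Proof. by rewrite /i /l; field. Qed.

Let l_ge : 80 <= l. Proof. by apply: le_trans w80 w_le_l. Qed.

Let ul : l ^+ 2 / 4 <= u. Proof. by rewrite /l -exprM. Qed.
Let ul20 : 20 * l <= u.
Proof. by apply: le_trans ul; move: l_ge; nra. Qed.

Let lu : l / u <= 4 * i ^+ 8.
Proof.
rewrite ler_pdivrMr//; apply: (@le_trans _ _ (4 * i ^+ 8 * (l ^+ 2 / 4))).
  by rewrite /i /l le_eqVlt; apply/orP; left; apply/eqP; field.
by rewrite ler_wpM2l// mulr_ge0.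
Qed.

Let sl_itv : - i ^+ 7 <= sl <= i ^+ 7. Proof. by rewrite -ler_norml. Qed.

Let u_gap : u - a <= 2 * l.
Proof.
rewrite /a /r /critical_height -/sl.
have h1 : ln l <= l by apply: ln_le_self; exact: ltW.
have h2 : ln k%:R <= k%:R :> R by apply: ln_le_self.
by have /andP[] := sl_itv; move: w64 w_le_l i7_small k1; lra.
Qed.

Let r_le_u : r <= u.
Proof.
rewrite /r /critical_height -/sl.
have h1 : 1 - l^-1 <= ln l.
  rewrite -ler_expR lnK ?posrE// -[leRHS]invrK -(invrK (expR _)) -expRN.
  rewrite lef_pV2 ?posrE ?expR_gt0 ?invr_gt0//.
  by apply: le_trans (expRN_ge _); lra.
have h2 : 0 <= ln k%:R :> R by exact: ln_ge0.
have h3 : l^-1 <= 80^-1 by rewrite lef_pV2 ?posrE.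
by have /andP[] := sl_itv; move: i7_small; lra.
Qed.

Let ar : a <= r. Proof. by rewrite gerBl. Qed.
Let ra : r - a = i ^+ 7. Proof. by rewrite /a; ring. Qed.
Let a_ge : u / 2 <= a. Proof. by move: u_gap ul20 u0; lra. Qed.
Let a0 : 0 <= a. Proof. by apply: le_trans a_ge; rewrite divr_ge0// ltW. Qed.
Let r0 : 0 <= r. Proof. exact: le_trans ar. Qed.

Let vol (t : R) : R := simplex_vol (d := k.+1) t.
Let volE t : vol t = t ^+ k / k`!%:R. Proof. by []. Qed.
Let fact0 : 0 < k`!%:R :> R. Proof. by rewrite ltr0n fact_gt0. Qed.
Let lam_gt0 : 0 < lam. Proof. by rewrite divr_gt0 ?expR_gt0. Qed.
Let vol_le t : 0 <= t -> t <= u -> vol t <= vol u.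
Proof.
move=> t0 tu; rewrite !volE ler_wpM2r ?invr_ge0 ?(ltW fact0)//.
by rewrite lerXn2r ?nnegrE ?(ltW u0).
Qed.
Let vol0 t : 0 <= t -> 0 <= vol t. Proof. exact: simplex_vol_ge0. Qed.

Let vol_Lr_le : vol u * expR (- Lr) <= lam.
Proof.
rewrite volE mulrAC /lam ler_wpM2r ?invr_ge0 ?(ltW fact0)//.
by rewrite mulrC.
Qed.

Let vol_Lr_ge : (1 - 2 * k%:R * i ^+ 6) * lam <= vol u * expR (- Lr).
Proof.
rewrite volE [leRHS]mulrAC /lam [leLHS]mulrA ler_wpM2r ?invr_ge0 ?(ltW fact0)//.
by rewrite [leRHS]mulrC.
Qed.

Let vol_a_ge : (1 - 8 * k%:R * i ^+ 6) * vol u <= vol a.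
Proof.
have au : a <= u by exact: le_trans r_le_u.
have p0 : 0 <= 1 - a / u by rewrite subr_ge0 ler_pdivrMr// mul1r.
have p1 : 1 - a / u <= 1 by rewrite gerBl divr_ge0// ltW.
have p8 : 1 - a / u <= 8 * i ^+ 6.
  have -> : 1 - a / u = (u - a) / u by field; rewrite gt_eqF.
  apply: (@le_trans _ _ (2 * (l / u))).
    by rewrite mulrA ler_wpM2r ?invr_ge0 ?(ltW u0).
  by have := iX (isT : (6 <= 8)%N); move: lu; lra.
have := bernoulli_ge k p0 p1; rewrite opprB addrCA subrr addr0 => h.
have -> : vol a = (a / u) ^+ k * vol u.
  by rewrite !volE expr_div_n mulrA divfK// expf_neq0// gt_eqF.
rewrite ler_wpM2r ?vol0 ?(ltW u0)//; apply: le_trans h.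
by rewrite lerB// mulrAC ler_wpM2r.
Qed.

Let decay : expR (- (w / 4)) <= E * i ^+ 14.
Proof.
have w40 : 0 <= w / 4 by rewrite divr_ge0// ltW.
have := expRN_mul_pow 14 w40; rewrite expr_div_n /i exprVn.
have -> : E = 14 ^+ 14 * 4 ^+ 14 by rewrite /E /decay_cst -exprMn -natrM.
by rewrite ler_pdivlMr ?exprn_gt0// mulrA ler_pdivrMr ?exprn_gt0.
Qed.

Let decay_half : expR (- (w / 2)) <= E * i ^+ 14.
Proof. by apply: le_trans decay; rewrite ler_expR; move: w0; lra. Qed.

Let eps : R := c * i ^+ 6.

Let eps0 : 0 <= eps.
Proof.
by rewrite mulr_ge0//; move: cE kE k2 E0 D0 k1; lra.
Qed.

Let ci : c * i <= 2^-1.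
Proof. by rewrite ler_pdivrMr//; move: w_ge; rewrite -/c; lra. Qed.

Let c0 : 0 <= c. Proof. by move: cE kE k2 E0 D0 k1; lra. Qed.

Let eps2 : eps <= 2^-1.
Proof. by apply: le_trans ci; rewrite ler_wpM2l// (iX (isT : (1 <= 6)%N)). Qed.

Let expRLa_le : expR (- La) <= expR (- Lr) * (E * i ^+ 14).
Proof.
have -> : - La = - Lr + - (La - Lr) by ring.
rewrite expRD ler_wpM2l ?expR_ge0//; apply: le_trans decay_half.
by rewrite ler_expR lerN2.
Qed.

Variable n : nat.
Hypothesis nE : n%:R = N.

Variable nu : probability R R.
Hypothesis nuE : forall A : set R, measurable A -> nu A = exponential_prob 1 A.
Variable mu : probability (k.+1.-tuple R) R.
Hypothesis iidmu : iid_law nu mu.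
Variable Q : probability (n.-tuple (k.+1.-tuple R)) R.
Hypothesis iidQ : iid_law mu Q.
Hypothesis lam_le : lam <= w.

Let n0 : (0 < n)%N. Proof. by rewrite -(ltr0n R) nE. Qed.
Let d2 : (2 <= k.+1)%N. Proof. by []. Qed.
Let m1 : R := critical_mean mu n a r.

Let m1_le : m1 <= lam.
Proof.
apply: le_trans (critical_mean_le d2 nuE iidmu n0 a0 ar) _.
rewrite nE -/Lr; apply: le_trans vol_Lr_le.
by rewrite ler_wpM2r ?expR_ge0// vol_le.
Qed.

Let m1_ge : (1 - eps) * lam <= m1.
Proof.
have := critical_mean_ge d2 nuE iidmu n0 a0 ar; apply: le_trans.
rewrite nE -/Lr -/La -/(vol a).
have e14 : E * i ^+ 14 <= E * i ^+ 6 by rewrite ler_wpM2l// iX.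
have h1 : (1 - E * i ^+ 6) * expR (- Lr) <= expR (- Lr) - expR (- La).
  have := expRLa_le; have := ler_wpM2l (expR_ge0 (- Lr)) e14; lra.
have k6 : 0 <= k%:R * i ^+ 6 by rewrite mulr_ge0.
have E6 : 0 <= E * i ^+ 6 by rewrite mulr_ge0.
have ceps : 10 * (k%:R * i ^+ 6) + E * i ^+ 6 <= eps.
  rewrite mulrA -mulrDl ler_wpM2r//.
  by move: cE kE k2 E0 D0 k1; lra.
have x1 : 0 <= 1 - 8 * k%:R * i ^+ 6 by move: eps2; lra.
have x2 : 0 <= 1 - E * i ^+ 6 by move: eps2; lra.
apply: (@le_trans _ _ (((1 - 8 * k%:R * i ^+ 6) * vol u) *
    ((1 - E * i ^+ 6) * expR (- Lr)))); last first.
  by apply: ler_pM => //; rewrite mulr_ge0 ?expR_ge0 ?vol0 ?(ltW u0).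
apply: (@le_trans _ _ ((1 - 8 * k%:R * i ^+ 6) * (1 - E * i ^+ 6) *
    ((1 - 2 * k%:R * i ^+ 6) * lam))); last first.
  rewrite [leRHS](_ : _ = (1 - 8 * k%:R * i ^+ 6) * (1 - E * i ^+ 6) *
    (vol u * expR (- Lr))); last by ring.
  by rewrite ler_wpM2l// mulr_ge0.
rewrite mulrA ler_wpM2r ?(ltW lam_gt0)// -[8 * _ * _]mulrA -[2 * _ * _]mulrA.
exact: onem_mul3_ge k6 E6 ceps eps2.
Qed.

Let klX m : k%:R * l * i ^+ (8 + m) = k%:R * i ^+ m.
Proof. by rewrite exprD /i /l -mulrA; congr (_ * _); field. Qed.

Let kap_le : 2 * (La * (r - a) ^+ 2) <= eps.
Proof.
rewrite ra -exprM.
apply: (@le_trans _ _ (2 * (4 * (k%:R * l) * i ^+ 14))).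
  by rewrite ler_wpM2l// ler_wpM2r.
have := klX 6; rewrite (_ : (8 + 6)%N = 14%N)// => h.
have -> : 2 * (4 * (k%:R * l) * i ^+ 14) = 8 * k%:R * i ^+ 6 by move: h; lra.
by rewrite ler_wpM2r//; move: cE kE k2 E0 D0 k1; lra.
Qed.

Let La0 : 0 <= La. Proof. by rewrite mulr_ge0 ?expR_ge0// ltW. Qed.

Let invN_le : N^-1 <= 64 * i ^+ 32.
Proof.
have h := expRN_mul_pow 2 (ltW u0); rewrite /N -expRN.
have h2 : l ^+ 4 / 16 <= u ^+ 2.
  have -> : l ^+ 4 / 16 = (l ^+ 2 / 4) ^+ 2 by field.
  by rewrite lerXn2r ?nnegrE ?(ltW u0)// divr_ge0// exprn_ge0// ltW.
have h3 : expR (- u) * (l ^+ 4 / 16) <= 4.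
  apply: (@le_trans _ _ (expR (- u) * u ^+ 2)); last by rewrite (le_trans h)// -natrX.
  by rewrite ler_wpM2l ?expR_ge0.
have -> : 64 * i ^+ 32 = 64 / l ^+ 4 by rewrite /i /l; field.
by rewrite ler_pdivlMr ?exprn_gt0//; move: h3; lra.
Qed.

Let La2_le : La ^+ 2 / N <= eps.
Proof.
apply: (@le_trans _ _ ((4 * (k%:R * l)) ^+ 2 * (64 * i ^+ 32))).
  apply: ler_pM => //; rewrite ?sqr_ge0 ?invr_ge0 ?(ltW N0)//.
  by rewrite lerXn2r ?nnegrE// mulr_ge0// ltW.
have -> : (4 * (k%:R * l)) ^+ 2 * (64 * i ^+ 32) = 1024 * k%:R ^+ 2 * i ^+ 16.
  by rewrite /i /l; field.
apply: (@le_trans _ _ (1024 * k%:R ^+ 2 * i ^+ 6)).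
  apply: ler_wpM2l; last exact: iX.
  by have := sqr_ge0 (k%:R : R); lra.
by rewrite ler_wpM2r//; move: cE kE k2 E0 D0 k1; lra.
Qed.

Let zeta_le : 2 * (La * expR (- ((w - (r - a)) / 2))) <= eps.
Proof.
apply: (@le_trans _ _ (2 * (4 * (k%:R * l) * (E * i ^+ 14)))).
  rewrite ler_wpM2l//; apply: ler_pM => //.
  by apply: le_trans decay; rewrite ler_expR ra; move: w80 i7_small; lra.
have := klX 6; rewrite (_ : (8 + 6)%N = 14%N)// => h.
have -> : 2 * (4 * (k%:R * l) * (E * i ^+ 14)) = 8 * (k%:R * E) * i ^+ 6.
  by rewrite [LHS](_ : _ = 8 * E * (k%:R * l * i ^+ 14)); [rewrite h; ring|ring].
by rewrite ler_wpM2r//; move: cE kE k2 E0 D0 k1; lra.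
Qed.

Let p : R := fine (mu (slab a r)).
Let q : R := fine (mu (above r)).
Let p0 : 0 <= p. Proof. exact: fine_ge0. Qed.
Let q0 : 0 <= q. Proof. exact: fine_ge0. Qed.

Let q_pow : q * u ^+ k.+1 <= D.
Proof.
apply: (@le_trans _ _ (k.+1%:R * expR (- (r / k.+1%:R)) * u ^+ k.+1)).
  rewrite ler_wpM2r ?exprn_ge0 ?(ltW u0)//.
  exact: (above_mass_le nuE iidmu).
have d0 : 0 < k.+1%:R :> R by rewrite ltr0n.
pose x := u / (2 * k.+1%:R).
have x0 : 0 <= x by rewrite divr_ge0 ?(ltW u0)// mulr_ge0.
have ux : u = 2 * k.+1%:R * x by rewrite /x; field; rewrite gt_eqF.
have h : expR (- (r / k.+1%:R)) * x ^+ k.+1 <= k.+1%:R ^+ k.+1.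
  apply: le_trans (expRN_mul_pow k.+1 x0); rewrite ler_wpM2r ?exprn_ge0//.
  rewrite ler_expR lerN2 /x invfM mulrA ler_wpM2r ?invr_ge0 ?(ltW d0)//.
  exact: le_trans ar.
have -> : k.+1%:R * expR (- (r / k.+1%:R)) * u ^+ k.+1 =
    k.+1%:R * ((2 * k.+1%:R) ^+ k.+1 * (expR (- (r / k.+1%:R)) * x ^+ k.+1)).
  by rewrite {1}ux exprMn; ring.
rewrite /D /tail_cst [in leRHS]exprMn ler_wpM2l// ler_wpM2l//.
Qed.

Let u1 : 1 <= u. Proof. by move: ul20 l_ge; lra. Qed.

Let q_le : q <= 2^-1.
Proof.
have h1 : q * u <= D.
  apply: le_trans q_pow; rewrite ler_wpM2l//.
  by rewrite exprS ler_peMr ?(ltW u0)// exprn_ege1.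
have h2 : q * (w / 4) <= D.
  apply: le_trans h1; rewrite ler_wpM2l//.
  by move: ul20 w_le_l l_ge; lra.
have h3 : 8 * D <= w by move: w_ge; rewrite -/c; move: cE kE k2 E0 D0 k1; lra.
by rewrite -(ler_pM2r w0); move: h2 h3; lra.
Qed.

Let Np_le : N * p <= u ^+ k * (4 * (k%:R * l)).
Proof.
rewrite -nE; apply: le_trans (slab_mass_le d2 nuE iidmu n a0 ar) _.
rewrite nE -/La; apply: ler_pM => //; first exact: vol0.
apply: le_trans (vol_le r0 r_le_u) _; rewrite volE ler_pdivrMr//.
by rewrite ler_peMr ?exprn_ge0 ?(ltW u0)// ler1n fact_gt0.
Qed.

Let Npq_le : N * p * q <= 16 * k%:R * D * i ^+ 4.
Proof.
apply: (@le_trans _ _ (u ^+ k * (4 * (k%:R * l)) * q)); first by rewrite ler_wpM2r.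
apply: (@le_trans _ _ (4 * k%:R * D * (l / u))).
  rewrite [leRHS]mulrA ler_pdivlMr//.
  have -> : u ^+ k * (4 * (k%:R * l)) * q * u = 4 * (k%:R * l) * (q * u ^+ k.+1).
    by rewrite exprS; ring.
  have := ler_wpM2l (_ : 0 <= 4 * (k%:R * l)) q_pow; rewrite mulr_ge0 ?(ltW kl0)//.
  by move=> /(_ isT); lra.
have -> : 16 * k%:R * D * i ^+ 4 = 4 * k%:R * D * (4 * i ^+ 4) by ring.
rewrite ler_wpM2l ?mulr_ge0//; apply: le_trans lu _.
by rewrite ler_wpM2l// iX.
Qed.

Let F : R := (2 * k.+1)%:R ^+ (2 * k.+1).
Let F0 : 0 <= F. Proof. exact: exprn_ge0. Qed.

Let Np2_le : 4 * (N * p ^+ 2) <= 1024 * k%:R ^+ 2 * F * i ^+ 4.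
Proof.
have -> : N * p ^+ 2 = (N * p) ^+ 2 * expR (- u).
  by rewrite expRN -/N; field; rewrite gt_eqF.
apply: (@le_trans _ _ (4 * ((u ^+ k * (4 * (k%:R * l))) ^+ 2 * expR (- u)))).
  apply: ler_wpM2l => //; apply: ler_wpM2r; first exact: expR_ge0.
  have Np0 : 0 <= N * p by rewrite mulr_ge0// ltW.
  by rewrite lerXn2r ?nnegrE//; exact: le_trans Np_le.
have h : expR (- u) * u ^+ k.*2 * u ^+ 2 <= F.
  have := expRN_mul_pow (2 * k.+1) (ltW u0); rewrite -/F.
  by rewrite mulnS mul2n [(2 + _)%N]addnC exprD mulrA.
have {}h : expR (- u) * u ^+ k.*2 <= F / u ^+ 2 by rewrite ler_pdivlMr ?exprn_gt0.
have -> : 4 * ((u ^+ k * (4 * (k%:R * l))) ^+ 2 * expR (- u)) =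
    64 * k%:R ^+ 2 * l ^+ 2 * (expR (- u) * u ^+ k.*2).
  by rewrite -muln2 exprM; ring.
apply: (@le_trans _ _ (64 * k%:R ^+ 2 * l ^+ 2 * (F / u ^+ 2))).
  by rewrite ler_wpM2l// !mulr_ge0// ltW.
have -> : 64 * k%:R ^+ 2 * l ^+ 2 * (F / u ^+ 2) = 64 * k%:R ^+ 2 * F * (l / u) ^+ 2.
  by field; rewrite gt_eqF.
have -> : 1024 * k%:R ^+ 2 * F * i ^+ 4 = 64 * k%:R ^+ 2 * F * (16 * i ^+ 4) by ring.
rewrite ler_wpM2l ?mulr_ge0//.
apply: (@le_trans _ _ ((4 * i ^+ 8) ^+ 2)).
  have lu0 : 0 <= l / u by apply: divr_ge0; exact: ltW.
  by rewrite lerXn2r ?nnegrE//; exact: le_trans lu.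
have -> : (4 * i ^+ 8) ^+ 2 = 16 * i ^+ 16 by ring.
by rewrite ler_wpM2l// iX.
Qed.

Let li13 : l * i ^+ 13 = i ^+ 5. Proof. by rewrite /l /i; field. Qed.

Let cube_near : cube_bound (d := k.+1) n a r (i ^+ 6) <= 16 * k%:R * i ^+ 5.
Proof.
rewrite /cube_bound nE -/La ra /=.
have i61 : i ^+ 6 <= 80^-1 by apply: le_trans (iX (isT : (1 <= 6)%N)) _.
have e2 : expR (2 * i ^+ 6) <= 2.
  have x0 : 0 <= 2 * i ^+ 6 by rewrite mulr_ge0.
  by apply: le_trans (expR_le1D2 x0 _) _; move: i61; lra.
set x := 2 * i ^+ 6 * _.
have x0 : 0 <= x by apply: mulr_ge0; [exact: mulr_ge0|exact: expR_ge0].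
have x4 : x <= 4 * i ^+ 6.
  have := ler_wpM2l (_ : 0 <= 2 * i ^+ 6) e2; rewrite mulr_ge0// => /(_ isT).
  by rewrite -/x; lra.
have xk : x ^+ k <= 4 * i ^+ 6.
  apply: le_trans (x4); rewrite -[leRHS]expr1 ler_wiXn2l//.
  by apply: le_trans x4 _; move: i61; lra.
apply: (@le_trans _ _ (4 * (k%:R * l) * i ^+ 7 * (4 * i ^+ 6))).
  apply: ler_pM => //; first exact: mulr_ge0; first exact: exprn_ge0.
  by rewrite ler_wpM2r.
rewrite le_eqVlt; apply/orP; left; apply/eqP.
by rewrite -li13; ring.
Qed.

Let theta : R := expR (- (Lr * ((i ^+ 6 - (r - a)) / 4))).

Let cube_far : theta * cube_bound (d := k.+1) n a r w <= 4 * k%:R * E * i ^+ 5.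
Proof.
rewrite /cube_bound nE -/La ra /=.
have th : theta <= expR (- (k%:R * w ^+ 2 / 16)).
  rewrite ler_expR lerN2 ra.
  apply: (@le_trans _ _ (k%:R * l / 2 * (i ^+ 6 / 8))).
    by rewrite le_eqVlt; apply/orP; left; apply/eqP; rewrite /l /i; field.
  apply: ler_pM => //; [|by rewrite divr_ge0|].
    by rewrite divr_ge0// ltW.
  have : i ^+ 7 <= i ^+ 6 / 80 by rewrite exprSr ler_wpM2l.
  by have := iX0 6; lra.
have wk : (2 * w * expR (2 * w)) ^+ k <= expR (4 * (k%:R * w)).
  have -> : 4 * (k%:R * w) = k%:R * (4 * w) by ring.
  rewrite [leRHS]expRM_natl lerXn2r ?nnegrE ?expR_ge0//.
    by rewrite !mulr_ge0 ?expR_ge0// ltW.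
  have -> : 4 * w = 2 * w + 2 * w by ring.
  rewrite expRD ler_wpM2r ?expR_ge0//.
  by apply: le_trans (expR_ge1Dx _); lra.
have Lai : La * i ^+ 7 <= 4 * (k%:R * w).
  apply: (@le_trans _ _ (4 * (k%:R * l) * i ^+ 7)); first by rewrite ler_wpM2r.
  by rewrite -i7s; lra.
have wk0 : 0 <= k%:R * w by rewrite mulr_ge0// ltW.
apply: (@le_trans _ _ (expR (- (k%:R * w ^+ 2 / 16)) *
    (4 * (k%:R * w) * expR (4 * (k%:R * w))))).
  have x0 : 0 <= (2 * w * expR (2 * w)) ^+ k.
    by rewrite exprn_ge0// !mulr_ge0 ?expR_ge0// ltW.
  have La7 : 0 <= La * i ^+ 7 by exact: mulr_ge0.
  by apply: ler_pM => //; [exact: expR_ge0|exact: mulr_ge0|exact: ler_pM].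
rewrite mulrCA -expRD.
apply: (@le_trans _ _ (4 * (k%:R * w) * (E * i ^+ 14))); last first.
  have -> : 4 * (k%:R * w) * (E * i ^+ 14) = 4 * k%:R * E * i ^+ 13.
    by rewrite /i; field.
  by rewrite ler_wpM2l ?iX// !mulr_ge0.
rewrite ler_wpM2l ?mulr_ge0 ?(ltW w0)//; apply: le_trans decay.
rewrite ler_expR.
have : k%:R * w * 80 <= k%:R * w * w by rewrite ler_wpM2l.
have : w <= k%:R * w by rewrite ler_peMl// ltW.
by rewrite expr2 mulrA; move: w0; lra.
Qed.

Let deep_le : expR 1 * (vol a * expR (- La)) <= expR 1 * E * i ^+ 4.
Proof.
rewrite -mulrA ler_wpM2l ?expR_ge0//.
apply: (@le_trans _ _ (w * (E * i ^+ 14))).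
  apply: (@le_trans _ _ (vol u * (expR (- Lr) * (E * i ^+ 14)))).
    apply: ler_pM => //; first exact: vol0.
    exact: vol_le (le_trans ar r_le_u).
  rewrite mulrA; apply: ler_wpM2r; first exact: mulr_ge0.
  exact: le_trans vol_Lr_le lam_le.
have -> : w * (E * i ^+ 14) = E * i ^+ 13 by rewrite /i; field.
by rewrite ler_wpM2l// iX.
Qed.

(** The dominant terms are the relative error [i ^+ 6] times the square of the mean,
which is at most [w ^+ 2], and the mass [i ^+ 5] of the close pairs times the
mean. *)
Lemma min_norm_critical : `|fine (Q [set t | critical_height < min_norm t]) -
  expR (- lam)| <= error_cst R k * i ^+ 4.
Proof.
have e2 : i ^+ 6 - (r - a) <= 2.
  by have := iX (isT : (0 <= 6)%N); have := iX0 7; rewrite ra expr0; lra.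
have ei : r - a <= i ^+ 6 by rewrite ra iX.
have ra1 : r - a <= 1 by rewrite ra; move: i7_small; lra.
have := min_norm_poisson d2 nuE iidmu n0 iidQ a0 ar ra1 (iX0 6) ei e2 (ltW w0)
  eps0 eps2 (ltW lam_gt0).
rewrite !nE -/La -/Lr => /(_ kap_le La2_le zeta_le q_le m1_ge m1_le) h.
apply: le_trans h _; rewrite -/theta -/p -/q -/r.
set B := cube_bound _ _ _ _ + _.
have iw m : i ^+ m.+1 * w = i ^+ m by rewrite exprSr -mulrA mulVf// mulr1.
have B_le : B * w <= (16 * k%:R + 4 * k%:R * E) * i ^+ 4.
  rewrite -(iw 4%N) mulrA ler_wpM2r ?(ltW w0)//.
  by rewrite mulrDl; exact: lerD.
have B0 : 0 <= B.
  have cb x : 0 <= x -> 0 <= cube_bound (d := k.+1) n a r x.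
    move=> x0; rewrite /cube_bound nE -/La ra; apply: mulr_ge0.
      exact: mulr_ge0.
    by rewrite exprn_ge0// !mulr_ge0 ?expR_ge0.
  apply: addr_ge0; first exact: cb.
  by apply: mulr_ge0; [exact: expR_ge0|apply: cb; exact: ltW].
have lB : lam * B <= (16 * k%:R + 4 * k%:R * E) * i ^+ 4.
  apply: le_trans B_le; rewrite [leLHS]mulrC; exact: (ler_wpM2l B0 lam_le).
have el2 : eps * lam ^+ 2 <= c * i ^+ 4.
  have -> : c * i ^+ 4 = eps * w ^+ 2 by rewrite /eps -(iw 4%N) -(iw 5%N); ring.
  apply: ler_wpM2l => //.
  by rewrite lerXn2r ?nnegrE ?(ltW w0) ?(ltW lam_gt0).
have el : eps * lam <= c * i ^+ 4.
  apply: (@le_trans _ _ (eps * w)); first by rewrite ler_wpM2l.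
  by rewrite -mulrA iw ler_wpM2l// iX.
rewrite /error_cst -/c -/E -/D -/F.
move: lB el2 el Npq_le Np2_le deep_le.
by rewrite -/(vol a); lra.
Qed.

End critical_scale.

(** * Uniformity over all levels *)

Section uniformity.
Context {R : realType}.
Implicit Types t x : R.

(** Outside a window that carries almost all of [T], monotonicity and the values
at the ends of the window take over. *)
Lemma antitone_close (S T : R -> R) s0 s1 e delta : 0 <= delta ->
  {homo S : x y / x <= y >-> y <= x} -> {homo T : x y / x <= y >-> y <= x} ->
  (forall t, 0 <= S t <= 1) -> (forall t, 0 <= T t <= 1) -> s0 <= s1 ->
  (forall t, s0 <= t -> t <= s1 -> `|S t - T t| <= e) ->
  1 - delta <= T s0 -> T s1 <= delta -> forall t, `|S t - T t| <= e + delta.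
Proof.
move=> delta0 Santi Tanti S01 T01 s01 close T0 T1 t.
have /andP[St0 St1] := S01 t; have /andP[Tt0 Tt1] := T01 t.
have [n0 p0] : S s0 - T s0 <= e /\ T s0 - S s0 <= e.
  by have := close s0 (lexx _) s01; rewrite ler_norml => /andP[]; lra.
have [n1 p1] : S s1 - T s1 <= e /\ T s1 - S s1 <= e.
  by have := close s1 s01 (lexx _); rewrite ler_norml => /andP[]; lra.
have e0 : 0 <= e by apply: le_trans (close s0 (lexx _) s01).
have [ts0|/ltW s0t] := leP t s0.
  have := Santi _ _ ts0; have := Tanti _ _ ts0; rewrite ler_norml; lra.
have [s1t|/ltW ts1] := leP s1 t.
  have := Santi _ _ s1t; have := Tanti _ _ s1t; rewrite ler_norml; lra.
by apply: le_trans (close t s0t ts1) _; rewrite lerDl.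
Qed.

Variables (k : nat) (w : R).
Hypotheses (k0 : (0 < k)%N) (w_ge : 2 * eps_cst R k <= w).
Hypothesis w_fact : 4 * k`!%:R <= w.
Variable n : nat.
Hypothesis nE : n%:R = expR (expR (w ^+ 8)).
Variable nu : probability R R.
Hypothesis nuE : forall A : set R, measurable A -> nu A = exponential_prob 1 A.
Variable mu : probability (k.+1.-tuple R) R.
Hypothesis iidmu : iid_law nu mu.
Variable Q : probability (n.-tuple (k.+1.-tuple R)) R.
Hypothesis iidQ : iid_law mu Q.

Let lam (t : R) : R := expR (k%:R * t) / k`!%:R.
Let fact1 : 1 <= k`!%:R :> R. Proof. by rewrite ler1n fact_gt0. Qed.
Let k1 : 1 <= k%:R :> R. Proof. by rewrite ler1n. Qed.
Let w4 : 4 <= w. Proof. by move: w_fact fact1; lra. Qed.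
Let w0 : 0 < w. Proof. by move: w4; lra. Qed.

Let lam0 t : 0 <= lam t. Proof. by rewrite divr_ge0 ?expR_ge0. Qed.

Let lam_homo : {homo lam : x y / x <= y}.
Proof.
move=> x y xy; rewrite ler_wpM2r ?invr_ge0// ler_expR ler_wpM2l//.
Qed.

Let expRNw : expR (- w) <= 256 * w^-1 ^+ 4.
Proof.
have := expRN_mul_pow 4 (ltW w0); rewrite -natrX => h.
by rewrite exprVn ler_pdivlMr ?exprn_gt0.
Qed.

(* The level at which the limiting mean reaches [w]. *)
Let s1 : R := ln (k`!%:R * w) / k%:R.
Let fw0 : 0 < k`!%:R * w. Proof. by rewrite mulr_gt0// ltr0n fact_gt0. Qed.

Let lam_s1 : lam s1 = w.
Proof.
have kn0 : k%:R != 0 :> R by rewrite pnatr_eq0 -lt0n.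
rewrite /lam /s1 mulrCA divff// mulr1 lnK ?posrE//; field.
by rewrite pnatr_eq0 -lt0n fact_gt0.
Qed.

Let s1_ge0 : 0 <= s1.
Proof.
rewrite divr_ge0// ln_ge0//; apply: (@le_trans _ _ (1 * w)); last by rewrite ler_wpM2r// ltW.
by move: w4; lra.
Qed.

Let s1_le : s1 <= w.
Proof.
rewrite ler_pdivrMr ?ltr0n// -ler_expR lnK ?posrE//.
apply: (@le_trans _ _ (expR w)); last by rewrite ler_expR ler_peMr// ltW.
have := pow_le_expR 2 (ltW w0); rewrite -natrX.
have := ler_wpM2r (ltW w0) w_fact; rewrite expr2; lra.
Qed.

Let l0 : 0 < w ^+ 8. Proof. exact: exprn_gt0. Qed.

(** The window runs from [- w], where the limiting mean is at most [expR (- w)], to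
the level where it equals [w]. *)
Lemma min_norm_uniform t :
  `|fine (Q [set x | critical_height k w t < min_norm x]) - expR (- lam t)| <=
  (error_cst R k + 256) * w^-1 ^+ 4.
Proof.
rewrite mulrDl.
apply: (@antitone_close (fun t => fine (Q [set x | critical_height k w t < min_norm x]))
  (fun t => expR (- lam t)) (- w) s1).
- by rewrite mulr_ge0// exprn_ge0// invr_ge0 ltW.
- move=> x y xy /=; apply: fine_le; rewrite ?fin_num_measure//;
    try exact: measurable_min_norm_gt.
  apply: le_measure; rewrite ?inE; try exact: measurable_min_norm_gt.
  move=> z /=; apply: le_lt_trans.
  by rewrite lerD2l ler_wpM2r// invr_ge0 ltW.
- by move=> x y xy /=; rewrite ler_expR lerN2 lam_homo.
- move=> x /=; rewrite fine_ge0//= -lee_fin fineK ?fin_num_measure ?probability_le1//;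
    exact: measurable_min_norm_gt.
- by move=> x /=; rewrite expR_ge0/= expRN_le1.
- by apply: le_trans s1_ge0; rewrite oppr_le0 ltW.
- move=> x x0 x1 /=; apply: (min_norm_critical k0 w_ge x0 _ nE nuE iidmu iidQ).
    exact: le_trans s1_le.
  by rewrite -/(lam x) -lam_s1 lam_homo.
- apply: le_trans (expRN_ge _); rewrite lerB//; apply: le_trans expRNw.
  rewrite /lam ler_pdivrMr ?(lt_le_trans ltr01)//.
  apply: (@le_trans _ _ (expR (- w))).
    by rewrite ler_expR mulrN lerN2 ler_peMl// ltW.
  by rewrite ler_peMr// expR_ge0.
- by rewrite /= lam_s1.
Qed.

End uniformity.

(** * Laws of samples *)

Section sample.
Context {dT} {T : measurableType dT} {R : realType} {P : probability T R}.

Lemma independent_iid_law {dE} {E : measurableType dE} m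
    (Y : 'I_m -> {RV P >-> E}) (nu : probability E R) (Z : {RV P >-> m.-tuple E}) :
  mutually_independent P Y ->
  (forall i A, measurable A -> distribution P (Y i) A = nu A) ->
  (forall i t, tnth (Z t) i = Y i t) -> iid_law nu (distribution P Z).
Proof.
move=> indep law ZE A mA.
transitivity (P (\bigcap_(i in [set` [set: 'I_m]%SET]) (Y i @^-1` A i))).
  rewrite /distribution /pushforward; congr (P _); apply/seteqP; split=> t /= h i.
    by move=> _; rewrite /= -ZE.
  by rewrite ZE; apply: h; rewrite /= inE.
rewrite indep//; apply: eq_big => i; rewrite ?inE//= => _.
exact: law.
Qed.

Context {d n : nat}.
Hypotheses (d0 : (0 < d)%N) (n0 : (0 < n)%N).
Variable X : 'I_n -> {RV P >-> d.-tuple R}.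
Hypothesis vectors_independent : mutually_independent P X.
Hypothesis coordinates_independent :
  forall i, mutually_independent P (fun j : 'I_d => coordinate (X i) j).
Hypothesis coordinates_exponential :
  forall i j, has_exponential_distribution P 1 (coordinate (X i) j).

Let sample (t : T) : n.-tuple (d.-tuple R) := [tuple X i t | i < n].

Let measurable_sample : measurable_fun setT sample.
Proof.
apply/measurable_fun_tnthP => i.
rewrite (_ : _ \o _ = X i); first exact: measurable_funPT.
by apply/funext => t; rewrite /= tnth_mktuple.
Qed.

HB.instance Definition _ :=
  isMeasurableFun.Build _ _ _ _ sample measurable_sample.

(** The probability space only matters through the product law of the sample. *)
Lemma phi_law : exists (nu : probability R R) (mu : probability (d.-tuple R) R)
    (Q : probability (n.-tuple (d.-tuple R)) R),
  [/\ forall A : set R, measurable A -> nu A = exponential_prob 1 A,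
      iid_law nu mu, iid_law mu Q &
      forall r, P [set t | r < phi X t] = Q [set x | r < min_norm x]].
Proof.
pose i0 : 'I_n := Ordinal n0; pose j0 : 'I_d := Ordinal d0.
exists (distribution P (coordinate (X i0) j0)), (distribution P (X i0)),
  (distribution P sample).
have iidX i : iid_law (distribution P (coordinate (X i0) j0)) (distribution P (X i)).
  apply: (independent_iid_law (coordinates_independent i)) => // j A mA.
  rewrite [LHS](coordinates_exponential i j mA).
  by rewrite [RHS](coordinates_exponential i0 j0 mA).
split=> //.
- exact: coordinates_exponential.
- apply: (independent_iid_law vectors_independent) => [i A mA|i t].
    apply: tuple_measure_unique => // B mB.
    by rewrite [LHS](iidX i B mB) [RHS](iidX i0 B mB).
  by rewrite /= tnth_mktuple.
- move=> r; rewrite /distribution /pushforward; congr (P _).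
  apply/seteqP; split=> t /=; rewrite /phi /min_norm;
    by rewrite (_ : tnth (sample t) = fun i => X i t)//;
      apply/funext => i; rewrite tnth_mktuple.
Qed.

End sample.

(** * The limiting law *)

Section reflected_gumbel.
Context {R : realType} {dT} {T : measurableType dT} {P : probability T R}.

(** The distribution function has no jump, so that strict and weak
inequalities have the same probability. *)
Lemma standard_gumbel_lt (G0 : {RV P >-> R}) z : standard_gumbel P G0 ->
  fine (P [set t | G0 t < z]) = expR (- expR (- z)).
Proof.
move=> G0E; set b := expR (- z); have b0 : 0 < b by exact: expR_gt0.
have mlt : measurable [set t | G0 t < z].
  rewrite (_ : [set y | G0 y < z] = G0 @^-1` `]-oo, z[%classic).
    by rewrite -[X in measurable X]setTI; apply: measurable_funPT => //; exact: measurable_itv.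
  by apply/seteqP; split=> y /=; rewrite in_itv.
have mle x : measurable [set t | G0 t <= x].
  rewrite (_ : [set y | G0 y <= x] = G0 @^-1` `]-oo, x]%classic).
    by rewrite -[X in measurable X]setTI; apply: measurable_funPT => //; exact: measurable_itv.
  by apply/seteqP; split=> y /=; rewrite in_itv.
have leE x : P [set t | G0 t <= x] = (expR (- expR (- x)))%:E.
  by rewrite -G0E.
apply/eqP; rewrite eq_le; apply/andP; split.
  rewrite -lee_fin -leE fineK ?fin_num_measure//.
  by apply: le_measure; rewrite ?inE// => t /= /ltW.
apply/ler_addgt0Pr => e e0; rewrite -lerBlDr.
(* The point where the exponent in the distribution function is [b + e]. *)
pose x := - ln (b + e); have be0 : 0 < b + e by exact: addr_gt0.
have xz : x < z by rewrite ltrNl -ltr_expR lnK ?posrE// ltrDl.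
apply: (@le_trans _ _ (expR (- (b + e)))).
  have := expRN_sub (ltW b0) (_ : b <= b + e); rewrite lerDl ltW// => /(_ isT).
  by rewrite addrAC subrr add0r; lra.
rewrite -lee_fin fineK ?fin_num_measure// (_ : b + e = expR (- x)) -?leE; last first.
  by rewrite opprK lnK ?posrE.
by apply: le_measure; rewrite ?inE// => t /= /le_lt_trans; exact.
Qed.

Lemma reflected_gumbel_distribution_function k (G : {RV P >-> R}) t : (0 < k)%N ->
  has_gumbel_distribution P (- (ln k`!%:R / k%:R)) k%:R^-1 G ->
  distribution_function (distribution P (\- G)) t =
  1 - expR (- (expR (k%:R * t) / k`!%:R)).
Proof.
move=> k0 [G0 G0E GE]; have kR0 : 0 < k%:R :> R by rewrite ltr0n.
have f0 : 0 < k`!%:R :> R by rewrite ltr0n fact_gt0.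
pose z := ln k`!%:R - k%:R * t : R.
have mlt : measurable [set x | G0 x < z].
  rewrite (_ : [set y | G0 y < z] = G0 @^-1` `]-oo, z[%classic).
    by rewrite -[X in measurable X]setTI; apply: measurable_funPT => //; exact: measurable_itv.
  by apply/seteqP; split=> y /=; rewrite in_itv.
rewrite (_ : expR (k%:R * t) / k`!%:R = expR (- z)); last first.
  by rewrite /z opprB expRD expRN lnK ?posrE.
rewrite -(standard_gumbel_lt z G0E).
transitivity (fine (P (~` [set x | G0 x < z]))); last first.
  by rewrite probability_setC// fineB ?fin_num_measure.
congr (fine (P _)).
apply/seteqP; split=> x /=; rewrite in_itv/= GE.
  move=> h; apply/negP; rewrite -leNgt /z lerBlDr -lerBlDl.
  rewrite -(ler_pM2r (_ : 0 < k%:R^-1 :> R)) ?invr_gt0// [k%:R * t * _]mulrAC divff ?gt_eqF// mul1r.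
  by lra.
move=> /negP; rewrite -leNgt /z lerBlDr -lerBlDl.
rewrite -(ler_pM2r (_ : 0 < k%:R^-1 :> R)) ?invr_gt0// [k%:R * t * _]mulrAC divff ?gt_eqF// mul1r.
by lra.
Qed.

End reflected_gumbel.

(** * The centred minimum norm *)

Section loglog_root.
Context {R : realType}.
Implicit Type n : nat.

(** Taking an eighth root turns every exponent of the error estimates into an
integer. *)
Definition loglog_root n : R := iterlog 2 (n%:R : R) `^ 8^-1.

Lemma loglog_root_large (M : R) : 0 < M ->
  \forall n \near \oo, 0 < iterlog 2 (n%:R : R) /\ M <= loglog_root n.
Proof.
move=> M0; near=> n.
have nM : expR (expR (M ^+ 8)) <= n%:R by near: n; exact: nbhs_infty_ger.
have n0 : 0 < n%:R :> R by apply: lt_le_trans nM; exact: expR_gt0.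
have ln1 : expR (M ^+ 8) <= ln n%:R.
  by rewrite -[leLHS]expRK ler_ln ?posrE ?expR_gt0.
have ln0 : 0 < ln n%:R :> R by apply: lt_le_trans ln1; exact: expR_gt0.
have ln2 : M ^+ 8 <= iterlog 2 n%:R.
  by rewrite -[leLHS]expRK /iterlog /= ler_ln ?posrE ?expR_gt0.
have M8 : 0 < M ^+ 8 by exact: exprn_gt0.
split; first exact: lt_le_trans ln2.
have -> : M = (M ^+ 8) `^ 8^-1.
  by rewrite -powR_mulrn ?(ltW M0)// -powRrM mulfV ?pnatr_eq0// powRr1// ltW.
apply: ge0_ler_powR; rewrite ?nnegrE ?(ltW M8)//.
exact: le_trans (ltW M8) ln2.
Unshelve. all: by end_near. Qed.

Variable n : nat.
Hypothesis l0 : 0 < iterlog 2 (n%:R : R).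
Let w : R := loglog_root n.

Lemma loglog_rootX8 : w ^+ 8 = iterlog 2 n%:R.
Proof.
rewrite -powR_mulrn ?powR_ge0// /w /loglog_root -powRrM mulVf ?pnatr_eq0//.
by rewrite powRr1// ltW.
Qed.

Lemma iterlog1_loglog : iterlog 1 (n%:R : R) = expR (w ^+ 8).
Proof.
rewrite loglog_rootX8 /iterlog /= lnK// posrE ltNge; apply/negP => h.
by move: l0; rewrite /iterlog/= (ln0 h) ltxx.
Qed.

Lemma natr_loglog : n%:R = expR (expR (w ^+ 8)).
Proof.
rewrite -iterlog1_loglog /iterlog /= lnK// posrE ltNge; apply/negP => h.
by move: l0; rewrite /iterlog/= (ln0 h) (ln0 (lexx _)) ltxx.
Qed.

Lemma loglog_rootV4 : w^-1 ^+ 4 = iterlog 2 (n%:R : R) `^ (- 2^-1).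
Proof.
rewrite exprVn -powR_mulrn ?powR_ge0// /w /loglog_root -powRrM powRN.
by congr (_ `^ _)^-1; field.
Qed.

End loglog_root.

Section centred_minimum.
Context {dT} {T : measurableType dT} {R : realType} {P : probability T R}.
Variables (k n : nat) (X : 'I_n -> {RV P >-> k.+1.-tuple R}).
Hypothesis k0 : (0 < k)%N.
Hypothesis vectors_independent : mutually_independent P X.
Hypothesis coordinates_independent :
  forall i, mutually_independent P (fun j : 'I_k.+1 => coordinate (X i) j).
Hypothesis coordinates_exponential :
  forall i j, has_exponential_distribution P 1 (coordinate (X i) j).
Hypothesis l0 : 0 < iterlog 2 (n%:R : R).
Let w : R := loglog_root n.
Hypotheses (w_ge : 2 * eps_cst R k <= w) (w_fact : 4 * k`!%:R <= w).

Lemma phi_circ_gt t x : (t < phi_circ X x) = (critical_height k w t < phi X x).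
Proof.
rewrite /phi_circ /critical_height iterlog1_loglog// -/w.
rewrite (_ : iterlog 3 n%:R = ln (iterlog 2 n%:R))//.
rewrite -(loglog_rootX8 l0) -/w.
have l1 : 0 < w ^+ 8 by rewrite loglog_rootX8.
by rewrite -ltr_pdivrMl// mulrC ltrBrDl.
Qed.

Lemma phi_circ_close t :
  `|distribution_function (distribution P (phi_circ X)) t -
    (1 - expR (- (expR (k%:R * t) / k`!%:R)))| <=
  (error_cst R k + 256) * w^-1 ^+ 4.
Proof.
have n0 : (0 < n)%N by rewrite -(ltr0n R) (natr_loglog l0) expR_gt0.
have [nu [mu [Q [nuE iidmu iidQ PQ]]]] := phi_law (ltn0Sn k) n0
  vectors_independent coordinates_independent coordinates_exponential.
have mgt : measurable [set x | critical_height k w t < phi X x].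
  rewrite (_ : [set _ | _] = phi X @^-1` `]critical_height k w t, +oo[%classic).
    by rewrite -[X in measurable X]setTI; apply: measurable_funPT => //; exact: measurable_itv.
  by apply/seteqP; split=> x /=; rewrite in_itv/= andbT.
have -> : distribution_function (distribution P (phi_circ X)) t =
    1 - fine (Q [set x | critical_height k w t < min_norm x]).
  transitivity (fine (P (~` [set x | critical_height k w t < phi X x]))).
    congr (fine (P _)); apply/seteqP; split=> x /=; rewrite in_itv/= -phi_circ_gt.
      by move=> h; apply/negP; rewrite -leNgt.
    by move=> /negP; rewrite -leNgt.
  by rewrite probability_setC// fineB ?fin_num_measure// PQ.
rewrite -normrN !opprB addrC addrA subrK.
exact: (min_norm_uniform k0 w_ge w_fact (natr_loglog l0) nuE iidmu iidQ).
Qed.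

End centred_minimum.

Theorem theorem1p1 (R : realType) (d : nat) (hd : (2 <= d)%N)
    (disp : nat -> measure_display)
    (Omega : forall n : nat, measurableType (disp n))
    (P : forall n : nat, probability (Omega n) R)
    (X : forall n : nat, 'I_n -> {RV (P n) >-> d.-tuple R})
    (vectors_independent :
       forall n : nat, mutually_independent (P n) (X n))
    (coordinates_independent :
       forall (n : nat) (i : 'I_n),
         mutually_independent (P n) (fun j : 'I_d => coordinate (X n i) j))
    (coordinates_exponential :
       forall (n : nat) (i : 'I_n) (j : 'I_d),
         has_exponential_distribution (P n) 1 (coordinate (X n i) j))
    (dispG : measure_display) (OmegaG : measurableType dispG)
    (PG : probability OmegaG R) (G : {RV PG >-> R})
    (G_gumbel :
       has_gumbel_distribution PG
         (- (ln (d.-1)`!%:R / d.-1%:R)) (d.-1%:R^-1) G) :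
  cvg_in_distribution
    (fun n => distribution (P n) (phi_circ (X n)))
    (distribution PG (\- G))
  /\
  (fun n : nat => kolmogorov_distance
     (distribution (P n) (phi_circ (X n))) (distribution PG (\- G)))
  =O_\oo
  (fun n : nat => (iterlog 2 (n%:R : R)) `^ (- 2^-1) * iterlog 3 (n%:R : R)).
Proof.
case: d hd X vectors_independent coordinates_independent coordinates_exponential
  G_gumbel => [//|k] k0 X indep cindep cexp G_gumbel.
pose C : R := `|error_cst R k + 256|.
have C0 : 0 <= C by exact: normr_ge0.
have [W [W1 We Wf]] : exists W : R,
    [/\ 1 <= W, 2 * eps_cst R k <= W & 4 * k`!%:R <= W].
  exists (1 + `|2 * eps_cst R k| + 4 * k`!%:R).
  have := ler_norm (2 * eps_cst R k); have := normr_ge0 (2 * eps_cst R k).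
  by have : 0 <= k`!%:R :> R by []; split; lra.
have W0 : 0 < W by apply: lt_le_trans W1.
have close n t : 0 < iterlog 2 (n%:R : R) -> W <= loglog_root n ->
    `|distribution_function (distribution (P n) (phi_circ (X n))) t -
      distribution_function (distribution PG (\- G)) t| <=
    C * (loglog_root n)^-1 ^+ 4.
  move=> l0 Ww.
  rewrite (reflected_gumbel_distribution_function t k0 G_gumbel).
  apply: le_trans (phi_circ_close k0 (indep n) (cindep n) (cexp n) l0
    (le_trans We Ww) (le_trans Wf Ww) t) _.
  by rewrite ler_wpM2r ?ler_norm// exprn_ge0// invr_ge0 powR_ge0.
split.
  move=> t _; apply/cvgrPdist_le => e e0.
  have Ce : 0 <= C / e by rewrite divr_ge0// ltW.
  near=> n.
  have [l0 Mw] : 0 < iterlog 2 (n%:R : R) /\ W + C / e <= loglog_root n.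
    near: n; apply: loglog_root_large; exact: ltr_pwDl.
  rewrite distrC; apply: le_trans (close n t l0 _) _; first by lra.
  set w := loglog_root n in Mw *.
  have w0 : 0 < w by lra.
  have w1 : 1 <= w by lra.
  rewrite exprVn ler_pdivrMr ?exprn_gt0//.
  apply: (@le_trans _ _ (e * w)).
    by rewrite -ler_pdivrMl// mulrC; lra.
  by rewrite ler_wpM2l ?(ltW e0)// -[leLHS]expr1 ler_weXn2l.
apply/eqOP; near=> K; near=> n.
have [l0 Mw] : 0 < iterlog 2 (n%:R : R) /\ W + expR 1 <= loglog_root n.
  near: n; apply: loglog_root_large; rewrite ltr_pwDl//.
have CK : C <= K by near: K; apply: nbhs_pinfty_ge; exact: num_real.
have Ww : W <= loglog_root n by have := expR_gt0 (1 : R); lra.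
set w := loglog_root n in Mw Ww *.
have w1 : expR 1 <= w by lra.
have L3 : 1 <= iterlog 3 (n%:R : R).
  rewrite (_ : iterlog 3 n%:R = ln (iterlog 2 n%:R))// -[leLHS]expRK.
  rewrite ler_ln ?posrE ?expR_gt0// -(loglog_rootX8 l0) -/w.
  apply: (le_trans w1); rewrite -[leLHS]expr1 ler_weXn2l//.
  by apply: le_trans (w1); rewrite -[leLHS]expR0 ler_expR.
have i0 : 0 <= w^-1 ^+ 4 by rewrite exprn_ge0// invr_ge0 powR_ge0.
have bound t : `|distribution_function (distribution (P n) (phi_circ (X n))) t -
    distribution_function (distribution PG (\- G)) t| <= C * w^-1 ^+ 4.
  exact: close.
have d0 : 0 <= kolmogorov_distance (distribution (P n) (phi_circ (X n)))
    (distribution PG (\- G)).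
  apply: le_trans (ub_le_sup _ (_ : _ (`|distribution_function
    (distribution (P n) (phi_circ (X n))) 0 -
    distribution_function (distribution PG (\- G)) 0|))) => //.
  by exists (C * w^-1 ^+ 4) => _ [t _ <-]; exact: bound.
rewrite ger0_norm// -loglog_rootV4 -/w.
rewrite ger0_norm; last by rewrite mulr_ge0// (le_trans ler01).
apply: ge_sup.
  by exists (`|distribution_function (distribution (P n) (phi_circ (X n))) 0 -
    distribution_function (distribution PG (\- G)) 0|), 0.
move=> _ [t _ <-]; apply: le_trans (bound t) _.
apply: (@le_trans _ _ (K * w^-1 ^+ 4)); first by rewrite ler_wpM2r.
by rewrite ler_wpM2l ?(le_trans _ CK)// ler_peMr.
Unshelve. all: by end_near. Qed.
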